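(* For every $n\ge1$ the (stationary) solution $F_n$ of the $SU(2)$ Yang–Mills equations $\nabla_\alpha F^{\alpha\beta}+[A_\alpha,F^{\alpha\beta}]=0$ on the exterior of the Schwarzschild black hole is unstable. More precisely, for every $n\ge 1$ there exist $\epsilon_0>0$ and a sequence of initial data giving rise to curvatures $F_{0,n}^{j}$, $j\in\mathbb N$, at time $t=0$ with $$E^{(\partial_t)}(F_{0,n}^{j}-F_n)\to0\quad(j\to\infty),$$ but such that for all $j$ $$\sup_{t\ge0}E^{(\partial_t)}(F_n^{j}(t)-F_n)\ge\epsilon_0,$$ where $F_n^{j}(t)$ is the solution of the Yang–Mills equations associated to the initial data corresponding to the curvature $F_{0,n}^{j}$.
   Context: Spacetime: for $m>0$, $\mathcal M=\mathbb R_t\times(2m,\infty)_r\times S^2$ with metric $g=N(-dt^2+dx^2)+r^2d\sigma^2$, $N=1-\frac{2m}{r}$, $\frac{dx}{dr}=N^{-1}$, $d\sigma^2=d\theta^2+\sin^2\theta\,d\phi^2$. Put $P=N/r^2$ (a function of $x\in\mathbb R$ via $r=r(x)$), $\dot{}=\partial_t$, $'=\partial_x$. Gauge fields: $\tau_1=\frac i2\begin{pmatrix}0&1\\1&0\end{pmatrix}$, $\tau_2=\frac12\begin{pmatrix}0&-1\\1&0\end{pmatrix}$, $\tau_3=\frac i2\begin{pmatrix}1&0\\0&-1\end{pmatrix}$ is a basis of $su(2)$, and the curvature of an $su(2)$-valued one-form $A$ is $F_{\alpha\beta}=\nabla_\alpha A_\beta-\nabla_\beta A_\alpha+[A_\alpha,A_\beta]$.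 Purely magnetic Ansatz: one considers initial data which, after a gauge transformation, are of the form $A_t=A_r=0$, $A_\theta=-W_0\tau_1$, $A_\phi=-W_0\sin\theta\,\tau_2+\cos\theta\,\tau_3$, $F_{\theta t}=W_1\tau_1$, $F_{\phi t}=W_1\sin\theta\,\tau_2$, $F_{rt}=0$ at $t=0$, with $W_0,W_1$ functions of $r$. The Ansatz is preserved by evolution: the solution is $A=-W\tau_1d\theta-W\sin\theta\,\tau_2d\phi+\cos\theta\,\tau_3d\phi$ with $\ddot W-W''+PW(W^2-1)=0$, $W(0)=W_0$, $\partial_tW(0)=W_1$, and its curvature has components $F_{\theta x}=W'\tau_1$, $F_{\theta t}=\dot W\tau_1$, $F_{\phi x}=W'\sin\theta\,\tau_2$, $F_{\phi t}=\dot W\sin\theta\,\tau_2$, $F_{tx}=0$, $F_{\theta\phi}=(W^2-1)\sin\theta\,\tau_3$. Differences of curvatures are taken in this gauge. Stationary solutions: $(a_n)_{n\ge1}$ is a decreasing sequence with $0<\dots<a_n<\dots<a_1=\frac{1+\sqrt3}{3\sqrt3+5}$, and $W_n$ ($n\ge1$) is a smooth solution of $-W_n''+PW_n(W_n^2-1)=0$ with $-1\le W_n\le1$, $\lim_{x\to-\infty}W_n=a_n$, $\lim_{x\to\infty}W_n=(-1)^n$, having exactly $n$ zeros (such sequences exist). $F_n$ is the curvature of $A=-W_n\tau_1d\theta-W_n\sin\theta\,\tau_2d\phi+\cos\theta\,\tau_3d\phi$, that is, the curvature with components $F_{\theta x}=W_n'\tau_1$, $F_{\theta t}=0$, $F_{\phi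 x}=W_n'\sin\theta\,\tau_2$, $F_{\phi t}=0$, $F_{tx}=0$, $F_{\theta\phi}=(W_n^2-1)\sin\theta\,\tau_3$ (the case $W=W_n$, $\dot W=0$). Energy: with an Ad-invariant scalar product $\langle\cdot,\cdot\rangle$ on $su(2)$, $T_{\mu\nu}=\langle F_{\mu\beta},F_\nu{}^\beta\rangle-\frac14g_{\mu\nu}\langle F_{\alpha\beta},F^{\alpha\beta}\rangle$, $J_\mu(X)=X^\nu T_{\mu\nu}$, and $E^{(\partial_t)}(F(t))=\int_{\Sigma_t}J_\mu(\partial_t)n^\mu d_{\Sigma_t}$, where $\Sigma_{t_0}=\{t=t_0\}$, $n$ is its unit normal and $d_{\Sigma_t}$ its induced volume. With the appropriate normalization, for the curvature of $(W,\dot W)$ this equals $\int_{\mathbb R}\dot W^2+(W')^2+\frac P2(W^2-1)^2\,dx$; accordingly, for the difference of the curvature of $(W,\dot W)$ and $F_n$, $$E^{(\partial_t)}(F-F_n)=\int_{\mathbb R}\dot W^2+(W'-W_n')^2+\frac P2(W^2-W_n^2)^2\,dx .$$ *)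

(* Defs.v *)
From HB Require Import structures.
From mathcomp Require Import all_boot all_order all_algebra.
From mathcomp Require Import complex.
From mathcomp Require Import all_classical all_reals all_analysis.

Set Implicit Arguments.
Unset Strict Implicit.
Unset Printing Implicit Defensive.

Import Order.TTheory GRing.Theory Num.Theory.
Import numFieldNormedType.Exports.

Local Open Scope classical_set_scope.
Local Open Scope ring_scope.
Local Open Scope complex_scope.

(* Spacetime is covered, up to the poles of the spheres, by the coordinates
   (t, x, theta, phi), numbered 0, 1, 2, 3 in this order; x is the tortoise
   coordinate, so that it ranges over the whole real line. *)

Definition ix_t : 'I_4 := @Ordinal 4 0 isT.
Definition ix_x : 'I_4 := @Ordinal 4 1 isT.
Definition ix_theta : 'I_4 := @Ordinal 4 2 isT.
Definition ix_phi : 'I_4 := @Ordinal 4 3 isT.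

Definition event (R : realType) (t x theta phi : R) : 'rV[R]_4 :=
  \row_(i < 4) nth 0 [:: t; x; theta; phi] i.

Definition partial (R : realType) (a : 'I_4) (f : 'rV[R]_4 -> R)
  (p : 'rV[R]_4) : R := 'D_(delta_mx 0 a) f p.

(* [xs] is the map r |-> x on (2m, oo) with dx/dr = 1 / N, and [r] is its
   inverse.  The additive constant in x is left free. *)
Definition tortoise (R : realType) (m : R) (xs r : R -> R) : Prop :=
  [/\ forall rho, 2 * m < rho ->
        is_derive rho 1 xs (1 - 2 * m / rho)^-1,
      forall x, 2 * m < r x
    & forall x, xs (r x) = x].

Definition lapse (R : realType) (m : R) (r : R -> R) (x : R) : R :=
  1 - 2 * m / r x.

Definition potential (R : realType) (m : R) (r : R -> R) (x : R) : R :=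
  lapse m r x / r x ^+ 2.

Definition metric (R : realType) (m : R) (r : R -> R) (p : 'rV[R]_4) : 'M[R]_4 :=
  let x := p 0 ix_x in
  let theta := p 0 ix_theta in
  diag_mx (event (- lapse m r x) (lapse m r x)
                 (r x ^+ 2) (r x ^+ 2 * sin theta ^+ 2)).

Definition inv_metric (R : realType) (m : R) (r : R -> R) (p : 'rV[R]_4) :
  'M[R]_4 := invmx (metric m r p).

(* Gamma^c_{ab} *)
Definition christoffel (R : realType) (m : R) (r : R -> R) (c a b : 'I_4)
    (p : 'rV[R]_4) : R :=
  2^-1 * \sum_(d < 4) inv_metric m r p c d *
    (partial a (fun q => metric m r q d b) p
     + partial b (fun q => metric m r q d a) p
     - partial d (fun q => metric m r q a b) p).

Definition mx2 (T : nzRingType) (a b c d : T) : 'M[T]_2 :=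
  \matrix_(i < 2, j < 2) nth 0 (nth [::] [:: [:: a; b]; [:: c; d]] i) j.

Definition tau1 (R : realType) : 'M[R[i]]_2 :=
  (0 +i* 2^-1) *: mx2 0 1 1 0.
Definition tau2 (R : realType) : 'M[R[i]]_2 :=
  (2^-1)%:C *: mx2 0 (- 1) 1 0.
Definition tau3 (R : realType) : 'M[R[i]]_2 :=
  (0 +i* 2^-1) *: mx2 1 0 0 (- 1).

Definition lie (R : realType) (X Y : 'M[R[i]]_2) : 'M[R[i]]_2 :=
  X *m Y - Y *m X.

(* The Ad-invariant scalar product on su(2), unique up to a positive factor,
   with |tau_i|^2 = 1 / (4 pi): this is the normalization for which the energy
   below is \int \dot W^2 + W'^2 + P/2 (W^2 - 1)^2 dx, without a factor 4 pi
   coming from the area of the sphere. *)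
Definition su2_dot (R : realType) (X Y : 'M[R[i]]_2) : R :=
  - (2 * pi)^-1 * complex.Re (\tr (X *m Y)).

Definition one_form (R : realType) := 'rV[R]_4 -> 'I_4 -> 'M[R[i]]_2.
Definition two_tensor (R : realType) :=
  'rV[R]_4 -> 'I_4 -> 'I_4 -> 'M[R[i]]_2.

(* Partial derivative of a matrix-valued function, entry by entry and for the
   real and imaginary parts separately, the parameter being real. *)
Definition partialM (R : realType) (a : 'I_4) (f : 'rV[R]_4 -> 'M[R[i]]_2)
    (p : 'rV[R]_4) : 'M[R[i]]_2 :=
  \matrix_(i < 2, j < 2)
    (partial a (fun q => complex.Re (f q i j)) p
     +i* partial a (fun q => complex.Im (f q i j)) p).

(* nabla_a A_b *)
Definition cov1 (R : realType) (m : R) (r : R -> R) (A : one_form R)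
    (p : 'rV[R]_4) (a b : 'I_4) : 'M[R[i]]_2 :=
  partialM a (fun q => A q b) p
  - \sum_(c < 4) (christoffel m r c a b p)%:C *: A p c.

Definition curvature (R : realType) (m : R) (r : R -> R) (A : one_form R) :
    two_tensor R :=
  fun p a b => cov1 m r A p a b - cov1 m r A p b a + lie (A p a) (A p b).

(* F^{ab} *)
Definition raise2 (R : realType) (m : R) (r : R -> R) (F : two_tensor R) :
    two_tensor R :=
  fun p a b => \sum_(c < 4) \sum_(d < 4)
    (inv_metric m r p a c * inv_metric m r p b d)%:C *: F p c d.

(* nabla_c G^{ab}, for a tensor G with two upper indices *)
Definition cov_up2 (R : realType) (m : R) (r : R -> R) (G : two_tensor R)
    (p : 'rV[R]_4) (c a b : 'I_4) : 'M[R[i]]_2 :=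
  partialM c (fun q => G q a b) p
  + \sum_(d < 4) (christoffel m r a c d p)%:C *: G p d b
  + \sum_(d < 4) (christoffel m r b c d p)%:C *: G p a d.

Definition yang_mills (R : realType) (m : R) (r : R -> R) (A : one_form R) :
    Prop :=
  let G := raise2 m r (curvature m r A) in
  forall (t x theta phi : R), 0 < theta < pi ->
  let p := event t x theta phi in
  forall b : 'I_4, \sum_(a < 4) (cov_up2 m r G p a a b + lie (A p a) (G p a b)) = 0.

Definition stress_energy (R : realType) (m : R) (r : R -> R) (F : two_tensor R)
    (p : 'rV[R]_4) (a b : 'I_4) : R :=
  \sum_(c < 4) \sum_(d < 4)
     inv_metric m r p c d * su2_dot (F p a c) (F p b d)
  - 4^-1 * metric m r p a b *
    \sum_(c < 4) \sum_(d < 4) su2_dot (F p c d) (raise2 m r F p c d).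

Definition current (R : realType) (m : R) (r : R -> R) (F : two_tensor R)
    (X : 'rV[R]_4 -> 'I_4 -> R) (p : 'rV[R]_4) (a : 'I_4) : R :=
  \sum_(b < 4) X p b * stress_energy m r F p a b.

Definition vec_dt (R : realType) (p : 'rV[R]_4) (a : 'I_4) : R :=
  (a == ix_t)%:R.

(* n = N^{-1/2} \partial_t, future-directed *)
Definition slice_normal (R : realType) (m : R) (r : R -> R) (p : 'rV[R]_4)
    (a : 'I_4) : R :=
  (Num.sqrt (lapse m r (p 0 ix_x)))^-1 * vec_dt p a.

Definition slice_density (R : realType) (m : R) (r : R -> R) (p : 'rV[R]_4) : R :=
  Num.sqrt (\det (row' ix_t (col' ix_t (metric m r p)))).

Definition energy_density (R : realType) (m : R) (r : R -> R)
    (F : two_tensor R) (p : 'rV[R]_4) : R :=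
  (\sum_(a < 4) current m r F (@vec_dt R) p a * slice_normal m r p a)
    * slice_density m r p.

Definition energy (R : realType) (m : R) (r : R -> R) (F : two_tensor R) (t : R) :
    \bar R :=
  (\int[@lebesgue_measure R]_(x in [set: R])
   \int[@lebesgue_measure R]_(theta in `]0, pi[%classic%R)
   \int[@lebesgue_measure R]_(phi in `]0, 2 * pi[%classic%R)
     (energy_density m r F (event t x theta phi))%:E)%E.

Definition tensor_sub (R : realType) (F G : two_tensor R) : two_tensor R :=
  fun p a b => F p a b - G p a b.

Definition magnetic_connection (R : realType) (W : R -> R -> R) : one_form R :=
  fun p a =>
    let w := W (p 0 ix_t) (p 0 ix_x) in
    let theta := p 0 ix_theta in
    if a == ix_theta then - (w%:C *: tau1 R)
    else if a == ix_phi then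
      - ((w * sin theta)%:C *: tau2 R) + (cos theta)%:C *: tau3 R
    else 0.

(* The curvature on a slice carrying the data W = W0, \partial_t W = W1,
   antisymmetrized from its components of indices theta x, theta t, phi x,
   phi t, theta phi. *)
Definition magnetic_curvature (R : realType) (W0 W1 : R -> R) : two_tensor R :=
  fun p a b =>
    let x := p 0 ix_x in
    let theta := p 0 ix_theta in
    let half (a b : 'I_4) :=
      if (a == ix_theta) && (b == ix_x) then (derive1 W0 x)%:C *: tau1 R
      else if (a == ix_theta) && (b == ix_t) then (W1 x)%:C *: tau1 R
      else if (a == ix_phi) && (b == ix_x) then
        (derive1 W0 x * sin theta)%:C *: tau2 R
      else if (a == ix_phi) && (b == ix_t) then
        (W1 x * sin theta)%:C *: tau2 R
      else if (a == ix_theta) && (b == ix_phi) then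
        ((W0 x ^+ 2 - 1) * sin theta)%:C *: tau3 R
      else 0 in
    half a b - half b a.

Definition d_t (R : realType) (f : R -> R -> R) (t x : R) : R :=
  derive1 (fun s => f s x) t.
Definition d_x (R : realType) (f : R -> R -> R) (t x : R) : R := derive1 (f t) x.

Definition class_C1 (R : realType) (f : R -> R -> R) : Prop :=
  [/\ forall t x, derivable (fun s => f s x) t 1,
      forall t x, derivable (f t) x 1,
      continuous (fun q : R * R => d_t f q.1 q.2)
    & continuous (fun q : R * R => d_x f q.1 q.2)].

Definition class_C2 (R : realType) (f : R -> R -> R) : Prop :=
  [/\ class_C1 f, class_C1 (d_t f) & class_C1 (d_x f)].

(* The connection of profile W is a global classical solution of the
   Yang-Mills equations with purely magnetic initial data (W0, W1). *)
Definition magnetic_solution (R : realType) (m : R) (r : R -> R)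
    (W0 W1 : R -> R) (W : R -> R -> R) : Prop :=
  [/\ class_C2 W,
      forall x, W 0 x = W0 x,
      forall x, d_t W 0 x = W1 x
    & yang_mills m r (magnetic_connection W)].

Definition smooth (R : realType) (f : R -> R) : Prop :=
  forall (k : nat) (x : R), derivable (derive1n k f) x 1.

(* Index 0 is unused: the families are indexed by n >= 1. *)
Record stationary_family (R : realType) (m : R) (r : R -> R)
    (a : nat -> R) (W : nat -> R -> R) : Prop := StationaryFamily {
  sf_a1 : a 1%N = (1 + Num.sqrt 3) / (3 * Num.sqrt 3 + 5);
  sf_pos : forall n, (0 < n)%N -> 0 < a n;
  sf_decr : forall n, (0 < n)%N -> a n.+1 < a n;
  sf_smooth : forall n, (0 < n)%N -> smooth (W n);
  sf_eq : forall n, (0 < n)%N -> forall x,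
    - derive1n 2 (W n) x + potential m r x * W n x * (W n x ^+ 2 - 1) = 0;
  sf_bound : forall n, (0 < n)%N -> forall x, -1 <= W n x <= 1;
  sf_horizon : forall n, (0 < n)%N -> W n x @[x --> -oo] --> a n;
  sf_infinity : forall n, (0 < n)%N -> W n x @[x --> +oo] --> (-1 : R) ^+ n;
  sf_zeros : forall n, (0 < n)%N -> ([set x | W n x = 0] #= `I_n)%card
}.

(* Main.v *)
(* Linearize the equation for W at the static profile W_n. The generator of
   dilations r W_n'(r), cut off far away, makes the quadratic form of
   - d^2/dx^2 + P (3 W_n^2 - 1) negative; positive solutions on growing
   intervals, vanishing at the right end, then converge to a positive square
   integrable phi with phi'' = (P (3 W_n^2 - 1) + mu) phi, mu > 0. The data
   W_n + eps phi and eps sqrt(mu) phi start the growing mode th(t) phi,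
   th(t) = eps e^{sqrt(mu) t}. For the remainder g = W - W_n - th phi one uses,
   on the backward light cone of a compact interval, the energy
   g_t^2 + (g' - w g)^2 + mu g^2, w = phi'/phi, whose growth rate 3 sqrt(mu) is
   smaller than the rate 4 sqrt(mu) of its source, of order th^4: a bootstrap
   keeps it of order th^4. Hence when th has reached a fixed small value, however
   small eps was, the energy on [-1, 1] is bounded below.
   Global solutions come from Duhamel's formula with the cubic truncated at
   height M, since the energy on light cones bounds W independently of M. *)

(* The obstacle is coercivity. Where [W_n] vanishes the linearized potential [P (3 W_n^2 - 1)] is
   negative, so the quadratic form conserved by the linearized flow is indefinite and bounds
   nothing. Factoring the operator through the positive [phi] turns this form into
   [g_t^2 + (g' - w g)^2 - mu g^2]; changing the last sign makes it coercive at the price of a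
   growth rate [2 sqrt mu], and absorbing the source costs another [sqrt mu]. The total stays below
   [4 sqrt mu] because the source is quadratic in a perturbation of size [th], hence its square is
   of order [th^4]. Dilations appear because for [m = 0] the static equation is scale invariant, so
   that [r W'(r)] is annihilated by the linearized operator. For [m > 0] what is left over acquires,
   after one integration by parts, a negative sign that does not depend on [n]. The mode [phi] is
   obtained by shooting and compactness. Its square integrability makes the initial energies tend to
   zero and bounds the source on arbitrarily long slices. All other estimates live on compact slices
   of light cones, whose boundary flux has the good sign. *)
Require Import Defs.
From HB Require Import structures.
From mathcomp Require Import all_boot all_order all_algebra.
From mathcomp Require Import complex.
From mathcomp Require Import all_classical all_reals all_analysis.
From mathcomp Require Import measurable_realfun ring lra.

Set Implicit Arguments.
Unset Strict Implicit.
Unset Printing Implicit Defensive.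

Import Order.TTheory GRing.Theory Num.Theory.
Import numFieldNormedType.Exports.

Local Open Scope classical_set_scope.
Local Open Scope ring_scope.

(** * Derivatives and continuity *)

(* [is_derive] is a class; hiding it keeps [apply:] and [rewrite] from launching
   instance search on the derivative hypotheses. *)
Definition has_deriv (R : realType) (f : R -> R) (x l : R) : Prop :=
  is_derive x 1 f l.

Section one_variable.
Context {R : realType}.
Implicit Types (f g : R -> R) (a b c x : R).

Lemma has_deriv_val f x a b : has_deriv f x a -> a = b -> has_deriv f x b.
Proof. by move=> fa <-. Qed.

Lemma d_cst c x : has_deriv (fun=> c) x 0.
Proof. exact: is_derive_cst. Qed.

Lemma d_id x : has_deriv (fun y : R => y) x 1.
Proof. exact: is_derive_id. Qed.

Lemma d_D f g x a b : has_deriv f x a -> has_deriv g x b ->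
  has_deriv (fun y => f y + g y) x (a + b).
Proof. by move=> fa gb; exact: is_deriveD. Qed.

Lemma d_N f x a : has_deriv f x a -> has_deriv (fun y => - f y) x (- a).
Proof. by move=> fa; exact: is_deriveN. Qed.

Lemma d_M f g x a b : has_deriv f x a -> has_deriv g x b ->
  has_deriv (fun y => f y * g y) x (a * g x + f x * b).
Proof.
move=> fa gb; apply: (has_deriv_val (@is_deriveM _ _ f g x 1 a b fa gb)).
by rewrite /GRing.scale/= addrC (mulrC (g x)).
Qed.

Lemma d_X f n x a : has_deriv f x a ->
  has_deriv (fun y => f y ^+ n) x (n%:R * f x ^+ n.-1 * a).
Proof.
move=> fa; have := @is_deriveX _ _ f n x 1 a fa; rewrite /has_deriv.
rewrite (_ : f ^+ n = (fun y => f y ^+ n))//.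
by apply/funext => y; rewrite fctE.
Qed.

Lemma d_V f x a : f x != 0 -> has_deriv f x a ->
  has_deriv (fun y => (f y)^-1) x (- (f x) ^- 2 * a).
Proof. by move=> fx0 fa; exact: is_deriveV. Qed.

Lemma d_comp f g x a b : has_deriv f (g x) a -> has_deriv g x b ->
  has_deriv (fun y => f (g y)) x (a * b).
Proof. by move=> fa gb; exact: is_derive1_comp. Qed.

Lemma d_expR x : has_deriv expR x (expR x).
Proof. exact: is_derive_expR. Qed.

Lemma d_cont f x a : has_deriv f x a -> {for x, continuous f}.
Proof. by move=> [fd _]; apply/differentiable_continuous/derivable1_diffP. Qed.

Lemma d_continuous f g : (forall x, has_deriv f x (g x)) -> continuous f.
Proof. by move=> fg x; exact: d_cont (fg x). Qed.

Lemma d_derive1 f x a : has_deriv f x a -> derive1 f x = a.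
Proof. by move=> fa; rewrite derive1E; exact: @derive_val _ _ _ _ _ _ _ fa. Qed.

Lemma derivable_d f x : derivable f x 1 -> has_deriv f x (derive1 f x).
Proof. by move=> fd; rewrite derive1E; exact: derivableP. Qed.

End one_variable.

Section continuity.
Context {R : realType} {T : topologicalType}.
Implicit Types (f g : T -> R).

Lemma c_cst (c : R) : continuous (fun _ : T => c).
Proof. by move=> x; exact: cvg_cst. Qed.

Lemma c_D f g : continuous f -> continuous g -> continuous (fun x => f x + g x).
Proof. by move=> fc gc x; apply: cvgD; [exact: fc|exact: gc]. Qed.

Lemma c_N f : continuous f -> continuous (fun x => - f x).
Proof. by move=> fc x; apply: cvgN; exact: fc. Qed.

Lemma c_M f g : continuous f -> continuous g -> continuous (fun x => f x * g x).
Proof. by move=> fc gc x; apply: cvgM; [exact: fc|exact: gc]. Qed.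

Lemma c_X f n : continuous f -> continuous (fun x => f x ^+ n).
Proof.
move=> fc; elim: n => [|n ih] x.
  by rewrite (_ : (fun x => f x ^+ 0) = cst 1)//; exact: cvg_cst.
rewrite (_ : (fun x => f x ^+ n.+1) = (fun x => f x * f x ^+ n)); last first.
  by apply/funext => y; rewrite exprS.
exact: c_M.
Qed.

Lemma c_V f : continuous f -> (forall x, f x != 0) ->
  continuous (fun x => (f x)^-1).
Proof. by move=> fc f0 x; apply: cvgV => //; exact: fc. Qed.

Lemma c_norm f : continuous f -> continuous (fun x => `|f x|).
Proof. by move=> fc x; apply: cvg_norm; exact: fc. Qed.

Lemma c_comp (g : R -> R) f : continuous g -> continuous f ->
  continuous (fun x => g (f x)).
Proof.
move=> gc fc x; apply: (@continuous_comp _ _ _ f g); [exact: fc|exact: gc].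
Qed.

Lemma c_comp2 (F : R -> R -> R) f g :
  continuous (fun q : R * R => F q.1 q.2) ->
  continuous f -> continuous g -> continuous (fun x => F (f x) (g x)).
Proof.
move=> Fc fc gc x.
apply: (@continuous_comp _ _ _ (fun x => (f x, g x)) (fun q => F q.1 q.2)).
  exact: (cvg_pair (fc x) (gc x)).
exact: Fc.
Qed.

End continuity.

Definition cont2 (R : realType) (F : R -> R -> R) :=
  continuous (fun q : R * R => F q.1 q.2).

Lemma c_id (R : realType) : continuous (fun x : R => x).
Proof. by move=> x; exact: cvg_id. Qed.

Lemma c_fst (R : realType) : continuous (fun x : R * R => x.1).
Proof. by move=> x; exact: cvg_fst. Qed.

Lemma c_snd (R : realType) : continuous (fun x : R * R => x.2).
Proof. by move=> x; exact: cvg_snd. Qed.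

(* Both tactics descend along the syntax of the function, taking the leaves
   from the context; the derivative they find is reconciled with the expected
   one by [field] or by hand. *)
Ltac deriv_step :=
  lazymatch goal with
  | |- has_deriv (fun _ => ?c) _ _ => exact: d_cst
  | |- has_deriv (fun y => y) _ _ => exact: d_id
  | |- has_deriv (-%R) _ _ => exact (d_N (d_id _))
  | |- has_deriv ( *%R ?c) _ _ => exact (d_M (d_cst c _) (d_id _))
  | |- has_deriv (+%R ?c) _ _ => exact (d_D (d_cst c _) (d_id _))
  | |- has_deriv (fun y => @?f y + @?g y) _ _ => notypeclasses refine (d_D _ _)
  | |- has_deriv (fun y => - @?f y) _ _ => notypeclasses refine (d_N _)
  | |- has_deriv (fun y => @?f y * @?g y) _ _ => notypeclasses refine (d_M _ _)
  | |- has_deriv (fun y => @?f y ^+ ?n) _ _ => notypeclasses refine (d_X _ _)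
  | |- has_deriv (fun y => (@?f y)^-1) _ _ => notypeclasses refine (d_V _ _)
  | |- has_deriv (fun y => expR y) _ _ => exact: d_expR
  | |- has_deriv (fun y => expR (@?f y)) _ _ =>
      notypeclasses refine (d_comp (d_expR _) _)
  end.
Ltac deriv :=
  repeat first [ match goal with
      | H : context [has_deriv] |- has_deriv _ _ _ =>
          solve [notypeclasses refine (H _) | notypeclasses refine (H _ _) | exact H]
      end
    | deriv_step
    | match goal with
      | H : context [has_deriv ?f _ _] |- has_deriv (fun z => ?f (@?g z)) _ _ =>
          notypeclasses refine (d_comp (H _) _)
      end ].
Ltac deriv_to := notypeclasses refine (has_deriv_val _ _); [by deriv|simpl].

Ltac conti_step :=
  lazymatch goal with
  | |- continuous (fun _ => ?c) => exact: c_cst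
  | |- continuous (fun y => y) => exact: c_id
  | |- continuous fst => exact: c_fst
  | |- continuous snd => exact: c_snd
  | |- continuous (fun y => y.1) => exact: c_fst
  | |- continuous (fun y => y.2) => exact: c_snd
  | |- continuous (-%R) => exact (c_N (@c_id _))
  | |- continuous ( *%R ?c) => exact (c_M (@c_cst _ _ c) (@c_id _))
  | |- continuous (+%R ?c) => exact (c_D (@c_cst _ _ c) (@c_id _))
  | |- continuous (fun y => @?f y + @?g y) => apply: c_D
  | |- continuous (fun y => - @?f y) => apply: c_N
  | |- continuous (fun y => @?f y * @?g y) => apply: c_M
  | |- continuous (fun y => @?f y ^+ ?n) => apply: c_X
  | |- continuous (fun y => expR (@?f y)) => apply: (@c_comp _ _ expR);
    first exact: continuous_expR
  | |- continuous (fun y => `|@?f y|) => apply: c_norm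
  end.
Ltac conti :=
  repeat first [ conti_step
    | match goal with
      | H : continuous ?f |- continuous ?f => exact H
      | H : continuous ?f |- continuous (fun z => ?f (@?g z)) =>
          apply: (@c_comp _ _ f); first exact H
      | H : cont2 ?f |- continuous (fun z => ?f (@?g z) (@?h z)) =>
          apply: (@c_comp2 _ _ f); first exact H
      end
    | assumption ].

Definition kept (Q : Prop) := Q.
Definition hidden (Q : Prop) := Q.

(* [lra] compares the atoms of all hypotheses up to conversion, which is slow in
   a long context; the most recent facts are tried first. *)
Ltac qlra :=
  first [ solve [
    do 7 (try match goal with H : is_true ?b |- _ => change (kept (is_true b)) in H end);
    repeat match goal with H : is_true ?b |- _ => change (hidden (is_true b)) in H end;
    repeat match goal with H : kept ?Q |- _ => change Q in H end; lra ] | lra ].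

Section monotone.
Context {R : realType}.
Implicit Types (f g : R -> R) (a b c x : R).

Lemma d_mvt f df a b : a <= b ->
  (forall x, a <= x <= b -> has_deriv f x (df x)) ->
  exists2 c, a <= c <= b & f b - f a = df c * (b - a).
Proof.
move=> ab fd; have [||c cab fE] := @MVT_segment R f df a b ab.
- by move=> x /andP[/ltW ax /ltW xb]; apply: fd; rewrite ax.
- apply: continuous_in_subspaceT => x; rewrite inE/= in_itv/= => xab.
  exact: d_cont (fd x xab).
by exists c => //; move: cab; rewrite in_itv.
Qed.

Lemma d_le f df a b : a <= b ->
  (forall x, a <= x <= b -> has_deriv f x (df x)) ->
  (forall x, a <= x <= b -> 0 <= df x) -> f a <= f b.
Proof.
move=> ab fd f0; have [c cab fE] := d_mvt ab fd.
by rewrite -subr_ge0 fE mulr_ge0 ?f0 ?subr_ge0.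
Qed.

Lemma d_le2 f g df dg a b : a <= b ->
  (forall x, a <= x <= b -> has_deriv f x (df x)) ->
  (forall x, a <= x <= b -> has_deriv g x (dg x)) ->
  (forall x, a <= x <= b -> df x <= dg x) -> f b - f a <= g b - g a.
Proof.
move=> ab fd gd fg.
have := @d_le (fun x => g x - f x) (fun x => dg x - df x) a b ab.
move=> H; suff : g a - f a <= g b - f b by qlra.
apply: H => x xab; last by rewrite subr_ge0 fg.
by apply: d_D; [exact: gd|apply: d_N; exact: fd].
Qed.

Lemma d_cst_eq f a b : (forall x, Num.min a b <= x <= Num.max a b -> has_deriv f x 0) -> f a = f
  b.
Proof.
wlog ab : a b / a <= b.
  move=> H fd; have [ab|/ltW ba] := leP a b; first exact: H.
  by apply/esym/H => // x; rewrite minC maxC; exact: fd.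
rewrite min_l// max_r// => fd; have [c cab] := d_mvt ab fd.
by rewrite mul0r => /eqP; rewrite subr_eq0 => /eqP.
Qed.

End monotone.

(** * Integrals of continuous functions *)

Section epsilon_delta.
Context {R : realType}.
Implicit Types (f g : R -> R) (a b c d e l x : R).

Lemma near_ball x (P : R -> Prop) (d : R) : 0 < d ->
  (forall y, `|x - y| < d -> P y) -> \forall y \near x, P y.
Proof. by move=> d0 H; apply/nbhs_ballP; exists d. Qed.

Lemma cont_epsP f x : {for x, continuous f} <->
  forall e, 0 < e -> exists2 d, 0 < d & forall y, `|x - y| < d -> `|f x - f y| < e.
Proof.
split=> [fc e e0|H].
  by have /cvgrPdist_lt/(_ _ e0)/nbhs_ballP[d d0 H] := fc; exists d.
by apply/cvgrPdist_lt => e /H[d d0 Hd]; apply/nbhs_ballP; exists d.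
Qed.

Lemma cont2P (F : R -> R -> R) : cont2 F <->
  forall a b e, 0 < e -> exists2 d, 0 < d & forall a' b',
    `|a - a'| < d -> `|b - b'| < d -> `|F a b - F a' b'| < e.
Proof.
split=> [Fc a b e e0|H [a b]].
  have /cvgrPdist_lt/(_ _ e0)[[U V]/= [/nbhs_ballP[d1 d10 HU] /nbhs_ballP[d2 d20 HV]] UV] := Fc
    (a, b).
  exists (Num.min d1 d2); first by rewrite lt_min d10.
  move=> a' b'; rewrite !lt_min => /andP[aa _] /andP[_ bb].
  by apply: (UV (a', b')); split => /=; [exact: HU|exact: HV].
apply/cvgrPdist_lt => e /(H a b)[d d0 Hd].
exists (ball a d, ball b d); first by split; apply/nbhs_ballP; exists d.
by move=> [a' b'] [/= aa bb]; exact: Hd.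
Qed.

Lemma d_epsP f x l : (forall e, 0 < e -> exists2 d, 0 < d &
    forall y, `|x - y| < d -> `|f y - f x - l * (y - x)| <= e * `|y - x|) ->
  has_deriv f x l.
Proof.
move=> H; apply/is_derive1_caratheodory.
exists (fun z => if z == x then l else (f z - f x) / (z - x)); split.
- move=> z; case: eqP => [->|/eqP zx]; first by rewrite !subrr mulr0.
  by rewrite divfK// subr_eq0.
- apply/cont_epsP => e e0; have [|d d0 Hd] := H (e / 2); first by rewrite divr_gt0.
  exists d => // y /Hd; rewrite eqxx; case: eqP => [->|/eqP yx].
    by rewrite (subrr l) normr0.
  have yx0 : 0 < `|y - x| by rewrite normr_gt0 subr_eq0.
  rewrite -ler_pdivrMr// -normfV -normrM mulrBl mulfK ?subr_eq0// distrC.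
  by move/le_lt_trans; apply; qlra.
- by rewrite eqxx.
Qed.

Lemma d_near f g x l (d : R) : 0 < d -> (forall y, `|x - y| < d -> f y = g y) ->
  has_deriv f x l -> has_deriv g x l.
Proof. by move=> d0 fg; apply: near_eq_is_derive; exact: near_ball d0 fg. Qed.

End epsilon_delta.

Section primitive.
Context {R : realType}.
Implicit Types (f g F G : R -> R) (a b c x : R).

Let mu := @lebesgue_measure R.

Lemma antiderivative_exists f : continuous f ->
  exists F, F 0 = 0 /\ forall x, has_deriv F x (f x).
Proof.
move=> fc.
pose P k x := (\int[mu]_(t in `[k, x]) f t)%R.
have Pd k x : k < x -> has_deriv (P k) x (f x).
  move=> kx; have xx : x < x + 1 by rewrite ltrDl.
  have [|dP <-] := @continuous_FTC1_closed R f k x _ xx _ kx (fc x).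
    apply: continuous_compact_integrable; first exact: segment_compact.
    exact: continuous_subspaceT.
  exact: derivable_d.
pose F x := let k := - `|x| - 1 in P k x - P k 0.
have Pk k l x : k < l -> l < 0 -> l < x -> P k x - P k 0 = P l x - P l 0.
  move=> kl l0 lx; suff : P k x - P l x = P k 0 - P l 0 by qlra.
  apply: (@d_cst_eq _ (fun y => P k y - P l y)) => y /andP[xy _].
  have ly : l < y by apply: lt_le_trans xy; rewrite lt_min lx l0.
  rewrite -(subrr (f y)); apply: d_D; first by apply: Pd; qlra.
  by apply: d_N; apply: Pd.
exists F; split; first by rewrite /F subrr.
move=> x; pose k := - `|x| - 2.
have xk : k < x by rewrite /k; have := ler_norm (- x); rewrite normrN; qlra.
apply: (@d_near _ (fun y => P k y - P k 0) F x (f x) 1) => //; last first.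
  by have h := Pd k x xk; deriv_to; ring.
move=> y xy; have yx : `|y| < `|x| + 1.
  by have := ler_normB x (x - y); rewrite opprB addrC subrK; qlra.
have := ler_norm (- y); rewrite normrN => yN.
have yp := normr_ge0 y.
by apply: Pk; rewrite /k; qlra.
Qed.

(* Meaningful for continuous [f] only. *)
Definition prim f : R -> R :=
  get [set F | F 0 = 0 /\ forall x, has_deriv F x (f x)].

Lemma primP f : continuous f ->
  prim f 0 = 0 /\ forall x, has_deriv (prim f) x (f x).
Proof.
move=> /antiderivative_exists[F HF].
exact: (@getPex _ [set F | F 0 = 0 /\ forall x, has_deriv F x (f x)] (ex_intro _ F HF)).
Qed.

Lemma prim0 f : continuous f -> prim f 0 = 0.
Proof. by move=> /primP[]. Qed.

Lemma d_prim f x : continuous f -> has_deriv (prim f) x (f x).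
Proof. by move=> /primP[]. Qed.

Lemma c_prim f : continuous f -> continuous (prim f).
Proof. by move=> fc; apply: d_continuous => x; exact: d_prim. Qed.

(** A difference of primitives is signed, so Duhamel's formula and its estimates cover both time
    directions at once. The link with the Lebesgue integral is made in [lebesgue_integ]. *)
Definition integ f a b : R := prim f b - prim f a.

Lemma integE f F a b : continuous f ->
  (forall x, Num.min a b <= x <= Num.max a b -> has_deriv F x (f x)) ->
  integ f a b = F b - F a.
Proof.
move=> fc Fd; suff : prim f b - F b = prim f a - F a by rewrite /integ; qlra.
apply: (@d_cst_eq _ (fun y => prim f y - F y)) => x xab.
rewrite -(subrr (f x)).
apply: d_D; first exact: d_prim.
by apply: d_N; apply: Fd; rewrite minC maxC.
Qed.

Lemma integ_swap f a b : integ f b a = - integ f a b.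
Proof. by rewrite /integ; ring. Qed.

Lemma integ_le f g a b : continuous f -> continuous g -> a <= b ->
  (forall x, a <= x <= b -> f x <= g x) -> integ f a b <= integ g a b.
Proof.
move=> fc gc ab fg; apply: (@d_le2 _ _ _ f g a b ab) => //.
  by move=> x _; exact: d_prim.
by move=> x _; exact: d_prim.
Qed.

Lemma integ_cst c a b : integ (fun=> c) a b = c * (b - a).
Proof.
rewrite (@integE _ (fun x => c * x)); first by ring.
  by conti.
by move=> x _; deriv_to; ring.
Qed.

Lemma integ_ge0 f a b : continuous f -> a <= b ->
  (forall x, a <= x <= b -> 0 <= f x) -> 0 <= integ f a b.
Proof.
move=> fc ab f0; rewrite -[leLHS](mul0r (b - a)) -integ_cst.
by apply: integ_le => //; conti.
Qed.

Lemma integD f g a b : continuous f -> continuous g ->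
  integ (fun x => f x + g x) a b = integ f a b + integ g a b.
Proof.
move=> fc gc; rewrite (@integE _ (fun x => prim f x + prim g x)).
- by rewrite /integ; ring.
- by conti.
- by move=> x _; apply: d_D; exact: d_prim.
Qed.

Lemma integZ c f a b : continuous f ->
  integ (fun x => c * f x) a b = c * integ f a b.
Proof.
move=> fc; rewrite (@integE _ (fun x => c * prim f x)).
- by rewrite /integ; ring.
- by conti.
- move=> x _; have fd := @d_prim f _ fc; deriv_to; ring.
Qed.

Lemma integ_eq f g a b : continuous f -> continuous g ->
  (forall x, Num.min a b <= x <= Num.max a b -> f x = g x) ->
  integ f a b = integ g a b.
Proof.
move=> fc gc fg; rewrite (@integE f (prim g) a b)// => x /fg ->.
exact: d_prim.
Qed.

Lemma integ_sub f a b c d : continuous f -> a <= b -> b <= c -> c <= d ->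
  (forall x, a <= x <= d -> 0 <= f x) -> integ f b c <= integ f a d.
Proof.
move=> fc ab bc cd f0.
have h1 : 0 <= integ f a b.
  by apply: integ_ge0 => // x xab; apply: f0; qlra.
have h2 : 0 <= integ f c d.
  by apply: integ_ge0 => // x xab; apply: f0; qlra.
by move: h1 h2; rewrite /integ; qlra.
Qed.

Lemma integ_norm f g a b : continuous f -> continuous g ->
  (forall x, Num.min a b <= x <= Num.max a b -> `|f x| <= g x) ->
  `|integ f a b| <= `|integ g a b|.
Proof.
move=> fc gc; wlog ab : a b / a <= b.
  move=> H fg; have [ab|/ltW ba] := leP a b; first exact: H.
  rewrite -normrN -[leRHS]normrN -!integ_swap; apply: H => // x.
  by rewrite minC maxC; exact: fg.
rewrite min_l// max_r// => fg.
have h1 : integ f a b <= integ g a b.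
  by apply: integ_le => // x /fg; exact: le_trans (ler_norm _).
have h2 : - integ f a b <= integ g a b.
  rewrite -mulN1r -integZ//; apply: integ_le => //; first by conti.
  by move=> x /fg; rewrite mulN1r -normrN; exact: le_trans (ler_norm _).
by rewrite ler_norml (le_trans _ (ler_norm _))// andbT lerNl (le_trans h2)// ler_norm.
Qed.

Lemma integ_norm_cst f M a b : continuous f ->
  (forall x, Num.min a b <= x <= Num.max a b -> `|f x| <= M) ->
  `|integ f a b| <= M * `|b - a|.
Proof.
move=> fc fM; have M0 : 0 <= M.
  by apply: le_trans (fM a _) => //; rewrite ge_min le_max lexx.
rewrite -[in leRHS](ger0_norm M0) -normrM -integ_cst; apply: integ_norm => //.
by conti.
Qed.

Lemma integ_mean f a b : continuous f -> a < b ->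
  exists2 c, a <= c <= b & integ f a b = f c * (b - a).
Proof.
move=> fc ab; apply: (@d_mvt _ (prim f) f); first exact: ltW.
by move=> x _; exact: d_prim.
Qed.

Lemma integ_gt0 f a b c : continuous f -> a < b -> a <= c <= b -> 0 < f c ->
  (forall x, a <= x <= b -> 0 <= f x) -> 0 < integ f a b.
Proof.
move=> fc ab cab fc0 f0.
have [|d d0 Hd] := (cont_epsP f c).1 (fc c) (f c / 2); first by qlra.
pose l := Num.max a (c - d / 2); pose u := Num.min b (c + d / 2).
have lu : l < u.
  by rewrite /l /u /Num.max /Num.min; do 2 (case: ifPn; rewrite -?leNgt => ?); qlra.
have al : a <= l by rewrite le_max lexx.
have ub : u <= b by rewrite ge_min lexx.
have cl : c - d / 2 <= l by rewrite le_max lexx orbT.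
have uc : u <= c + d / 2 by rewrite ge_min lexx orbT.
apply: lt_le_trans (integ_sub fc al (ltW lu) ub f0).
apply: (@lt_le_trans _ _ (integ (fun=> f c / 2) l u)).
  by rewrite integ_cst mulr_gt0 ?subr_gt0// divr_gt0.
apply: integ_le => //; [by conti|exact: ltW|move=> x xlu].
have /Hd : `|c - x| < d.
  by rewrite ltr_norml; qlra.
by rewrite ltr_norml; qlra.
Qed.

End primitive.

Section parametric_integral.
Context {R : realType}.
Implicit Types (F Ft : R -> R -> R) (a b c d e t x : R).

Lemma cont2_l F t : cont2 F -> continuous (F t).
Proof. by move=> Fc; apply: (c_comp2 Fc); conti. Qed.

Lemma cont2_r F x : cont2 F -> continuous (F ^~ x).
Proof. by move=> Fc; apply: (c_comp2 Fc); conti. Qed.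

Lemma cont2_swap F : cont2 F -> cont2 (fun a b => F b a).
Proof. by move=> Fc; rewrite /cont2; conti. Qed.

(** Compactness of the segment makes the continuity in the first variable uniform in the second. *)
Lemma tube F t c d e : cont2 F -> 0 < e ->
  exists2 del, 0 < del & forall s x, `|t - s| < del -> c <= x <= d ->
    `|F t x - F s x| < e.
Proof.
move=> /cont2P Fc e0.
have /compact_near_coveringP := @segment_compact R c d.
move=> /(_ R (nbhs t) (fun s x => `|F t x - F s x| < e) _).
case.
  move=> x _; have e20 : 0 < e / 2 by qlra.
  have [d1 d10 H] := Fc t x _ e20.
  exists (ball x d1, ball t d1) => /=.
    by split; apply/nbhs_ballP; exists d1.
  move=> [y s] [/= xy ts].
  have h1 := H t y; rewrite subrr normr0 in h1.
  have h2 := H _ _ ts xy.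
  rewrite (_ : _ - _ = (F t x - F s y) - (F t x - F t y)); last by ring.
  by apply: le_lt_trans (ler_normB _ _) _; have := h1 d10 xy; qlra.
move=> del /= del0 H; exists del => // s x ts xcd.
by apply: (H s) => //=; rewrite in_itv.
Qed.

Lemma cont2_prim F : cont2 F -> cont2 (fun a b => prim (F a) b).
Proof.
move=> Fc; apply/cont2P => a b e e0.
have Fa t := @cont2_l F t Fc.
have e20 : 0 < e / 2 by qlra.
have pc : continuous (prim (F a)) by exact: c_prim.
have [d1 d10 H1] := (cont_epsP _ _).1 (pc b) _ e20.
pose B := `|b| + d1.
have B0 : 0 < B by rewrite /B; have := normr_ge0 b; qlra.
have [|d2 d20 H2] := @tube F a (- B) B (e / 2 / B) Fc; first by rewrite divr_gt0.
exists (Num.min d1 d2); first by rewrite lt_min d10.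
move=> a' b'; rewrite !lt_min => /andP[_ aa] /andP[bb _].
rewrite (_ : _ - _ = (prim (F a) b - prim (F a) b') + (prim (F a) b' - prim (F a') b'));
  last by ring.
apply: le_lt_trans (ler_normD _ _) _; have := H1 _ bb.
suff : `|prim (F a) b' - prim (F a') b'| <= e / 2 by qlra.
have b'B : `|b'| < B.
  by rewrite /B; have := ler_normB b (b - b'); rewrite opprB addrC subrK; qlra.
have -> : prim (F a) b' - prim (F a') b' = integ (fun x => F a x - F a' x) 0 b'.
  rewrite (integE (F := fun x => prim (F a) x - prim (F a') x)).
  - by rewrite !prim0 // !subr0.
  - by have ? := Fa a; have ? := Fa a'; conti.
  - by move=> x _; apply: d_D; [|apply: d_N]; exact: d_prim.
apply: (@le_trans _ _ (e / 2 / B * `|b' - 0|)).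
  apply: integ_norm_cst.
    by have ? := Fa a; have ? := Fa a'; conti.
  move=> x xb; apply/ltW/H2 => //.
  have := ler_norm b'; have := ler_norm (- b'); rewrite normrN.
  by move: xb; rewrite /Num.min /Num.max; case: ifPn; rewrite -?leNgt => ?; qlra.
by rewrite subr0 -mulrA ger_pMr// mulrC ler_pdivrMr// mul1r ltW.
Qed.

(** The mean value theorem in the parameter replaces each difference quotient by a value of [Ft] at
    a nearby parameter, and [tube] makes the error uniform on the interval of integration. *)
Lemma d_prim_param F Ft t b : cont2 F -> cont2 Ft ->
  (forall s x, has_deriv (F ^~ x) s (Ft s x)) ->
  has_deriv (fun s => prim (F s) b) t (prim (Ft t) b).
Proof.
move=> Fc Ftc Fd; apply: d_epsP => e e0.
have Fa t := @cont2_l F t Fc; have Fta t := @cont2_l Ft t Ftc.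
pose B := `|b| + 1.
have B0 : 0 < B by rewrite /B; have := normr_ge0 b; qlra.
have [|d d0 H] := @tube Ft t (- B) B (e / B) Ftc; first by rewrite divr_gt0.
exists d => // s ts.
have -> : prim (F s) b - prim (F t) b - prim (Ft t) b * (s - t) =
    integ (fun x => F s x - F t x - Ft t x * (s - t)) 0 b.
  rewrite (integE (F := fun x => prim (F s) x - prim (F t) x - prim (Ft t) x * (s - t))).
  - by rewrite !prim0 // mul0r !subr0.
  - by have ? := Fa s; have ? := Fa t; have ? := Fta t; conti.
  - move=> x _; have h1 := d_prim x (Fa s); have h2 := d_prim x (Fa t).
    by have h3 := d_prim x (Fta t); deriv_to; ring.
apply: (@le_trans _ _ (e / B * `|s - t| * `|b - 0|)).
  apply: integ_norm_cst.
    by have ? := Fa s; have ? := Fa t; have ? := Fta t; conti.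
  move=> x xb.
  have xB : - B <= x <= B.
    have := ler_norm b; have := ler_norm (- b); rewrite normrN /B.
    by move: xb; rewrite /Num.min /Num.max; case: ifPn; rewrite -?leNgt => ?; qlra.
  have [c cst ->] : exists2 c, `|t - c| < d & F s x - F t x = Ft c x * (s - t).
    have [st|/ltW st] := leP s t.
      have [c cst E] := d_mvt st (fun c _ => Fd c x).
      exists c; last by rewrite -opprB E; ring.
      by apply: le_lt_trans ts; rewrite !ger0_norm; qlra.
    have [c cst E] := d_mvt st (fun c _ => Fd c x).
    exists c; last by rewrite E.
    by apply: le_lt_trans ts; rewrite !ler0_norm; qlra.
  rewrite -mulrBl normrM ler_wpM2r// distrC ltW//; exact: H.
rewrite subr0 mulrAC ler_wpM2r// -mulrA ger_pMr// mulrC ler_pdivrMr// mul1r /B.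
by rewrite lerDl.
Qed.

End parametric_integral.

(** * Functions of two variables *)

Section functions_of_two_variables.
Context {R : realType}.
Implicit Types (f ft fx : R -> R -> R) (a b c d e t x : R).

Definition C1_with f ft fx :=
  [/\ forall t x, has_deriv (f ^~ x) t (ft t x),
      forall t x, has_deriv (f t) x (fx t x), cont2 ft & cont2 fx].

(** [C1_with] asks for joint continuity of the partial derivatives only. That of [f] follows by
    writing it as [f 0] plus the primitive of [ft] in time. *)
Lemma C1_cont f ft fx : C1_with f ft fx -> cont2 f.
Proof.
move=> [ftd fxd ftc _].
have -> : f = (fun t x => f 0 x + prim (ft ^~ x) t).
  apply/funext => t; apply/funext => x.
  have := @integE _ (ft ^~ x) (f ^~ x) 0 t (cont2_r ftc) (fun s _ => ftd s x).
  rewrite /integ prim0; last exact: cont2_r.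
  qlra.
have f0 : continuous (f 0) by apply: d_continuous => x; exact: fxd.
apply: c_D; first exact: (c_comp f0 (@c_snd R)).
exact: (cont2_swap (cont2_prim (cont2_swap ftc))).
Qed.

Lemma d_comp2 f ft fx (al be : R -> R) t a b : C1_with f ft fx ->
  has_deriv al t a -> has_deriv be t b ->
  has_deriv (fun s => f (al s) (be s)) t
    (ft (al t) (be t) * a + fx (al t) (be t) * b).
Proof.
move=> [ftd fxd ftc fxc] ald bed.
have -> : (fun s => f (al s) (be s)) =
    (fun s => (f (al s) (be s) - f (al t) (be s)) + f (al t) (be s)).
  by apply/funext => s; ring.
apply: d_D; last exact: (d_comp (fxd _ _) bed).
have [ga [alE gac gat]] := (is_derive1_caratheodory al t a).1 ald.
(* The intermediate point [c s] lies between [al t] and [al s], so it tends to [al t]. Then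
   [ft (c s) (be s)] times the Caratheodory slope of [al] is a slope for the increment in the first
   variable. *)
have /choice[c cP] : forall s, exists c, `|al t - c| <= `|al t - al s| /\
    f (al s) (be s) - f (al t) (be s) = ft c (be s) * (al s - al t).
  move=> s; have [st|/ltW st] := leP (al t) (al s).
    have [c cst E] := d_mvt st (fun c _ => ftd c (be s)).
    by exists c; rewrite E; split => //; rewrite !ler0_norm; qlra.
  have [c cst E] := d_mvt st (fun c _ => ftd c (be s)).
  exists c; split; first by rewrite !ger0_norm; qlra.
  by rewrite -opprB E; ring.
apply/is_derive1_caratheodory; exists (fun s => ft (c s) (be s) * ga s).
have ct : c t = al t.
  have [+ _] := cP t; rewrite subrr normr0 normr_le0 subr_eq0 => /eqP->//.
split.
- by move=> s; rewrite subrr subr0 (cP s).2 alE mulrA.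
- apply: cvgM => //.
  apply: (@continuous_comp _ _ _ (fun s => (c s, be s)) (fun q => ft q.1 q.2)).
    have cc : {for t, continuous c}.
      apply/cont_epsP => e e0.
      have [d d0 H] := (cont_epsP _ _).1 (d_cont ald) _ e0.
      by exists d => // s /H; rewrite ct; apply: le_lt_trans; exact: (cP s).1.
    exact: (cvg_pair cc (d_cont bed)).
  exact: ftc.
- by rewrite ct gat.
Qed.

Lemma class_C1_with f : class_C1 f <-> C1_with f (d_t f) (d_x f).
Proof.
split=> [[ftd fxd ftc fxc]|[ftd fxd ftc fxc]].
  split; [| |exact: ftc|exact: fxc] => t x; apply: derivable_d.
    exact: ftd.
  exact: fxd.
split; [| |exact: ftc|exact: fxc] => t x; first by have [] := ftd t x.
by have [] := fxd t x.
Qed.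

Lemma C1_with_class f ft fx : C1_with f ft fx ->
  [/\ class_C1 f, d_t f = ft & d_x f = fx].
Proof.
move=> C; have [ftd fxd _ _] := C.
have Et : d_t f = ft.
  by apply/funext => t; apply/funext => x; apply: d_derive1; exact: ftd.
have Ex : d_x f = fx.
  by apply/funext => t; apply/funext => x; apply: d_derive1; exact: fxd.
by split => //; apply/class_C1_with; rewrite Et Ex.
Qed.

Lemma C1_prim F Ft : cont2 F -> cont2 Ft ->
  (forall s x, has_deriv (F ^~ x) s (Ft s x)) ->
  C1_with (fun t b => prim (F t) b) (fun t b => prim (Ft t) b) F.
Proof.
move=> Fc Ftc Fd; split.
- by move=> t x; exact: d_prim_param.
- by move=> t x; apply: d_prim; exact: cont2_l.
- exact: cont2_prim.
- exact: Fc.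
Qed.

(* The boundary terms of the shrinking interval absorb the flux [p], since
   [`|p| <= e]. *)
Lemma cone_energy (e et p px s : R -> R -> R) (K t : R) : t <= K ->
  cont2 e -> cont2 et -> cont2 px -> continuous (s t) ->
  (forall r x, has_deriv (e ^~ x) r (et r x)) ->
  (forall x, has_deriv (p t) x (px t x)) ->
  (forall x, `|p t x| <= e t x) ->
  (forall x, t - K <= x <= K - t -> et t x <= px t x + s t x) ->
  exists2 dE, has_deriv (fun r => integ (e r) (r - K) (K - r)) t dE &
    dE <= integ (s t) (t - K) (K - t).
Proof.
move=> tK ec etc pxc sc ed pd pe es.
have G := C1_prim ec etc ed.
exists (integ (et t) (t - K) (K - t) - e t (K - t) - e t (t - K)).
  have h1 : has_deriv (fun r => r) t 1 by exact: d_id.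
  have h2 : has_deriv (fun r => K - r) t (- 1) by deriv_to; ring.
  have h3 : has_deriv (fun r => r - K) t 1 by deriv_to; ring.
  apply: (has_deriv_val (d_D (d_comp2 G h1 h2) (d_N (d_comp2 G h1 h3)))).
  by rewrite /integ /=; ring.
have etc' : continuous (et t) by exact: cont2_l.
have pxc' : continuous (px t) by exact: cont2_l.
have ab : t - K <= K - t by qlra.
have : integ (et t) (t - K) (K - t) <= integ (fun x => px t x + s t x) (t - K) (K - t).
  by apply: integ_le => //; conti.
rewrite integD// (@integE _ (px t) (p t)) => // h.
have := pe (K - t); have := pe (t - K); rewrite !ler_norml; qlra.
Qed.

(** Some unit interval contains [x] and lies in [[a, b]]. On it [g ^+ 2] equals its mean at a point
    [y], and the change from [y] to [x] is the integral of [2 * g * dg], at most that of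
    [g ^+ 2 + dg ^+ 2]. *)
Lemma sobolev (g dg : R -> R) a b x : (forall y, has_deriv g y (dg y)) ->
  continuous dg -> a + 1 <= b -> a <= x <= b ->
  g x ^+ 2 <= integ (fun y => 2 * g y ^+ 2 + dg y ^+ 2) a b.
Proof.
move=> gd dgc ab xab.
have gc : continuous g := d_continuous gd.
have gc2 : continuous (fun y => g y ^+ 2) by conti.
have [c [ac cx cb]] : exists c, [/\ a <= c, c <= x <= c + 1 & c + 1 <= b].
  have [xb|xb] := leP (x + 1) b; first by exists x; split; qlra.
  by exists (b - 1); split; qlra.
have cc : c < c + 1 by qlra.
have [y cy Ey] := integ_mean gc2 cc.
have le1 : integ (fun y => 2 * g y ^+ 2 + dg y ^+ 2) c (c + 1) <=
    integ (fun y => 2 * g y ^+ 2 + dg y ^+ 2) a b.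
  by apply: integ_sub => //; [conti|qlra|move=> z _; have := sqr_ge0 (g z);
    have := sqr_ge0 (dg z); qlra].
apply: le_trans le1; rewrite (_ : (fun y => _) = (fun y => g y ^+ 2 + (g y ^+ 2 + dg y ^+ 2)));
  last first.
  by apply/funext => z; ring.
rewrite integD; [|by conti|by conti].
have -> : integ (fun y => g y ^+ 2) c (c + 1) = g y ^+ 2 by rewrite Ey; ring.
suff : `|g x ^+ 2 - g y ^+ 2| <= integ (fun y => g y ^+ 2 + dg y ^+ 2) c (c + 1).
  by rewrite ler_norml; qlra.
have <- : integ (fun z => 2 * g z * dg z) y x = g x ^+ 2 - g y ^+ 2.
  apply: (@integE _ _ (fun z => g z ^+ 2)); first by conti.
  by move=> z _; deriv_to; ring.
apply: le_trans.
  apply: (@integ_norm _ _ (fun z => g z ^+ 2 + dg z ^+ 2)); [by conti|by conti|].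
  by move=> z _; rewrite ler_norml; have := sqr_ge0 (g z + dg z); have := sqr_ge0 (g z - dg z);
    rewrite !expr2; qlra.
have [yx|/ltW xy] := leP y x.
  rewrite ger0_norm.
    by apply: integ_sub => //; [conti|qlra|qlra|move=> z _; have := sqr_ge0 (g z);
      have := sqr_ge0 (dg z); qlra].
  by apply: integ_ge0 => //; [conti|move=> z _; have := sqr_ge0 (g z); have := sqr_ge0 (dg z);
    qlra].
rewrite -normrN -integ_swap ger0_norm.
  by apply: integ_sub => //; [conti|qlra|qlra|move=> z _; have := sqr_ge0 (g z);
    have := sqr_ge0 (dg z); qlra].
by apply: integ_ge0 => //; [conti|move=> z _; have := sqr_ge0 (g z); have := sqr_ge0 (dg z);
  qlra].
Qed.

(** At the first time [s0] with [y >= 0] one has [y s0 = 0], hence a negative slope; [y] would then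
    be positive just before [s0], against minimality. *)
Lemma barrier (y dy : R -> R) (T : R) :
  (forall t, 0 <= t <= T -> has_deriv y t (dy t)) ->
  y 0 < 0 -> (forall t, 0 <= t <= T -> y t = 0 -> dy t < 0) ->
  forall t, 0 <= t <= T -> y t < 0.
Proof.
move=> yd y0 yb t1 t1T; rewrite ltNge; apply/negP => yt1.
pose S := [set s | 0 <= s <= t1 /\ 0 <= y s].
have S1 : S t1 by split => //; qlra.
have Slb : lbound S 0 by move=> s [/andP[]].
have hS : has_inf S by split; [exists t1|exists 0].
set s0 := inf S.
have s00 : 0 <= s0 by apply: lb_le_inf; [exists t1|].
have s01 : s0 <= t1 by apply: ge_inf => //; exists 0.
have s0T : 0 <= s0 <= T by qlra.
have Sge s : S s -> s0 <= s by move=> Ss; apply: ge_inf => //; exists 0.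
have yc := (cont_epsP _ _).1 (d_cont (yd _ s0T)).
have ys0 : 0 <= y s0.
  rewrite leNgt; apply/negP => ys; have [|d d0 H] := yc (- y s0); first by qlra.
  have [s Ss sd] : exists2 s, S s & s < s0 + d by apply: inf_adherent.
  have := Sge _ Ss; have := H s; case: Ss => _ ys' + s0s.
  by rewrite distrC ger0_norm ?subr_ge0// ltr_norml; qlra.
have ys0' : y s0 = 0.
  apply/eqP; rewrite eq_le ys0 andbT leNgt; apply/negP => ys.
  have s0p : 0 < s0.
    by rewrite lt_neqAle s00 andbT; apply/eqP => E; move: ys; rewrite -E; qlra.
  have [d d0 H] := yc _ ys.
  pose s := Num.max 0 (s0 - d / 2).
  have sb : 0 <= s /\ s0 - d / 2 <= s by split; rewrite le_max lexx ?orbT.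
  have ss : s < s0 by rewrite gt_max s0p; qlra.
  have := H s; rewrite ger0_norm ?subr_ge0 ?(ltW ss)// ltr_norml => h.
  have : S s by split; qlra.
  by move/Sge; qlra.
have s0p : 0 < s0.
  by rewrite lt_neqAle s00 andbT; apply/eqP => E; move: ys0'; rewrite -E; qlra.
have [g [yE gc gs]] := (is_derive1_caratheodory y s0 (dy s0)).1 (yd _ s0T).
have dy0 := yb _ s0T ys0'.
have [|d d0 H] := (cont_epsP _ _).1 gc (- g s0); first by rewrite gs; qlra.
pose s := Num.max 0 (s0 - d / 2).
have sb : 0 <= s /\ s0 - d / 2 <= s by split; rewrite le_max lexx ?orbT.
have ss : s < s0 by rewrite gt_max s0p; qlra.
have := H s; rewrite ger0_norm ?subr_ge0 ?(ltW ss)// ltr_norml => h.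
have gs0 : g s < 0 by qlra.
have : S s by split; [qlra|have := yE s; rewrite ys0'; nra].
by move/Sge; qlra.
Qed.

Lemma cont2_bounded f (K : R) : cont2 f ->
  exists2 B, 0 < B & forall a b, `|a| <= K -> `|b| <= K -> `|f a b| <= B.
Proof.
move=> fc; have cK : compact (`[- K, K]%classic `*` `[- K, K]%classic : set (R * R)).
  by apply: compact_setX; exact: segment_compact.
have := @continuous_compact _ _ (fun q : R * R => f q.1 q.2) _ _ cK.
move=> /(_ (continuous_subspaceT fc)) /compact_bounded [M [_ HM]].
exists (Num.max M 0 + 1); first by rewrite ltr_pwDr// le_max lexx orbT.
move=> a b aK bK; apply: (HM (Num.max M 0 + 1)).
  by rewrite ltr_pwDr// le_max lexx.
by exists (a, b) => //; split; rewrite /= in_itv/= -ler_norml.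
Qed.

Lemma cont_bounded (f : R -> R) (K : R) : continuous f ->
  exists2 B, 0 < B & forall a, `|a| <= K -> `|f a| <= B.
Proof.
move=> fc; have [|B B0 H] := @cont2_bounded (fun _ b => f b) K.
  by rewrite /cont2; conti.
by exists B => // a aK; exact: (H a a).
Qed.

End functions_of_two_variables.

(** * Fixed points by Picard iteration in weighted norms *)

Section volterra.
Context {R : realType}.
Implicit Types (U V W : R -> R -> R) (a b c K : R).

Lemma half_small (C e : R) : 0 < e -> exists k : nat, C / 2 ^+ k < e.
Proof.
move=> e0; have [k Ck] : exists k : nat, C / e < k%:R.
  exists (Num.truncn `|C / e|).+1; apply: le_lt_trans (ler_norm _) _.
  exact: truncnS_gt.
exists k; rewrite ltr_pdivrMr ?exprn_gt0// mulrC -ltr_pdivrMr//.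
by apply: lt_le_trans Ck _; rewrite -natrX ler_nat ltnW// ltn_expl.
Qed.

(** The radius [2 * C / 2 ^+ k] is the sum of all later increments, so the intervals of this radius
    around [u k] are nested; the supremum of their left ends lies in all of them. *)
Lemma geometric_limit (u : nat -> R) (C : R) :
  (forall k, `|u k.+1 - u k| <= C / 2 ^+ k) ->
  exists l, forall k, `|l - u k| <= 2 * C / 2 ^+ k.
Proof.
move=> uC; pose r k := 2 * C / 2 ^+ k.
have rS k : r k.+1 = r k - C / 2 ^+ k.
  by rewrite /r exprS invfM; field.
have lo k j : (k <= j)%N -> u k - r k <= u j - r j.
  move=> /subnK <-; elim: (j - k)%N => [|n ih]//.
  apply: le_trans ih _; rewrite addSn; have := uC (n + k)%N.
  by rewrite rS ler_norml; qlra.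
have hi k j : (k <= j)%N -> u j + r j <= u k + r k.
  move=> /subnK <-; elim: (j - k)%N => [|n ih]//.
  apply: le_trans _ ih; rewrite addSn; have := uC (n + k)%N.
  by rewrite rS ler_norml; qlra.
have C0 : 0 <= C by have := uC 0%N; rewrite expr0 divr1; apply: le_trans.
have r0 k : 0 <= r k by rewrite /r divr_ge0 ?exprn_ge0 ?mulr_ge0.
have lh k j : u k - r k <= u j + r j.
  have [kj|/ltnW jk] := leqP k j.
    by have := lo _ _ kj; have := r0 j; qlra.
  by have := hi _ _ jk; have := r0 k; qlra.
pose S := range (fun k => u k - r k).
have S0 : S !=set0 by exists (u 0%N - r 0%N); exists 0%N.
have Sub : has_ubound S by exists (u 0%N + r 0%N) => _ [k _ <-].
exists (sup S) => k; rewrite ler_norml.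
have h1 : u k - r k <= sup S by apply: ub_le_sup => //; exists k.
have h2 : sup S <= u k + r k by apply: ge_sup => // _ [j _ <-].
by move: h1 h2; rewrite /r; qlra.
Qed.

(** [T] contracts by one half in the sup norm weighted by [w]; the bounds [1] and [Om] make this
    norm equivalent to the plain one. Since the hypothesis on [U] and [V] concerns the box alone,
    finite dependence is part of the notion. *)
Definition halves (T : (R -> R -> R) -> R -> R -> R) K :=
  exists w : R -> R -> R, exists2 Om : R,
    (forall a b, `|a| <= K -> `|b| <= K -> 1 <= w a b <= Om) &
    forall U V c, cont2 U -> cont2 V -> 0 <= c ->
      (forall a b, `|a| <= K -> `|b| <= K -> `|U a b - V a b| <= c * w a b) ->
      forall a b, `|a| <= K -> `|b| <= K -> `|T U a b - T V a b| <= c / 2 * w a b.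

Lemma volterra_unique T K U V : halves T K -> cont2 U -> cont2 V ->
  (forall a b, `|a| <= K -> `|b| <= K -> U a b = T U a b) ->
  (forall a b, `|a| <= K -> `|b| <= K -> V a b = T V a b) ->
  forall a b, `|a| <= K -> `|b| <= K -> U a b = V a b.
Proof.
move=> [w [Om wOm H]] Uc Vc UT VT a b aK bK.
have [B B0 UV] : exists2 B, 0 < B & forall a b, `|a| <= K -> `|b| <= K ->
    `|U a b - V a b| <= B.
  by apply: cont2_bounded; rewrite /cont2; conti.
have Hk (k : nat) a' b' : `|a'| <= K -> `|b'| <= K ->
    `|U a' b' - V a' b'| <= B / 2 ^+ k * w a' b'.
  elim: k a' b' => [|k ih] a' b' aK' bK'.
    rewrite expr0 divr1; apply: le_trans (UV _ _ aK' bK') _.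
    by have := wOm _ _ aK' bK'; nra.
  rewrite UT// VT// exprSr invfM mulrA.
  have Bk : 0 <= B / 2 ^+ k by rewrite divr_ge0 ?exprn_ge0// ltW.
  exact: (H _ _ _ Uc Vc Bk ih).
apply/eqP; rewrite -subr_eq0 -normr_le0 leNgt; apply/negP => p0.
have [k] := half_small (B * Om) p0.
have h1 := Hk k _ _ aK bK; have /andP[_ h2] := wOm _ _ aK bK.
have Bk : 0 <= B / 2 ^+ k by rewrite divr_ge0 ?exprn_ge0// ltW.
by have := ler_wpM2l Bk h2; rewrite (mulrAC B Om); qlra.
Qed.

Lemma volterra_exists T : (forall U, cont2 U -> cont2 (T U)) ->
  (forall K, 0 < K -> halves T K) ->
  exists2 U, cont2 U & forall a b, U a b = T U a b.
Proof.
move=> Tc Th; pose u k := iter k T (fun _ _ => 0).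
have uc k : cont2 (u k).
  elim: k => [|k ih]; last exact: Tc.
  by rewrite /cont2 /u /=; conti.
have box K : 0 < K -> exists C : R, forall k a b, `|a| <= K -> `|b| <= K ->
    `|u k.+1 a b - u k a b| <= C / 2 ^+ k.
  move=> K0; have [w [Om wOm H]] := Th K K0.
  have [B B0 UV] : exists2 B, 0 < B & forall a b, `|a| <= K -> `|b| <= K ->
      `|u 1%N a b - u 0%N a b| <= B.
    by apply: cont2_bounded; have := uc 1%N; have := uc 0%N; rewrite /cont2 => ? ?;
      apply: c_D => //; apply: c_N.
  exists (B * Om) => k a b aK bK.
  have {}H : forall a b, `|a| <= K -> `|b| <= K ->
      `|u k.+1 a b - u k a b| <= B / 2 ^+ k * w a b.
    elim: k => [|k ih] a' b' aK' bK'.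
      rewrite expr0 divr1; apply: le_trans (UV _ _ aK' bK') _.
      by have := wOm _ _ aK' bK'; nra.
    rewrite exprSr invfM mulrA.
    have Bk : 0 <= B / 2 ^+ k by rewrite divr_ge0 ?exprn_ge0// ltW.
    exact: (H _ _ _ (uc _) (uc _) Bk ih).
  apply: le_trans (H _ _ aK bK) _; rewrite (mulrAC B Om) ler_wpM2l//.
    by rewrite divr_ge0 ?exprn_ge0// ltW.
  by have /andP[] := wOm _ _ aK bK.
(* Here the constant still depends on the point. [Ubox] then identifies [U] with the limit taken
   with the constant of a box, which gives locally uniform convergence, hence continuity. *)
have /choice[U UP] : forall a, exists Ua : R -> R, forall b, exists C : R,
    forall k, `|Ua b - u k a b| <= C / 2 ^+ k.
  move=> a; have /choice[Ua HUa] : forall b, exists l, exists C : R, forall k,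
    `|l - u k a b| <= C / 2 ^+ k; last by exists Ua.
  move=> b; have [|C HC] := box (`|a| + `|b| + 1).
    by rewrite ltr_pwDr// addr_ge0.
  have [|l Hl] := @geometric_limit (fun k => u k a b) C.
    by move=> k; apply: HC; have := normr_ge0 a; have := normr_ge0 b; qlra.
  by exists l, (2 * C).
have Ubox K : 0 < K -> exists2 C : R, 0 < C & forall k a b, `|a| <= K -> `|b| <= K ->
    `|U a b - u k a b| <= C / 2 ^+ k.
  move=> K0; have [C HC] := box K K0; exists (`|2 * C| + 1).
    by rewrite ltr_pwDr.
  move=> k a b aK bK; have [C' HC'] := UP a b.
  have [l Hl] := @geometric_limit (fun k => u k a b) C (fun k => HC k a b aK bK).
  have -> : U a b = l.
    apply/eqP; rewrite -subr_eq0 -normr_le0 leNgt; apply/negP => p0.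
    have [j] := half_small (C' + 2 * C) p0; rewrite ltNge => /negP; apply.
    rewrite mulrDl (_ : _ - _ = (U a b - u j a b) - (l - u j a b)); last by ring.
    by apply: le_trans (ler_normB _ _) (lerD (HC' j) (Hl j)).
  apply: le_trans (Hl k) _; rewrite ler_wpM2r ?invr_ge0 ?exprn_ge0//.
  by have := ler_norm (2 * C); qlra.
have Uc : cont2 U.
  apply/cont2P => a b e e0.
  have [|C C0 HC] := Ubox (`|a| + `|b| + 1).
    by rewrite ltr_pwDr// addr_ge0.
  have e3 : 0 < e / 3 by qlra.
  have [k Hk] := half_small C e3.
  have [|d d0 Hd] := (cont2P _).1 (uc k) a b (e / 3); first by qlra.
  exists (Num.min d 1); first by rewrite lt_min d0 ltr01.
  move=> a' b'; rewrite !lt_min => /andP[ad a1] /andP[bd b1].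
  have na := normr_ge0 a; have nb := normr_ge0 b.
  have h1 := HC k a b ltac:(qlra) ltac:(qlra).
  have h2 : `|U a' b' - u k a' b'| <= C / 2 ^+ k.
    apply: HC.
      by have := ler_normB a (a - a'); rewrite opprB addrC subrK; qlra.
    by have := ler_normB b (b - b'); rewrite opprB addrC subrK; qlra.
  have h3 := Hd _ _ ad bd.
  rewrite (_ : _ - _ = (U a b - u k a b) + (u k a b - u k a' b') - (U a' b' - u k a' b'));
    last by ring.
  apply: le_lt_trans (ler_normB _ _) _.
  have := ler_normD (U a b - u k a b) (u k a b - u k a' b'); qlra.
exists U => // a b.
have K0 : 0 < `|a| + `|b| + 1 by rewrite ltr_pwDr// addr_ge0.
have aK : `|a| <= `|a| + `|b| + 1 by have := normr_ge0 b; qlra.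
have bK : `|b| <= `|a| + `|b| + 1 by have := normr_ge0 a; qlra.
have [C C0 HC] := Ubox _ K0; have [w [Om wOm H]] := Th _ K0.
apply/eqP; rewrite -subr_eq0 -normr_le0 leNgt; apply/negP => p0.
have [k] := half_small (C + C * Om) p0; rewrite ltNge => /negP; apply.
rewrite (_ : _ - _ = (U a b - u k.+1 a b) - (T U a b - T (u k) a b)); last first.
  by rewrite /u /=; ring.
apply: le_trans (ler_normB _ _) _; rewrite mulrDl.
have Ck : 0 <= C / 2 ^+ k by rewrite divr_ge0 ?exprn_ge0// ltW.
apply: lerD.
  apply: le_trans (HC _ _ _ aK bK) _; rewrite exprSr invfM mulrA.
  by rewrite ler_piMr// invf_le1// ler1n.
apply: le_trans.
  apply: (H U (u k) (C / 2 ^+ k) Uc (uc k) Ck) => // a' b' aK' bK'.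
  apply: le_trans (HC k _ _ aK' bK') _.
  by have /andP[h1 _] := wOm _ _ aK' bK'; rewrite ler_peMr.
have /andP[h1 h2] := wOm _ _ aK bK.
have Om0 : 0 <= Om by qlra.
have COm := mulr_ge0 Ck Om0.
have C2 : 0 <= C / 2 ^+ k / 2 by qlra.
by have := ler_wpM2l C2 h2; rewrite (mulrAC C Om); qlra.
Qed.

End volterra.

(** * The tortoise coordinate *)

Section tortoise_coordinate.
Context {R : realType} {m : R} {xs r : R -> R}.
Hypothesis m_gt0 : 0 < m.
Hypothesis Hr : tortoise m xs r.
Implicit Types (x y rho : R).

Local Notation N := (lapse m r).
Local Notation P := (potential m r).

Lemma r_gt x : 2 * m < r x.
Proof. by have [_ + _] := Hr; apply. Qed.

Lemma r_gt0 x : 0 < r x.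
Proof. by apply: lt_trans (r_gt x); rewrite mulr_gt0. Qed.

Lemma r_neq0 x : r x != 0.
Proof. by rewrite gt_eqF ?r_gt0. Qed.

Lemma lapse_gt0 x : 0 < N x.
Proof. by rewrite /lapse subr_gt0 ltr_pdivrMr ?r_gt0// mul1r r_gt. Qed.

Lemma lapse_neq0 x : N x != 0.
Proof. by rewrite gt_eqF ?lapse_gt0. Qed.

Lemma lapse_le1 x : N x <= 1.
Proof. by rewrite /lapse gerBl divr_ge0 ?ltW ?r_gt0 ?mulr_gt0. Qed.

Lemma xs_inj a b : 2 * m < a -> 2 * m < b -> xs a = xs b -> a = b.
Proof.
have [xsd _ _] := Hr.
wlog ab : a b / a < b.
  move=> H a2 b2 E; have [ab|ba|//] := ltgtP a b; first exact: H.
  by apply/esym/H.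
move=> a2 b2 E.
have [|c cab] := @d_mvt _ xs (fun rho => (1 - 2 * m / rho)^-1) a b (ltW ab).
  by move=> c cab; apply: xsd; qlra.
rewrite E subrr => /esym/eqP; rewrite mulf_eq0 subr_eq0 (gt_eqF ab) orbF invr_eq0.
have c0 : 0 < c by have m0 := m_gt0; qlra.
have : 2 * m / c < 1 by rewrite ltr_pdivrMr// mul1r; qlra.
by move=> ? /eqP; qlra.
Qed.

Lemma r_xs rho : 2 * m < rho -> r (xs rho) = rho.
Proof.
by move=> h; have [_ _ xsr] := Hr; apply: xs_inj; rewrite ?r_gt ?xsr.
Qed.

Lemma d_r x : has_deriv r x (N x).
Proof.
have [xsd _ xsr] := Hr.
have d0 : 0 < r x - 2 * m by have := r_gt x; qlra.
have nr : \forall rho \near r x, 2 * m < rho.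
  apply: (near_ball d0) => rho; rewrite ltr_norml; qlra.
rewrite -{1}(xsr x) -[N x]invrK.
apply: (@is_derive_inverse R xs r).
- by apply: filterS nr => rho; exact: r_xs.
- by apply: filterS nr => rho h; apply: (@d_cont _ xs rho _ (xsd _ h)).
- exact: xsd (r_gt x).
- by rewrite invr_eq0 lapse_neq0.
Qed.

Lemma d_lapse x : has_deriv N x (2 * m * P x).
Proof.
rewrite /lapse; have h := d_r; have := r_neq0 x => rx.
deriv_to; rewrite /potential; field.
exact: rx.
Qed.

Lemma c_lapse : continuous N.
Proof. exact: d_continuous d_lapse. Qed.

Lemma d_invr x : has_deriv (fun y => (r y)^-1) x (- P x).
Proof.
have h := d_r; have rx := r_neq0 x.
by deriv_to; rewrite /potential; field.
Qed.

Definition dpotential x := 2 * m * P x / r x ^+ 2 - 2 * N x ^+ 2 / r x ^+ 3.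

Lemma d_potential x : has_deriv P x (dpotential x).
Proof.
rewrite /potential; have h := d_invr; have h2 := d_lapse; have rx := r_neq0 x.
have -> : (fun x => N x / r x ^+ 2) = (fun x => N x * (r x)^-1 ^+ 2).
  by apply/funext => y; rewrite exprVn.
by deriv_to; rewrite /dpotential /potential; field.
Qed.

Lemma c_potential : continuous P.
Proof. exact: d_continuous d_potential. Qed.

Lemma c_invr : continuous (fun y => (r y)^-1).
Proof. exact: d_continuous d_invr. Qed.

Lemma c_dpotential : continuous dpotential.
Proof.
have h1 := c_potential; have h2 := c_lapse; have h3 := c_invr.
have -> : dpotential = (fun x => 2 * m * P x * (r x)^-1 ^+ 2 - 2 * N x ^+ 2 * (r x)^-1 ^+ 3).
  by apply/funext => x; rewrite /dpotential !exprVn.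
by conti.
Qed.

Lemma potential_gt0 x : 0 < P x.
Proof. by rewrite /potential divr_gt0 ?exprn_gt0 ?lapse_gt0 ?r_gt0. Qed.

Lemma potential_le_lapse x : P x <= N x / (4 * m ^+ 2).
Proof.
rewrite /potential ler_pM2l ?lapse_gt0// lef_pV2 ?posrE ?exprn_gt0 ?r_gt0//; last first.
  by rewrite mulr_gt0 ?exprn_gt0.
have h1 := r_gt x; have m0 := m_gt0; have h2 := r_gt0 x.
suff : 0 <= (r x - 2 * m) * (r x + 2 * m) by qlra.
by rewrite mulr_ge0//; qlra.
Qed.

Lemma potential_le_invr x : P x <= (r x)^-1 ^+ 2.
Proof.
by rewrite /potential exprVn ler_piMl ?lapse_le1// invr_ge0 exprn_ge0// ltW ?r_gt0.
Qed.

Lemma potential_le x : P x <= (4 * m ^+ 2)^-1.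
Proof.
apply: le_trans (potential_le_lapse x) _.
by rewrite ler_piMl ?lapse_le1// invr_ge0 mulr_ge0 ?exprn_ge0// ltW.
Qed.

Lemma lapse_homo x y : x <= y -> N x <= N y.
Proof.
move=> xy; apply: (@d_le _ _ (fun x => 2 * m * P x) _ _ xy) => z _.
  exact: d_lapse.
by rewrite mulr_ge0 ?(ltW (potential_gt0 _))// mulr_ge0// ltW.
Qed.

(** Since [r' = N] and [N] is nondecreasing, [r] grows at least at the rate [N 0] to the right of
    0. *)
Lemma r_growth x : 0 <= x -> r 0 + N 0 * x <= r x.
Proof.
move=> x0; have := @d_le2 _ (fun y => N 0 * y) r (fun=> N 0) N 0 x x0.
move=> H; suff : N 0 * x - N 0 * 0 <= r x - r 0 by rewrite mulr0; qlra.
apply: H => y; first by move=> _; deriv_to; ring.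
  by move=> _; exact: d_r.
by move=> /andP[y0 _]; exact: lapse_homo.
Qed.

(** Two different mechanisms: at infinity [P <= r ^- 2] and [r] grows linearly; at the horizon [P]
    is at most a multiple of the lapse, which tends to 0. *)
Lemma potential_vanishes (e : R) : 0 < e -> exists2 X, 0 < X &
  forall x, X <= `|x| -> P x <= e.
Proof.
move=> e0; have N0 := lapse_gt0 0; have r0 := r_gt0 0.
have [X1 X10 H1] : exists2 X, 0 < X & forall x, X <= x -> P x <= e.
  exists (1 + (e * N 0 )^-1 + (N 0)^-1).
    by rewrite !addr_gt0 ?invr_gt0 ?mulr_gt0.
  move=> x Xx; have eN0 : 0 < (e * N 0)^-1 by rewrite invr_gt0 mulr_gt0.
  have iN0 : 0 < (N 0)^-1 by rewrite invr_gt0.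
  have x0 : 0 <= x by qlra.
  have rx : N 0 * x <= r x by have := r_growth x0; qlra.
  have h1 : 1 <= r x.
    have : N 0 * (N 0)^-1 <= N 0 * x by rewrite ler_pM2l//; qlra.
    by rewrite mulfV ?gt_eqF//; qlra.
  have h2 : e^-1 <= r x.
    have : N 0 * (e * N 0)^-1 <= N 0 * x by rewrite ler_pM2l//; qlra.
    by rewrite invfM mulrCA mulfV ?gt_eqF// mulr1; qlra.
  apply: le_trans (potential_le_invr x) _; rewrite exprVn invf_ple ?posrE ?exprn_gt0 ?r_gt0//.
  apply: le_trans h2 _; rewrite expr2; have := r_gt0 x => rp.
  by rewrite ler_peMr// ltW.
have [X2 X20 H2] : exists2 X, X < 0 & forall x, x <= X -> P x <= e.
  pose d := e * (4 * m ^+ 2); have d0 : 0 < d by rewrite !mulr_gt0 ?exprn_gt0.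
  have key x : N x <= d -> P x <= e.
    move=> h; apply: le_trans (potential_le_lapse x) _.
    by rewrite ler_pdivrMr ?mulr_gt0 ?exprn_gt0.
  (* If the lapse exceeded [d] at some [x <= X], by monotonicity it would do so on all of [[x, 0]],
     and [r x <= r 0 + d * x] would be negative. *)
  pose X := - (r 0 / d) - 1.
  have X0 : X < 0 by rewrite /X; have : 0 < r 0 / d by [rewrite divr_gt0]; qlra.
  exists X => // x xX; apply: key; rewrite leNgt; apply/negP => Nx.
  have Nx' : d < N X by apply: lt_le_trans Nx (lapse_homo xX).
  have x0 : x <= 0 by qlra.
  have := @d_le2 _ (fun y => d * y) r (fun=> d) N x 0 x0.
  move=> H; have : d * 0 - d * x <= r 0 - r x.
    apply: H => y; first by move=> _; deriv_to; ring.
      by move=> _; exact: d_r.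
    by move=> /andP[xy _]; apply/ltW/(lt_le_trans Nx)/lapse_homo.
  have := r_gt0 x; suff : r 0 < - (d * x) by qlra.
  rewrite -mulrN mulrC -ltr_pdivrMr//; move: xX; rewrite /X; qlra.
exists (Num.max X1 (- X2)); first by rewrite lt_max X10.
move=> x; rewrite ge_max; have [x0|x0] := ger0P x; move=> /andP[h1 h2].
  exact: H1.
by apply: H2; qlra.
Qed.

End tortoise_coordinate.

(** * A direction of negative energy *)

Section stationary_profile.
Context {R : realType} {m : R} {xs r : R -> R} {W W1 : R -> R}.
Hypothesis m_gt0 : 0 < m.
Hypothesis Hr : tortoise m xs r.
Implicit Types (x y : R).

Local Notation N := (lapse m r).
Local Notation P := (potential m r).

Lemma bounded_slope (f df : R -> R) (d x : R) : 0 < d ->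
  (forall y, has_deriv f y (df y)) -> (forall y, `|f y| <= 1) ->
  ~ (forall y, y <= x -> d <= df y) /\ ~ (forall y, x <= y -> d <= df y).
Proof.
move=> d0 fd f1.
(* Over a length [3 / d] such a function rises by at least 3, while its values differ by at most
   2. *)
have key a : ~ (forall y, a <= y <= a + 3 / d -> d <= df y).
  move=> H; have h0 : 0 < 3 / d by rewrite divr_gt0.
  have ab : a <= a + 3 / d by qlra.
  have := @d_le2 _ (fun y => d * y) f (fun=> d) df a _ ab.
  move=> /(_ _ _ H) h.
  have : d * (a + 3 / d) - d * a <= f (a + 3 / d) - f a.
    by apply: h => y _; [deriv_to; ring|exact: fd].
  have -> : d * (a + 3 / d) - d * a = 3 by field; rewrite gt_eqF.
  have := f1 a; have := f1 (a + 3 / d); rewrite !ler_norml; qlra.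
split=> H.
  by apply: (key (x - 3 / d)) => y /andP[_ yx]; apply: H; qlra.
by apply: (key x) => y /andP[xy _]; exact: H.
Qed.

Hypothesis Wd : forall x, has_deriv W x (W1 x).
Hypothesis W1d : forall x, has_deriv W1 x (P x * W x * (W x ^+ 2 - 1)).
Hypothesis W_le1 : forall x, `|W x| <= 1.

(* Compare W' with an antiderivative of P (from either end): the difference
   is monotone because [`|W (W^2 - 1)| <= 1]. *)
Lemma slope_bounds x : `|W1 x| <= N x / (2 * m) /\ `|W1 x| <= (r x)^-1.
Proof.
have m0 := m_gt0; have h2 := d_lapse m_gt0 Hr; have h3 := d_invr m_gt0 Hr.
have q1 y : has_deriv (fun z => N z / (2 * m)) y (P y).
  by deriv_to; field; rewrite gt_eqF.
have q2 y : has_deriv (fun z => - (r z)^-1) y (P y).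
  by deriv_to; ring.
have Nm y : 0 < N y / (2 * m).
  by rewrite divr_gt0 ?mulr_gt0// (lapse_gt0 m_gt0 Hr).
have rp y : 0 < (r y)^-1 by rewrite invr_gt0 (r_gt0 m_gt0 Hr).
have Pp y := potential_gt0 m_gt0 Hr y.
have main (V V1 : R -> R) : (forall x, has_deriv V x (V1 x)) ->
    (forall x, has_deriv V1 x (P x * V x * (V x ^+ 2 - 1))) ->
    (forall x, `|V x| <= 1) -> V1 x <= N x / (2 * m) /\ V1 x <= (r x)^-1.
  move=> Vd V1d V1l.
  have b y : `|V y * (V y ^+ 2 - 1)| <= 1.
    have := V1l y; rewrite ler_norml => /andP[h h'].
    have s1 : V y ^+ 2 <= 1.
      have : 0 <= (1 - V y) * (1 + V y) by rewrite mulr_ge0; qlra.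
      by rewrite expr2; qlra.
    have s2 : `|V y ^+ 2 - 1| <= 1.
      by have := sqr_ge0 (V y); rewrite ler_norml; qlra.
    have : `|V y| * `|V y ^+ 2 - 1| <= 1 * 1 by apply: ler_pM.
    by rewrite normrM mulr1.
  have b1 y : - P y <= P y * V y * (V y ^+ 2 - 1) <= P y.
    have := b y; rewrite -mulrA ler_norml => /andP[h h'].
    have := Pp y => p; apply/andP; split; last by rewrite ger_pMr.
    by rewrite -[leLHS]mulrN1 ler_pM2l.
  split; rewrite leNgt; apply/negP => V1x.
    have d0 : 0 < V1 x - N x / (2 * m) by qlra.
    have [+ _] := @bounded_slope V V1 _ x d0 Vd V1l; apply => y yx.
    have := @d_le2 _ V1 (fun z => N z / (2 * m)) _ P y x yx.
    move=> /(_ _ (fun z _ => V1d z) (fun z _ => q1 z)) h.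
    have : V1 x - V1 y <= N x / (2 * m) - N y / (2 * m).
      by apply: h => z _; have /andP[] := b1 z.
    by have := Nm y; qlra.
  have d0 : 0 < V1 x - (r x)^-1 by qlra.
  have [_ +] := @bounded_slope V V1 _ x d0 Vd V1l; apply => y yx.
  have := @d_le2 _ (fun z => (r z)^-1) V1 (fun z => - P z) _ x y yx.
  move=> /(_ _ (fun z _ => h3 z) (fun z _ => V1d z)) h.
  have : (r y)^-1 - (r x)^-1 <= V1 y - V1 x.
    by apply: h => z _; have /andP[] := b1 z.
  by have := rp y; qlra.
have [a1 a2] := main W W1 Wd W1d W_le1.
have [|||b1 b2] := main (fun x => - W x) (fun x => - W1 x).
- by move=> y; have ? := Wd; deriv.
- by move=> y; have ? := W1d; deriv_to; ring.
- by move=> y; rewrite normrN.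
by rewrite !ler_norml; split; qlra.
Qed.

(* The generator of dilations [r d/dr] applied to the profile. *)
Definition dil x := r x * W1 x / N x.
Definition ddil x := dil x * (1 - 4 * m / r x) / r x + W x * (W x ^+ 2 - 1) / r x.

Lemma W1_dil x : W1 x = N x * dil x / r x.
Proof.
by rewrite /dil; field; rewrite (lapse_neq0 m_gt0 Hr) (r_neq0 m_gt0 Hr).
Qed.

Lemma lapseE x : N x = 1 - 2 * m / r x. Proof. by []. Qed.

Lemma d_dil x : has_deriv dil x (ddil x).
Proof.
have rx := r_neq0 m_gt0 Hr x; have Nx := lapse_neq0 m_gt0 Hr x.
have h1 := d_r m_gt0 Hr; have h2 := d_lapse m_gt0 Hr; have ? := W1d.
rewrite /dil; deriv_to; rewrite /ddil /dil /potential.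
rewrite lapseE; have := r_gt Hr x; rewrite -subr_gt0 => /lt0r_neq0 rm.
by field; rewrite rx rm.
Qed.

(** The first term is the linearized operator at [W]. The other two measure the failure of scale
    invariance; both carry a factor [m], and they produce the negative direction. *)
Definition dddil x := (3 * W x ^+ 2 - 1) * P x * dil x - 2 * m / r x ^+ 2 * ddil x
  + 4 * m * P x / r x * dil x.

Lemma d_ddil x : has_deriv ddil x (dddil x).
Proof.
have rx := r_neq0 m_gt0 Hr x; have Nx := lapse_neq0 m_gt0 Hr x.
have h1 := d_r m_gt0 Hr; have h2 := d_dil; have ? := Wd.
rewrite /ddil; deriv_to; rewrite -/(ddil x) W1_dil /dddil /ddil /potential.
by rewrite lapseE; field.
Qed.

(** The two bounds of [slope_bounds] serve in two zones: for [r <= 4 m] the one by the lapse, which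
    cancels the division by [N]; beyond, the one by [1 / r], where [N >= 1 / 2]. *)
Lemma dil_le2 x : `|dil x| <= 2.
Proof.
have [h1 h2] := slope_bounds x; have m0 := m_gt0.
have rx := r_gt0 m_gt0 Hr x; have Nx := lapse_gt0 m_gt0 Hr x.
rewrite /dil normrM normfV (gtr0_norm Nx) normrM (gtr0_norm rx) ler_pdivrMr//.
have [r4|r4] := leP (r x) (4 * m).
  apply: le_trans (_ : r x * (N x / (2 * m)) <= _); first by rewrite ler_pM2l.
  rewrite mulrCA mulrC ler_pM2r// ler_pdivrMr ?mulr_gt0//; qlra.
apply: le_trans (_ : r x * (r x)^-1 <= _); first by rewrite ler_pM2l.
rewrite mulfV ?gt_eqF// lapseE.
have : 2 * m / r x <= 1 / 2 by rewrite ler_pdivrMr//; qlra.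
qlra.
Qed.

Hypothesis W_nonconstant : exists x, W1 x != 0.

(** The test function is [dil] times the cutoff [1 - x^2 / K^2]. Its quadratic form is minus a fixed
    positive amount, from the broken scale invariance, plus cutoff errors of order [1 / K]; it is
    negative for large [K], and stays so after a small shift [d]. *)
Lemma unstable_direction : exists (K d : R) (f df : R -> R),
  [/\ 0 < K, 0 < d & [/\ forall x, has_deriv f x (df x), continuous df,
      f K = 0, f (- K) = 0 &
      integ (fun x => df x ^+ 2 + ((3 * W x ^+ 2 - 1) * P x + d) * f x ^+ 2) (- K) K < 0]].
Proof.
have [x0 W1x0] := W_nonconstant; have m0 := m_gt0.
have vd := d_dil; have dvd := d_ddil.
have vc : continuous dil := d_continuous vd.
have dvc : continuous ddil := d_continuous dvd.
have Wc : continuous W := d_continuous Wd.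
have Pc := c_potential m_gt0 Hr; have Nc := c_lapse m_gt0 Hr.
have irc := c_invr m_gt0 Hr.
(* Integration by parts of the [ddil] term of [dddil] gives [+ 2 m N dil^2 / r^3], its last term
   gives [- 4 m N dil^2 / r^3]; the sum is [- G], up to a term in the derivative of the cutoff. *)
pose G x := 2 * m * N x * (r x)^-1 ^+ 3 * dil x ^+ 2.
have Gc : continuous G by rewrite /G; conti.
have rp x := r_gt0 m_gt0 Hr x; have Np x := lapse_gt0 m_gt0 Hr x.
have ir x : 0 < (r x)^-1 by rewrite invr_gt0 rp.
have G0 x : 0 <= G x.
  by rewrite /G mulr_ge0 ?sqr_ge0// mulr_ge0 ?exprn_ge0 ?(ltW (ir _))// mulr_ge0 ?(ltW
    (Np _))// mulr_ge0// ltW.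
have Gx0 : 0 < G x0.
  have dx0 : dil x0 != 0.
    by rewrite /dil !mulf_neq0// ?invr_neq0// gt_eqF.
  rewrite /G mulr_gt0 ?exprn_even_gt0//.
  by rewrite mulr_gt0 ?exprn_gt0 ?ir// mulr_gt0 ?Np// mulr_gt0.
pose L := `|x0| + 1.
have L1 : 1 <= L by rewrite lerDr.
have g0 : 0 < integ G (- L) L.
  apply: (@integ_gt0 _ G _ _ x0) => //; first by qlra.
  by rewrite -ler_norml /L; qlra.
set g := integ G (- L) L in g0.
have r00 := rp 0; have N00 := Np 0.
(* For [x >= 0], [x / r^2 <= x / (r 0 + N 0 x)^2 <= 1 / (4 r 0 N 0)] by the inequality of means.
   With [dil^2 <= 4] this bounds the cross term by [c3 / K^2]; for [x <= 0] that term is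
   nonpositive. *)
pose c3 := 4 * m / (r 0 * N 0).
have c30 : 0 < c3 by rewrite /c3 divr_gt0 ?mulr_gt0.
(* [K >= 2 L] keeps the cutoff above [3 / 4] on [[- L, L]], so at least half of [g] survives; the
   second summand makes the total error [(32 + 2 c3) / K] smaller than [g / 2]. *)
pose K := 2 * L + (64 + 4 * c3) / g + 1.
have q0 : 0 < (64 + 4 * c3) / g by rewrite divr_gt0//; qlra.
have K0 : 0 < K by rewrite /K; qlra.
have KL : 2 * L <= K by rewrite /K; qlra.
have K1 : 1 <= K by qlra.
have KN : K != 0 by rewrite gt_eqF.
pose chi x := 1 - x ^+ 2 / K ^+ 2.
pose f x := chi x * dil x.
pose df x := - (2 * x / K ^+ 2) * dil x + chi x * ddil x.
have chid x : has_deriv chi x (- (2 * x / K ^+ 2)).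
  by rewrite /chi; deriv_to; field.
have fd x : has_deriv f x (df x).
  by rewrite /f; deriv.
have chic : continuous chi := d_continuous chid.
have fc : continuous f := d_continuous fd.
have dfc : continuous df by rewrite /df; conti.
pose s x := (2 * x / K ^+ 2) ^+ 2 * dil x ^+ 2 - chi x ^+ 2 * G x
  + 4 * chi x * x * m * dil x ^+ 2 / K ^+ 2 * (r x)^-1 ^+ 2.
have sc : continuous s by rewrite /s; conti.
(* The boundary term of the integration by parts: the quadratic form density is [s + Z'], and [Z]
   vanishes at both ends together with [chi]. *)
pose Z x := chi x ^+ 2 * (dil x * ddil x + m * dil x ^+ 2 * (r x)^-1 ^+ 2).
have Zd x : has_deriv Z x (df x ^+ 2 + (3 * W x ^+ 2 - 1) * P x * f x ^+ 2 - s x).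
  rewrite /Z; have h := d_invr m_gt0 Hr; deriv_to.
  have rx : r x != 0 by rewrite gt_eqF.
  by rewrite /df /s /f /dddil /G /potential; field; rewrite rx KN.
have chiK : chi K = 0 by rewrite /chi divff ?expf_neq0// subrr.
have chiNK : chi (- K) = 0 by rewrite /chi sqrrN divff ?expf_neq0// subrr.
have Qc : continuous (fun x => df x ^+ 2 + (3 * W x ^+ 2 - 1) * P x * f x ^+ 2).
  by conti.
have f2c : continuous (fun x => f x ^+ 2) by conti.
pose Q := integ (fun x => df x ^+ 2 + (3 * W x ^+ 2 - 1) * P x * f x ^+ 2) (- K) K.
have QE : Q = integ s (- K) K.
  apply/eqP; rewrite -subr_eq0 -mulN1r -(integZ _ _ _ sc) /Q -integD//; last by conti.
  rewrite (@integE _ _ Z) /Z ?chiK ?chiNK; first by apply/eqP; ring.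
    by conti.
  by move=> x _; apply: has_deriv_val (Zd x) _; ring.
(* The constant 16 comes from the derivative of [chi] being at most [2 / K] in size and [dil] at
   most 2. *)
have s1 x : - K <= x <= K -> s x <= (16 + c3) / K ^+ 2 - chi x ^+ 2 * G x.
  move=> xK; rewrite /s mulrDl.
  have v4 : dil x ^+ 2 <= 4.
    have := dil_le2 x; rewrite ler_norml => /andP[a b].
    have : 0 <= (2 - dil x) * (2 + dil x) by rewrite mulr_ge0; qlra.
    by rewrite expr2; qlra.
  have v0 : 0 <= dil x ^+ 2 by exact: sqr_ge0.
  have K2 : 0 < K ^+ 2 by rewrite exprn_gt0.
  have x2 : x ^+ 2 <= K ^+ 2.
    have : 0 <= (K - x) * (K + x) by rewrite mulr_ge0; qlra.
    by rewrite !expr2; qlra.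
  have t1 : (2 * x / K ^+ 2) ^+ 2 * dil x ^+ 2 <= 16 / K ^+ 2.
    have -> : (2 * x / K ^+ 2) ^+ 2 * dil x ^+ 2 = (4 * (x ^+ 2 / K ^+ 2) * dil x ^+ 2) / K ^+ 2.
      by field.
    rewrite ler_pM2r ?invr_gt0//.
    have a1 : x ^+ 2 / K ^+ 2 <= 1 by rewrite ler_pdivrMr// mul1r.
    have a0 : 0 <= x ^+ 2 / K ^+ 2 by rewrite divr_ge0 ?sqr_ge0// ltW.
    have : (x ^+ 2 / K ^+ 2) * dil x ^+ 2 <= 1 * 4 by apply: ler_pM.
    qlra.
  have chi0 : 0 <= chi x by rewrite /chi subr_ge0 ler_pdivrMr// mul1r.
  have chi1 : chi x <= 1 by rewrite /chi gerBl divr_ge0 ?sqr_ge0// ltW.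
  have t3 : 4 * chi x * x * m * dil x ^+ 2 / K ^+ 2 * (r x)^-1 ^+ 2 <= c3 / K ^+ 2.
    rewrite (mulrAC _ (K ^+ 2)^-1) ler_pM2r ?invr_gt0//.
    have [x0'|x0'] := leP x 0.
      apply: (@le_trans _ _ 0); last exact: ltW.
      rewrite [leLHS](_ : _ = - (4 * chi x * m * dil x ^+ 2 * (r x)^-1 ^+ 2 * - x)); last by ring.
      have i2 : 0 <= (r x)^-1 ^+ 2 by rewrite sqr_ge0.
      have x'0 : 0 <= - x by qlra.
      rewrite oppr_le0; apply: mulr_ge0 => //; apply: mulr_ge0 => //.
      by apply: mulr_ge0 => //; apply: mulr_ge0; qlra.
    have rg := r_growth m_gt0 Hr (ltW x0').
    have rr : x * (r x)^-1 ^+ 2 <= (4 * (r 0 * N 0))^-1.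
      rewrite exprVn ler_pdivrMr ?exprn_gt0// mulrC ler_pdivlMr ?mulr_gt0//.
      have : (r 0 + N 0 * x) ^+ 2 <= r x ^+ 2.
        by rewrite ler_sqr ?nnegrE// ltW// addr_gt0// mulr_gt0.
      by have := sqr_ge0 (r 0 - N 0 * x); qlra.
    have -> : c3 = 16 * m * (4 * (r 0 * N 0))^-1.
      by rewrite /c3; field; rewrite !gt_eqF.
    have xr0 : 0 <= x * (r x)^-1 ^+ 2 by rewrite mulr_ge0 ?exprn_ge0// ltW.
    rewrite [leLHS](_ : _ = (4 * m) * ((chi x * dil x ^+ 2) * (x * (r x)^-1 ^+ 2))); last by ring.
    rewrite [leRHS](_ : _ = (4 * m) * (4 * (4 * (r 0 * N 0))^-1)); last by ring.
    have cv0 : 0 <= chi x * dil x ^+ 2 by exact: mulr_ge0.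
    have cv4 : chi x * dil x ^+ 2 <= 1 * 4 by apply: ler_pM.
    by rewrite ler_pM2l ?mulr_gt0//; apply: ler_pM => //; qlra.
  qlra.
have QL : Q <= (32 + 2 * c3) / K - g / 2.
  rewrite QE.
  have c1 : continuous (fun x => chi x ^+ 2 * G x) by conti.
  have KK : - K <= K by qlra.
  have : integ s (- K) K <= integ (fun x => (16 + c3) / K ^+ 2 + -1 * (chi x ^+ 2 * G x)) (- K) K.
    apply: integ_le => //; first by conti.
    by move=> x /s1; rewrite mulN1r.
  rewrite [X in _ <= X -> _]integD; [|by conti|by conti]; rewrite integ_cst (integZ (-1) _ _ c1).
  have -> : (16 + c3) / K ^+ 2 * (K - - K) = (32 + 2 * c3) / K by field.
  have h1 : integ (fun x => chi x ^+ 2 * G x) (- L) L <= integ (fun x => chi x ^+ 2 * G x)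
    (- K) K.
    apply: integ_sub => //; [qlra|qlra|qlra|].
    by move=> x _; rewrite mulr_ge0 ?sqr_ge0.
  have h2 : 1 / 2 * integ G (- L) L <= integ (fun x => chi x ^+ 2 * G x) (- L) L.
    rewrite -integZ//; apply: integ_le => //; [by conti|by qlra|].
    move=> x xL; rewrite ler_wpM2r//.
    have xK : x ^+ 2 / K ^+ 2 <= 1 / 4.
      rewrite ler_pdivrMr ?exprn_gt0//.
      have : 0 <= (K - 2 * x) * (K + 2 * x) by rewrite mulr_ge0; qlra.
      by rewrite !expr2; qlra.
    have : 3 / 4 <= chi x by rewrite /chi; qlra.
    move=> h; have : (3 / 4) ^+ 2 <= chi x ^+ 2 by rewrite ler_sqr// ?nnegrE; qlra.
    qlra.
  rewrite -/g in h2; qlra.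
have QN : Q < 0.
  apply: le_lt_trans QL _; rewrite subr_lt0 ltr_pdivrMr//.
  have : g / 2 * ((64 + 4 * c3) / g) < g / 2 * K.
    by rewrite ltr_pM2l ?divr_gt0// /K; qlra.
  have -> : g / 2 * ((64 + 4 * c3) / g) = 32 + 2 * c3 by field; rewrite gt_eqF.
  by [].
have I0 : 0 <= integ (fun x => f x ^+ 2) (- K) K.
  by apply: integ_ge0 => //; [qlra|move=> x _; exact: sqr_ge0].
set I := integ (fun x => f x ^+ 2) (- K) K in I0.
(* The shift adds [d * I], which by this choice of [d] is at most half of [- Q]. *)
exists K, (- Q / (2 * (I + 1))), f, df; split=> //.
  by rewrite divr_gt0 ?mulr_gt0//; qlra.
split=> //; rewrite /f ?chiK ?chiNK ?mul0r//.
set d := - Q / _.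
have -> : (fun x => df x ^+ 2 + ((3 * W x ^+ 2 - 1) * P x + d) * f x ^+ 2) =
  (fun x => df x ^+ 2 + (3 * W x ^+ 2 - 1) * P x * f x ^+ 2 + d * f x ^+ 2).
  by apply/funext => x; ring.
rewrite integD//; last by conti.
rewrite integZ// -/Q -/I /d.
have -> : - Q / (2 * (I + 1)) * I = - Q / 2 * (I / (I + 1)).
  by field; rewrite gt_eqF//; qlra.
have : I / (I + 1) <= 1 by rewrite ler_pdivrMr ?mul1r; qlra.
move=> h; have : - Q / 2 * (I / (I + 1)) <= - Q / 2 * 1 by rewrite ler_pM2l//; qlra.
qlra.
Qed.

End stationary_profile.

(** * Linear second-order equations *)

Section exponential_weight.
Context {R : realType}.
Implicit Types (g c a b s x : R) (f : R -> R).

(** This is [2 cosh (g s)]: even in [s], at least 1, and integration against it from 0 gains a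
    factor [1 / g] in both directions. *)
Definition eweight g s := expR (g * s) + expR (- (g * s)).

Lemma c_eweight g : continuous (eweight g).
Proof. by rewrite /eweight; conti. Qed.

Lemma eweight_ge1 g s : 1 <= eweight g s.
Proof.
rewrite /eweight; have [h|/ltW h] := leP 0 (g * s).
  have : expR 0 <= expR (g * s) by rewrite ler_expR.
  by rewrite expR0; have := expR_gt0 (- (g * s)); qlra.
have : expR 0 <= expR (- (g * s)) by rewrite ler_expR; qlra.
by rewrite expR0; have := expR_gt0 (g * s); qlra.
Qed.

Lemma eweight_le g s b : 0 <= g -> `|s| <= b -> eweight g s <= 2 * expR (g * b).
Proof.
move=> g0; rewrite ler_norml => /andP[h1 h2].
have : expR (g * s) <= expR (g * b) by rewrite ler_expR ler_wpM2l.
have : expR (- (g * s)) <= expR (g * b) by rewrite ler_expR -mulrN ler_wpM2l//; qlra.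
rewrite /eweight; qlra.
Qed.

Lemma eweight_integ g c f a b : 0 < g -> 0 <= c -> continuous f ->
  (forall x, Num.min a b <= x <= Num.max a b -> `|f x| <= c * eweight g (x - a)) ->
  `|integ f a b| <= c / g * eweight g (b - a).
Proof.
move=> g0 c0 fc H; have wc := c_eweight (g := g).
have cc : continuous (fun x => c * eweight g (x - a)) by conti.
apply: le_trans (integ_norm fc cc H) _.
rewrite (@integE _ _ (fun x => c / g * (expR (g * (x - a)) - expR (- (g * (x - a))))))//;
  last first.
  move=> x _; deriv_to; rewrite /eweight; field; by rewrite gt_eqF.
have cg : 0 <= c / g by rewrite divr_ge0// ltW.
rewrite subrr mulr0 oppr0 subrr mulr0 subr0 normrM (ger0_norm cg).
rewrite ler_wpM2l// ler_norml /eweight.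
by have := expR_gt0 (g * (b - a)); have := expR_gt0 (- (g * (b - a))); qlra.
Qed.

Lemma prim_integ f b : continuous f -> prim f b = integ f 0 b.
Proof. by move=> fc; rewrite /integ prim0// subr0. Qed.

Lemma integB f1 f2 a b : continuous f1 -> continuous f2 ->
  integ (fun x => f1 x - f2 x) a b = integ f1 a b - integ f2 a b.
Proof.
move=> c1 c2; rewrite (@integE _ _ (fun x => prim f1 x - prim f2 x)).
- by rewrite /integ; ring.
- by conti.
- by move=> x _; apply: d_D; [|apply: d_N]; exact: d_prim.
Qed.

Lemma minmax_norm a b x K : `|a| <= K -> `|b| <= K ->
  Num.min a b <= x <= Num.max a b -> `|x| <= K.
Proof.
rewrite !ler_norml /Num.min /Num.max => h1 h2.
by case: ifPn; rewrite -?leNgt => ?; qlra.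
Qed.

End exponential_weight.

Section linear_ode.
Context {R : realType}.
Implicit Types (V : R -> R) (mu x y c s : R).

(** The parameter [mu] is the first variable of the unknown, so the fixed point theorem yields joint
    continuity in [(mu, x)], which the shooting argument relies on. *)
Lemma linear_ode_exists V c s : continuous V ->
  exists U U1 : R -> R -> R, [/\ cont2 U, cont2 U1,
    forall mu, U mu 0 = c, forall mu, U1 mu 0 = s &
    forall mu x, has_deriv (U mu) x (U1 mu x) /\
                 has_deriv (U1 mu) x ((V x + mu) * U mu x)].
Proof.
move=> Vc.
pose F (U : R -> R -> R) mu x := (V x + mu) * U mu x.
have Fc U : cont2 U -> cont2 (F U).
  by move=> Uc; rewrite /cont2 /F; conti.
have pFc U : cont2 U -> cont2 (fun mu => prim (F U mu)).
  by move=> Uc; exact: cont2_prim (Fc U Uc).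
pose T U mu x := c + s * x + prim (prim (F U mu)) x.
have Tc U : cont2 U -> cont2 (T U).
  move=> Uc; rewrite /cont2 /T; apply: c_D; first by conti.
  exact: cont2_prim (pFc U Uc).
have Th K : 0 < K -> halves T K.
  move=> K0; have [B B0 VB] := cont_bounded K Vc.
  (* [L] bounds the coefficient on the box and two integrations gain [1 / g^2]; this [g] gives
     [L / g^2 <= 1 / 2]. *)
  pose L := B + K; pose g := 2 * L + 1.
  have L0 : 0 < L by rewrite /L; qlra.
  have g0 : 0 < g by rewrite /g; qlra.
  exists (fun _ x => eweight g x), (2 * expR (g * K)).
    by move=> a b aK bK; rewrite eweight_ge1 eweight_le// ltW.
  move=> U W d Uc Wc d0 H a b aK bK.
  have FU : continuous (F U a) := cont2_l (Fc U Uc).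
  have FW : continuous (F W a) := cont2_l (Fc W Wc).
  have pU : continuous (prim (F U a)) by exact: c_prim.
  have pW : continuous (prim (F W a)) by exact: c_prim.
  have K00 : `|0 : R| <= K by rewrite normr0 ltW.
  rewrite (_ : _ - _ = integ (fun x => prim (F U a) x - prim (F W a) x) 0 b); last first.
    by rewrite integB// /T -!prim_integ//; ring.
  have Ld : 0 <= L * d by rewrite mulr_ge0// ltW.
  apply: le_trans (_ : L * d / g / g * eweight g (b - 0) <= _).
    apply: eweight_integ => //; [by rewrite divr_ge0// ltW|by conti|].
    move=> x xb; have xK := minmax_norm K00 bK xb.
    rewrite !prim_integ// -integB// -[X in _ * eweight g X]/(x - 0).
    apply: eweight_integ => //; first by conti.
    move=> y yx; have yK := minmax_norm K00 xK yx.
    rewrite /F -mulrBr normrM -mulrA subr0; apply: ler_pM => //; last exact: H.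
    by apply: le_trans (ler_normD _ _) _; rewrite /L lerD// VB.
  rewrite subr0 ler_wpM2r//.
    by apply: le_trans (eweight_ge1 g b).
  rewrite -mulrA -invfM mulrAC mulrC ler_wpM2l//.
  rewrite ler_pdivrMr ?mulr_gt0// /g.
  by have := sqr_ge0 L; rewrite expr2; qlra.
have [U Uc UT] := volterra_exists Tc Th.
have FU a : continuous (F U a) := cont2_l (Fc U Uc).
have pU a : continuous (prim (F U a)) by exact: c_prim.
have UE mu : U mu = T U mu by apply/funext => x; exact: UT.
exists U, (fun mu x => s + prim (F U mu) x); split => //.
- by apply: c_D; [conti|exact: pFc].
- by move=> mu; rewrite UT /T mulr0 prim0// !addr0.
- by move=> mu; rewrite prim0// addr0.
- move=> mu x; have h1 y := d_prim y (FU mu); have h2 y := d_prim y (pU mu); split.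
    by rewrite UE /T; deriv_to; ring.
  by deriv_to; rewrite /F; ring.
Qed.

Lemma deriv_at_min (f : R -> R) x l : has_deriv f x l -> (forall y, f x <= f y) ->
  l = 0.
Proof.
move=> fd fm; have [g [fE gc gx]] := (is_derive1_caratheodory f x l).1 fd.
apply/eqP; apply/negPn/negP => l0.
have [|d d0 H] := (cont_epsP _ _).1 gc `|l|; first by rewrite normr_gt0.
have h1 := H (x + d / 2); have h2 := H (x - d / 2).
have : `|x - (x + d / 2)| < d by rewrite ltr_norml; qlra.
have : `|x - (x - d / 2)| < d by rewrite ltr_norml; qlra.
move=> /h2 {}h2 /h1 {}h1.
have := fE (x + d / 2); have := fE (x - d / 2).
have := fm (x + d / 2); have := fm (x - d / 2).
have -> : x - d / 2 - x = - (d / 2) by ring.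
have -> : x + d / 2 - x = d / 2 by ring.
have d20 : 0 < d / 2 by qlra.
move=> m1 m2 e1 e2; move: h1 h2; rewrite gx !ltr_norml.
have [lp|ln] := ltP 0 l.
  rewrite gtr0_norm// => h1 h2.
  have g1 : 0 < g (x - d / 2) by qlra.
  by have := mulr_gt0 g1 d20; qlra.
have {}ln : l < 0 by rewrite lt_neqAle l0.
rewrite ltr0_norm// => h1 h2.
have g1 : 0 < - g (x + d / 2) by qlra.
by have := mulr_gt0 g1 d20; qlra.
Qed.

Lemma deriv_sign (f : R -> R) x l a : has_deriv f x l -> l < 0 -> f x = 0 -> x < a ->
  exists2 y, x < y <= a & f y < 0.
Proof.
move=> fd l0 fx xa; have [g [fE gc gx]] := (is_derive1_caratheodory f x l).1 fd.
have [|d d0 H] := (cont_epsP _ _).1 gc (- l); first by qlra.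
pose y := Num.min a (x + d / 2).
have ya : y <= a by rewrite ge_min lexx.
have yd : y <= x + d / 2 by rewrite ge_min lexx orbT.
have xy : x < y by rewrite lt_min xa; qlra.
exists y; first by rewrite xy.
have : `|x - y| < d by rewrite ltr_norml; qlra.
move=> /H; rewrite gx ltr_norml => h.
have g1 : 0 < - g y by qlra.
have y0 : 0 < y - x by qlra.
have := mulr_gt0 g1 y0; have := fE y; rewrite fx; qlra.
Qed.

Lemma first_zero (f : R -> R) a b : continuous f -> 0 < f a -> f b <= 0 -> a <= b ->
  exists z, [/\ a < z <= b, f z = 0 & forall x, a <= x < z -> 0 < f x].
Proof.
move=> fc fa fb ab; pose S := [set s | a <= s <= b /\ f s <= 0].
have Sb : S b by split => //; qlra.
have Slb : lbound S a by move=> s [/andP[]].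
have hS : has_inf S by split; [exists b|exists a].
set z := inf S.
have az : a <= z by apply: lb_le_inf; [exists b|].
have Sge s : S s -> z <= s by move=> Ss; apply: ge_inf => //; exists a.
have zb : z <= b := Sge _ Sb.
have before x : a <= x < z -> 0 < f x.
  move=> /andP[ax xz]; rewrite ltNge; apply/negP => fx.
  by have : S x; [split => //; qlra|move/Sge; qlra].
have yc := (cont_epsP _ _).1 (fc z).
have fz : f z <= 0.
  rewrite leNgt; apply/negP => fz; have [d d0 H] := yc _ fz.
  have [s Ss sd] : exists2 s, S s & s < z + d by apply: inf_adherent.
  have := Sge _ Ss; have := H s; case: Ss => _ fs + zs.
  by rewrite distrC ger0_norm ?subr_ge0// ltr_norml; qlra.
have az' : a < z.
  by rewrite lt_neqAle az andbT; apply/eqP => E; move: fz; rewrite -E; qlra.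
exists z; split => //; first by rewrite az'.
apply/eqP; rewrite eq_le fz andTb leNgt; apply/negP => fz'.
have [|d d0 H] := yc (- f z); first by qlra.
pose s := Num.max a (z - d / 2).
have s1 : a <= s by rewrite le_max lexx.
have s2 : z - d / 2 <= s by rewrite le_max lexx orbT.
have s3 : s < z by rewrite gt_max az'; qlra.
have : `|z - s| < d by rewrite ltr_norml; qlra.
move/H; rewrite ltr_norml; have := before s; rewrite s1 s3 => /(_ isT); qlra.
Qed.

(* The decaying side of a positive solution: [(u' ^ 2 - B u ^ 2)' >= 0] forces
   [|u'| <= sqrt B u], and [(u u')' = u' ^ 2 + q u ^ 2] bounds the integrals. *)
Lemma decaying_tail (u u1 q : R -> R) (X d B : R) : 0 < d -> 0 < B ->
  (forall x, has_deriv u x (u1 x)) -> (forall x, has_deriv u1 x (q x * u x)) ->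
  continuous q ->
  (forall x, X <= x -> [/\ 0 < u x, u1 x <= 0 & d <= q x <= B]) ->
  (forall x, X <= x -> u x <= u X /\ u1 x ^+ 2 <= B * u x ^+ 2) /\
  exists I, forall b, X <= b -> integ (fun x => u x ^+ 2 + u1 x ^+ 2) X b <= I.
Proof.
move=> d0 B0 ud u1d qc H; split.
  move=> x Xx; have [ux u1x qx] := H x Xx; split.
    rewrite -lerN2; apply: (@d_le _ (fun y => - u y) (fun y => - u1 y) X x Xx).
      by move=> y _; deriv.
    by move=> y /andP[Xy _]; have [_ h _] := H y Xy; qlra.
  rewrite leNgt; apply/negP => h.
  pose z y := u1 y ^+ 2 - B * u y ^+ 2.
  have zx : 0 < z x by rewrite /z; qlra.
  have zy y : x <= y -> z x <= z y.
    move=> xy; apply: (@d_le _ z (fun y => 2 * u1 y * u y * (q y - B)) x y xy).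
      by move=> t _; rewrite /z; deriv_to; ring.
    move=> t /andP[xt _]; have [h1 h2 h3] := H t (le_trans Xx xt).
    have -> : 2 * u1 t * u t * (q t - B) = 2 * (- u1 t) * u t * (B - q t) by ring.
    by rewrite !mulr_ge0//; qlra.
  (* As [z] is nondecreasing, [u1 ^+ 2 >= z x] from [x] on; [k <= 1] turns this into [u1 <= - k]
     without a square root. Then [u] would become negative at distance [(u x + 1) / k]. *)
  pose k := Num.min 1 (z x).
  have k0 : 0 < k by rewrite lt_min zx ltr01.
  have u1k y : x <= y -> u1 y <= - k.
    move=> xy; have [h1 h2 h3] := H y (le_trans Xx xy).
    rewrite leNgt; apply/negP => h4.
    have k1 : k <= 1 by rewrite ge_min lexx.
    have kz : k <= z x by rewrite ge_min lexx orbT.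
    have := zy y xy; rewrite {2}/z; have : 0 <= B * u y ^+ 2 by rewrite mulr_ge0 ?sqr_ge0// ltW.
    have h5 : - u1 y * - u1 y <= k * 1.
      by apply: ler_pM; qlra.
    rewrite expr2; move: h5; rewrite mulrNN.
    have h6 : - u1 y * - u1 y < 1 * k.
      apply: (@le_lt_trans _ _ (1 * - u1 y)); last by rewrite ltr_pM2l; qlra.
      by rewrite ler_wpM2r; qlra.
    by move: h6; rewrite mulrNN; qlra.
  pose b := x + (u x + 1) / k.
  have xb : x <= b by rewrite lerDl divr_ge0; qlra.
  have := @d_le2 _ u (fun y => - k * y) u1 (fun=> - k) x b xb.
  move=> hh; have : u b - u x <= - k * b - - k * x.
    by apply: hh => y; [move=> _; exact: ud|move=> _; deriv_to; ring|move=> /andP[xy _];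
      exact: u1k].
  have -> : - k * b - - k * x = - (u x + 1).
    by rewrite /b; field; rewrite gt_eqF.
  by have [h1 _ _] := H b (le_trans Xx xb); qlra.
have uc : continuous u := d_continuous ud.
have u1c : continuous u1 := d_continuous u1d.
pose k := Num.min 1 d.
have k0 : 0 < k by rewrite lt_min d0 ltr01.
have k1 : k <= 1 by rewrite ge_min lexx.
have kd : k <= d by rewrite ge_min lexx orbT.
exists (- (u X * u1 X) / k) => b Xb.
have [uX _ _] := H X (lexx X); have [ub u1b _] := H b Xb.
have h : integ (fun x => k * (u x ^+ 2 + u1 x ^+ 2)) X b <=
    integ (fun x => u1 x ^+ 2 + q x * u x ^+ 2) X b.
  apply: integ_le => //; [by conti|by conti|].
  move=> x /andP[Xx _]; have [_ _ h] := H x Xx.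
  have a1 : k * u1 x ^+ 2 <= 1 * u1 x ^+ 2 by rewrite ler_wpM2r ?sqr_ge0.
  have a2 : k * u x ^+ 2 <= q x * u x ^+ 2 by rewrite ler_wpM2r ?sqr_ge0//; qlra.
  by qlra.
rewrite integZ in h; last by conti.
rewrite (@integE _ (fun x => u1 x ^+ 2 + q x * u x ^+ 2) (fun x => u x * u1 x)) in h; first last.
- by move=> x _; deriv_to; ring.
- by conti.
rewrite ler_pdivlMr// mulrC; have : 0 <= u b * - u1 b by rewrite mulr_ge0; qlra.
qlra.
Qed.

End linear_ode.

(** * The ground state *)

Section ground_state.
Context {R : realType}.
Implicit Types (mu x y c s : R).

Lemma pos_tube (F : R -> R -> R) t c d : cont2 F ->
  (forall x, c <= x <= d -> 0 < F t x) ->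
  exists2 del, 0 < del & forall s x, `|t - s| < del -> c <= x <= d -> 0 < F s x.
Proof.
move=> /cont2P Fc F0.
have /compact_near_coveringP := @segment_compact R c d.
move=> /(_ R (nbhs t) (fun s x => 0 < F s x) _).
case.
  move=> x xcd; have Fx : 0 < F t x by apply: F0; move: xcd; rewrite /= in_itv.
  have [d1 d10 H] := Fc t x _ Fx.
  exists (ball x d1, ball t d1) => /=.
    by split; apply/nbhs_ballP; exists d1.
  by move=> [y s] [/= xy ts]; have := H _ _ ts xy; rewrite ltr_norml; qlra.
move=> del /= del0 H; exists del => // s x ts xcd.
by apply: (H s) => //=; rewrite in_itv.
Qed.

(* Jacobi: [f' ^ 2 + (V + mu) f ^ 2 = (f' - w f) ^ 2 + (w f ^ 2)'] for
   [w = u' / u]. *)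
Lemma jacobi (V : R -> R) (K0 d mu : R) (f df u u1 : R -> R) :
  continuous V -> mu <= d -> 0 < K0 ->
  (forall x, has_deriv u x (u1 x)) ->
  (forall x, has_deriv u1 x ((V x + mu) * u x)) ->
  (forall x, has_deriv f x (df x)) -> continuous df ->
  f K0 = 0 -> f (- K0) = 0 ->
  integ (fun x => df x ^+ 2 + (V x + d) * f x ^+ 2) (- K0) K0 < 0 ->
  ~ (forall x, - K0 <= x <= K0 -> 0 < u x).
Proof.
move=> Vc mud K00 ud u1d fd dfc fK fNK fQ up.
pose w x := u1 x / u x; pose h x := w x * f x ^+ 2.
have fc : continuous f := d_continuous fd.
have gc : continuous (fun x => df x ^+ 2 + (V x + d) * f x ^+ 2) by conti.
have le : - K0 <= K0 by qlra.
have := @d_le2 _ h _ (fun x => (V x + mu) * f x ^+ 2 - w x ^+ 2 * f x ^+ 2 + 2 * w x * f x * df x)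
  _ _ _ le _ (fun x _ => d_prim x gc).
move=> /(_ _ _) H; move: fQ; rewrite /integ => fQ.
have : h K0 - h (- K0) <= prim (fun x => df x ^+ 2 + (V x + d) * f x ^+ 2) K0 -
    prim (fun x => df x ^+ 2 + (V x + d) * f x ^+ 2) (- K0).
  apply: H => x xK.
    have ux : u x != 0 by rewrite gt_eqF// up.
    have wd : has_deriv w x (V x + mu - w x ^+ 2).
      rewrite /w; apply: (has_deriv_val (d_M (u1d x) (d_V ux (ud x)))); field.
      exact: ux.
    by apply: (has_deriv_val (d_M wd (d_X 2 (fd x)))); rewrite /=; ring.
  have : (V x + mu) * f x ^+ 2 <= (V x + d) * f x ^+ 2.
    by rewrite ler_wpM2r ?sqr_ge0//; qlra.
  by have := sqr_ge0 (df x - w x * f x); qlra.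
by rewrite /h fK fNK; qlra.
Qed.

(** Cramer's rule with determinant 1. Applied to the Wronskian, it says that a solution vanishing
    together with its derivative at one point is zero. *)
Lemma nondegenerate (c c1 s s1 a b : R) : c * s1 - s * c1 = 1 ->
  c * a - s * b = 0 -> c1 * a - s1 * b = 0 -> a = 0 /\ b = 0.
Proof.
move=> w e1 e2; split; rewrite -[LHS]mul1r -w.
  transitivity (s1 * (c * a - s * b) - s * (c1 * a - s1 * b)); first by ring.
  by rewrite e1 e2; ring.
transitivity (c1 * (c * a - s * b) - c * (c1 * a - s1 * b)); first by ring.
by rewrite e1 e2; ring.
Qed.

(** On each [[- K, K]] shooting finds a [mu] whose solution is positive up to a zero at [K]. The
    triples formed by [mu] and the two normalized coefficients stay in a compact set, and a cluster
    point as [K] grows gives [phi]. *)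
Lemma positive_solution (V : R -> R) (B K0 d : R) (f df : R -> R) :
  continuous V -> (forall x, `|V x| <= B) ->
  (forall e, 0 < e -> exists2 X, 0 < X & forall x, X <= `|x| -> `|V x| <= e) ->
  0 < K0 -> 0 < d -> (forall x, has_deriv f x (df x)) -> continuous df ->
  f K0 = 0 -> f (- K0) = 0 ->
  integ (fun x => df x ^+ 2 + (V x + d) * f x ^+ 2) (- K0) K0 < 0 ->
  exists (mu X : R) (phi phi1 : R -> R), (d <= mu <= B /\ 0 < X) /\
    [/\ forall x, has_deriv phi x (phi1 x),
        forall x, has_deriv phi1 x ((V x + mu) * phi x),
        forall x, 0 < phi x,
        forall x, X <= `|x| -> d / 2 <= V x + mu &
        forall x, (x <= - X -> 0 <= phi1 x) /\ (X <= x -> phi1 x <= 0)].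
Proof.
move=> Vc VB Vv K00 d0 fd dfc fK fNK fQ.
have [C [C1 [Cc C1c C0 C10 Cd]]] := linear_ode_exists 1 0 Vc.
have [S [S1 [Sc S1c S0 S10 Sd]]] := linear_ode_exists 0 1 Vc.
have Cd0 mu x : has_deriv (C mu) x (C1 mu x) := (Cd mu x).1.
have Cd1 mu x : has_deriv (C1 mu) x ((V x + mu) * C mu x) := (Cd mu x).2.
have Sd0 mu x : has_deriv (S mu) x (S1 mu x) := (Sd mu x).1.
have Sd1 mu x : has_deriv (S1 mu) x ((V x + mu) * S mu x) := (Sd mu x).2.
have wronskian mu x : C mu x * S1 mu x - S mu x * C1 mu x = 1.
  transitivity (C mu 0 * S1 mu 0 - S mu 0 * C1 mu 0).
    apply: (@d_cst_eq _ (fun y => C mu y * S1 mu y - S mu y * C1 mu y)) => y _.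
    by deriv_to; ring.
  by rewrite C0 C10 S0 S10; ring.
(* The solution with value 1 and slope 0 at [- K]. The zero slope makes it increase as long as
   [V + mu >= 0], which gives the sign of the derivative on the left tail; on the right the zero at
   [K] gives the opposite sign. *)
pose v K mu x := C mu x * S1 mu (- K) - S mu x * C1 mu (- K).
pose v1 K mu x := C1 mu x * S1 mu (- K) - S1 mu x * C1 mu (- K).
have vd K mu x : has_deriv (v K mu) x (v1 K mu x).
  by rewrite /v; deriv_to; rewrite /v1; ring.
have v1d K mu x : has_deriv (v1 K mu) x ((V x + mu) * v K mu x).
  by rewrite /v1; deriv_to; rewrite /v; ring.
have vK K mu : v K mu (- K) = 1 by exact: wronskian.
have v1K K mu : v1 K mu (- K) = 0 by rewrite /v1; ring.
have vc K : cont2 (v K).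
  by rewrite /cont2 /v; conti.
have vcx K mu : continuous (v K mu) := cont2_l (vc K).
have v1cx K mu : continuous (v1 K mu) := d_continuous (v1d K mu).
have low K mu : K0 <= K -> mu <= d -> exists2 x, - K <= x <= K & v K mu x <= 0.
  move=> KK mud; apply: contrapT => nex.
  have vp x : - K <= x <= K -> 0 < v K mu x.
    by move=> xK; rewrite ltNge; apply/negP => vx; apply: nex; exists x.
  by apply: (jacobi Vc mud K00 (vd K mu) (v1d K mu) fd dfc fK fNK fQ) => x xK; apply: vp; qlra.
have nondecr K mu x y : - K <= x -> x <= y ->
    (forall z, x <= z <= y -> 0 <= (V z + mu) * v K mu z) -> v1 K mu x <= v1 K mu y.
  by move=> Kx xy H; apply: (@d_le _ _ _ x y xy (fun z _ => v1d K mu z)).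
have up K mu x : B <= mu -> - K <= x <= K -> 0 < v K mu x.
  move=> Bmu /andP[Kx xK]; rewrite ltNge; apply/negP => vx.
  have [|z [/andP[Kz zx] vz vp]] := first_zero (vcx K mu) _ vx Kx.
    by rewrite vK.
  have Vmu y : 0 <= V y + mu.
    by have := VB y; rewrite ler_norml; qlra.
  have v1p y : - K <= y <= z -> 0 <= v1 K mu y.
    move=> /andP[Ky yz]; rewrite -(v1K K mu); apply: nondecr => // t /andP[Kt ty].
    rewrite mulr_ge0//; have [tz|zt] := ltP t z; first by rewrite ltW// vp// Kt.
    by rewrite (_ : t = z) ?vz//; qlra.
  have := @d_le _ (v K mu) (v1 K mu) (- K) z (ltW Kz) (fun y _ => vd K mu y) v1p.
  by rewrite vK vz ler10.
(* The largest [mu] for which [v] fails to be positive on [[- K, K]]: [low] shows that [d] is one of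
   them, [up] bounds them by [B]. *)
have critical K : K0 <= K -> exists2 mu, d <= mu <= B &
    v K mu K = 0 /\ forall x, - K <= x < K -> 0 < v K mu x.
  move=> KK; have K_0 : 0 < K by qlra.
  pose Z := [set mu | d <= mu /\ exists2 x, - K <= x <= K & v K mu x <= 0].
  have Zd : Z d by split => //; exact: low.
  have ZB mu : Z mu -> mu <= B.
    move=> [_ [x xK vx]]; rewrite leNgt; apply/negP => Bmu.
    by have := up K mu x (ltW Bmu) xK; qlra.
  have hS : has_sup Z by split; [exists d|exists B].
  have mule mu : Z mu -> mu <= sup Z by move=> Zm; apply: ub_le_sup => //; exists B.
  have supB : sup Z <= B by apply: ge_sup => //; exists d.
  set mus := sup Z in mule supB; have dmus : d <= mus := mule _ Zd.
  have [x xK vx] : exists2 x, - K <= x <= K & v K mus x <= 0.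
    apply: contrapT => nex.
    have vp x : - K <= x <= K -> 0 < v K mus x.
      by move=> xK; rewrite ltNge; apply/negP => vx; apply: nex; exists x.
    have [del del0 H] := pos_tube (vc K) vp.
    have [mu Zmu mumus] : exists2 mu, Z mu & mus - del < mu by apply: sup_adherent.
    have := mule _ Zmu; have [_ [x xK vx]] := Zmu; have := H mu x.
    move=> h1 h2; suff : 0 < v K mu x by qlra.
    by apply: h1 => //; rewrite ltr_norml; qlra.
  have /andP[Kx xK'] := xK.
  have [|z [/andP[Kz zx] vz vp]] := first_zero (vcx K mus) _ vx Kx.
    by rewrite vK.
  exists mus; first by rewrite dmus.
  have [zK|Kz'] := ltP z K; last first.
    have zE : z = K by qlra.
    split; first by rewrite -[X in v K mus X]zE.
    by move=> y yK; apply: vp; qlra.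
  (* A zero [z < K] is simple by the Wronskian and reached from above, so [v] is negative just after
     it, and still so for a slightly larger [mu], against the choice of [mus]. *)
  exfalso.
  have v1z : v1 K mus z < 0.
    rewrite ltNge; apply/negP => h.
    have v1z0 : v1 K mus z <> 0.
      move=> h0; have := wronskian mus z; have := wronskian mus (- K).
      move: vz h0; rewrite /v /v1 => e1 e2 e3 e4.
      have [E1 E2] := nondegenerate e4 e1 e2.
      by move: e3; rewrite E1 E2; qlra.
    have h' : 0 < v1 K mus z by rewrite lt_neqAle h andbT eq_sym; apply/eqP.
    have hd : has_deriv (fun y => v K mus (- y)) (- z) (- v1 K mus z).
      apply: (has_deriv_val (d_comp (g := fun y => - y) (b := -1) _ _)); last by rewrite mulrN1.
        by rewrite opprK; exact: vd.
      exact: (d_N (d_id _)).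
    have zKz : - z < K by qlra.
    have [||y /andP[zy yK] vy] := deriv_sign hd _ _ zKz; rewrite ?opprK//; first by qlra.
    have : - K <= - y < z by qlra.
    by move/vp; qlra.
  have [y /andP[zy yK] vy] := deriv_sign (vd K mus z) v1z vz zK.
  have [|del del0 Hd] := (cont2P _).1 (vc K) mus y (- v K mus y); first by qlra.
  have Zm : Z (mus + del / 2).
    split; first by qlra.
    exists y; first by qlra.
    have : `|mus - (mus + del / 2)| < del by rewrite ltr_norml; qlra.
    have : `|y - y| < del by rewrite subrr normr0.
    by move=> h1 h2; have := Hd _ _ h2 h1; rewrite ltr_norml; qlra.
  by have := mule _ Zm; qlra.
have [|X X0 VX] := Vv (d / 2); first by qlra.
have Vmu x mu : X <= `|x| -> d <= mu -> d / 2 <= V x + mu.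
  by move=> /VX; rewrite ler_norml; qlra.
pose U (p : R * R * R) x := p.1.2 * C p.1.1 x + p.2 * S p.1.1 x.
pose U1 (p : R * R * R) x := p.1.2 * C1 p.1.1 x + p.2 * S1 p.1.1 x.
(* Without normalization the solutions could degenerate as the interval grows. Dividing by the sum
   [n] of the absolute values of the coefficients keeps the limit nonzero. *)
have /choice[p Hp] : forall j : nat, exists p : R * R * R,
    [/\ d <= p.1.1 <= B, `|p.1.2| + `|p.2| = 1,
        forall x, `|x| < K0 + j%:R -> 0 <= U p x,
        forall x, `|x| < K0 + j%:R -> x <= - X -> 0 <= U1 p x &
        forall x, `|x| < K0 + j%:R -> X <= x -> 0 <= - U1 p x].
  move=> j; pose K := K0 + j%:R; have KK : K0 <= K by rewrite lerDl.
  have [mu /andP[dmu muB] [vz vp]] := critical K KK.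
  pose n := `|S1 mu (- K)| + `|C1 mu (- K)|.
  have n0 : 0 < n.
    rewrite lt_neqAle addr_ge0// andbT eq_sym; apply/negP.
    rewrite paddr_eq0// !normr_eq0 => /andP[/eqP E1 /eqP E2].
    by have := wronskian mu (- K); rewrite E1 E2; qlra.
  exists (mu, S1 mu (- K) / n, - C1 mu (- K) / n); rewrite /U /U1 /=.
  have UE x : S1 mu (- K) / n * C mu x + - C1 mu (- K) / n * S mu x = v K mu x / n.
    by rewrite /v; field; rewrite gt_eqF.
  have U1E x : S1 mu (- K) / n * C1 mu x + - C1 mu (- K) / n * S1 mu x = v1 K mu x / n.
    by rewrite /v1; field; rewrite gt_eqF.
  split.
  - by rewrite dmu.
  - by rewrite !normrM normrN normfV (gtr0_norm n0) -mulrDl divff// gt_eqF.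
  - move=> x; rewrite UE -/K ltr_norml => xK.
    by rewrite divr_ge0 ?(ltW n0)// ltW// vp; qlra.
  - move=> x; rewrite U1E -/K ltr_norml => /andP[xK1 xK2] xX.
    rewrite divr_ge0 ?(ltW n0)// -(v1K K mu); apply: nondecr => //; first exact: ltW.
    move=> t tx; apply: mulr_ge0; last by rewrite ltW// vp; qlra.
    have : X <= `|t| by rewrite ler0_norm; qlra.
    by move/Vmu => /(_ _ dmu); qlra.
  - move=> x; rewrite U1E -/K ltr_norml => /andP[xK1 xK2] xX.
    rewrite -mulNr divr_ge0 ?(ltW n0)// oppr_ge0 leNgt; apply/negP => v1x.
    have v1y y : x <= y <= K -> 0 <= v1 K mu y.
      move=> /andP[xy yK]; apply: le_trans (ltW v1x) _.
      apply: nondecr => //; first by qlra.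
      move=> t /andP[xt ty]; apply: mulr_ge0.
        have : X <= `|t| by rewrite ger0_norm; qlra.
        by move/Vmu => /(_ _ dmu); qlra.
      have [tK|Kt] := ltP t K; first by rewrite ltW// vp; qlra.
      by rewrite (_ : t = K) ?vz//; qlra.
    have := @d_le _ (v K mu) (v1 K mu) x K (ltW xK2) (fun y _ => vd K mu y) v1y.
    have : 0 < v K mu x by apply: vp; qlra.
    by rewrite vz; qlra.
pose A : set (R * R * R) := (`[d, B]%classic `*` `[- 1, 1]%classic) `*` `[- 1, 1]%classic.
have cA : compact A.
  by apply: compact_setX; [apply: compact_setX|]; exact: segment_compact.
have [|q [_ clq]] := cA (p @ \oo) _.
  exists 0%N => // j _; have [h1 h2 _ _ _] := Hp j.
  have a1 := normr_ge0 (p j).1.2; have a2 := normr_ge0 (p j).2.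
  by split; [split|]; rewrite /= in_itv//= -ler_norml; qlra.
(* Every property needed of the limit is a nonstrict inequality between continuous functions of the
   triple, holding for all large indices, so it passes to the cluster point. *)
have lim (g : R * R * R -> R) (j0 : nat) : continuous g ->
    (forall j, (j0 <= j)%N -> 0 <= g (p j)) -> 0 <= g q.
  move=> gc gj; rewrite leNgt; apply/negP => gq.
  have nb : nbhs q [set y | g y < 0].
    have /cvgrPdist_lt/(_ (- g q)) := gc q; rewrite oppr_gt0 => /(_ gq).
    by apply: filterS => y /=; rewrite ltr_norml; qlra.
  have ev : (p @ \oo) [set y | 0 <= g y] by exists j0.
  by have [y [/= h1 h2]] := clq _ _ ev nb; qlra.
have c11 : continuous (fun y : R * R * R => y.1.1).
  move=> y; apply: (@continuous_comp _ _ _ fst fst); exact: cvg_fst.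
have c12 : continuous (fun y : R * R * R => y.1.2).
  move=> y; apply: (@continuous_comp _ _ _ fst snd); [exact: cvg_fst|exact: cvg_snd].
have c2 : continuous (fun y : R * R * R => y.2).
  by move=> y; exact: cvg_snd.
have Uc x : continuous (U ^~ x).
  rewrite /U; apply: c_D; apply: c_M => //.
    by apply: (c_comp2 Cc) => //; exact: c_cst.
  by apply: (c_comp2 Sc) => //; exact: c_cst.
have U1c x : continuous (U1 ^~ x).
  rewrite /U1; apply: c_D; apply: c_M => //.
    by apply: (c_comp2 C1c) => //; exact: c_cst.
  by apply: (c_comp2 S1c) => //; exact: c_cst.
have big x : exists j0 : nat, forall j, (j0 <= j)%N -> `|x| < K0 + j%:R.
  exists (Num.truncn `|x|).+1 => j jj; apply: (@lt_le_trans _ _ j%:R); last by qlra.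
  by apply: lt_le_trans (truncnS_gt _) _; rewrite ler_nat.
set mu := q.1.1; pose phi := U q; pose phi1 := U1 q.
have dmu : d <= mu.
  rewrite -subr_ge0; apply: (lim (fun z => z.1.1 - d) 0%N).
    by apply: c_D => //; exact: c_cst.
  by move=> j _; rewrite subr_ge0; have [/andP[]] := Hp j.
have muB : mu <= B.
  rewrite -subr_ge0; apply: (lim (fun z => B - z.1.1) 0%N).
    by apply: c_D; [exact: c_cst|exact: c_N].
  by move=> j _; rewrite subr_ge0; have [/andP[]] := Hp j.
have qn : 1 <= `|q.1.2| + `|q.2|.
  rewrite -subr_ge0; apply: (lim (fun z => `|z.1.2| + `|z.2| - 1) 0%N).
    by apply: c_D; [apply: c_D; exact: c_norm|exact: c_cst].
  by move=> j _; have [_ -> _ _ _] := Hp j; rewrite subrr.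
have phi0 x : 0 <= phi x.
  have [j0 H] := big x; apply: (lim (U ^~ x) j0) => // j /H.
  by have [_ _ h _ _] := Hp j; exact: h.
have phi1l x : x <= - X -> 0 <= phi1 x.
  move=> xX; have [j0 H] := big x; apply: (lim (U1 ^~ x) j0) => // j /H.
  by have [_ _ _ h _] := Hp j => /h; apply.
have phi1r x : X <= x -> phi1 x <= 0.
  move=> xX; rewrite -oppr_ge0; have [j0 H] := big x.
  apply: (lim (fun z => - U1 z x) j0); first exact: c_N.
  by move=> j /H; have [_ _ _ _ h] := Hp j => /h; apply.
have phid x : has_deriv phi x (phi1 x).
  by rewrite /phi /U; deriv_to; rewrite /phi1 /U1; ring.
have phi1d x : has_deriv phi1 x ((V x + mu) * phi x).
  by rewrite /phi1 /U1; deriv_to; rewrite /phi /U -/mu; ring.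
(* The limit is only known to be nonnegative. A zero would be a minimum, hence a double zero, which
   the normalization excludes. *)
have phip x : 0 < phi x.
  rewrite lt_neqAle phi0 andbT eq_sym; apply/negP => /eqP phix.
  have phi1x : phi1 x = 0.
    by apply: (deriv_at_min (phid x)) => y; rewrite phix.
  have e4 := wronskian mu x; move: phix phi1x; rewrite /phi /phi1 /U /U1 -/mu => e1 e2.
  have [E1 E2] : q.1.2 = 0 /\ - q.2 = 0.
    by apply: (nondegenerate e4); [rewrite -[RHS]e1|rewrite -[RHS]e2]; ring.
  by move: qn; rewrite E1 -[q.2]opprK E2 oppr0 normr0; qlra.
exists mu, X, phi, phi1; rewrite dmu muB X0; split => //.
by split => // [x Xx|x]; [exact: Vmu|split; [exact: phi1l|exact: phi1r]].
Qed.

(** Beyond [X] the coefficient [V + mu] lies between [d / 2] and [2 * B] and [phi] decreases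
    outwards, which is the setting of [decaying_tail]; on [[- X, X]] continuity gives the bounds. *)
Lemma ground_state (V : R -> R) (B K0 d : R) (f df : R -> R) :
  continuous V -> (forall x, `|V x| <= B) ->
  (forall e, 0 < e -> exists2 X, 0 < X & forall x, X <= `|x| -> `|V x| <= e) ->
  0 < K0 -> 0 < d -> (forall x, has_deriv f x (df x)) -> continuous df ->
  f K0 = 0 -> f (- K0) = 0 ->
  integ (fun x => df x ^+ 2 + (V x + d) * f x ^+ 2) (- K0) K0 < 0 ->
  exists (mu M I : R) (phi phi1 : R -> R), 0 < mu /\
    [/\ forall x, has_deriv phi x (phi1 x),
        forall x, has_deriv phi1 x ((V x + mu) * phi x),
        forall x, 0 < phi x <= M,
        forall x, `|phi1 x| <= M * phi x &
        forall a b, a <= b -> integ (fun x => phi x ^+ 2 + phi1 x ^+ 2) a b <= I].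
Proof.
move=> Vc VB Vv K00 d0 fd dfc fK fNK fQ.
have [mu [X [phi [phi1 [[/andP[dmu muB] X0] [phid phi1d phip Vmu mono]]]]]] :=
  positive_solution Vc VB Vv K00 d0 fd dfc fK fNK fQ.
clear fd dfc fK fNK fQ K00 f df K0 Vv.
have phi1l x : x <= - X -> 0 <= phi1 x := (mono x).1.
have phi1r x : X <= x -> phi1 x <= 0 := (mono x).2.
have VB2 x : V x + mu <= 2 * B by have := VB x; rewrite ler_norml; qlra.
have B0 : 0 < 2 * B by qlra.
have qc : continuous (fun x => V x + mu) by conti.
have d20 : 0 < d / 2 by qlra.
have [Hr [Ir HIr]] := decaying_tail (X := X) d20 B0 phid phi1d qc
  (fun x Xx => And3 (phip x) (phi1r x Xx) (introT andP (conj (Vmu x (le_trans Xx (ler_norm x)))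
    (VB2 x)))).
(* Reflection reduces the left tail to the right one. *)
pose psi x := phi (- x); pose psi1 x := - phi1 (- x).
have psid x : has_deriv psi x (psi1 x).
  by rewrite /psi; deriv_to; rewrite /psi1; ring.
have psi1d x : has_deriv psi1 x ((V (- x) + mu) * psi x).
  by rewrite /psi1; deriv_to; rewrite /psi; ring.
have qc' : continuous (fun x => V (- x) + mu) by conti.
have Hl' x : X <= x -> [/\ 0 < psi x, psi1 x <= 0 & d / 2 <= V (- x) + mu <= 2 * B].
  move=> Xx; split; first exact: phip.
    by rewrite oppr_le0; apply: phi1l; qlra.
  by rewrite VB2 andbT Vmu// normrN (le_trans Xx)// ler_norm.
have [Hl [Il HIl]] := decaying_tail d20 B0 psid psi1d qc' Hl'.
have phic : continuous phi := d_continuous phid.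
have phi1c : continuous phi1 := d_continuous phi1d.
have [Bm Bm0 HBm] := cont_bounded X phic.
have ratc : continuous (fun x => phi1 x / phi x).
  by apply: c_M => //; apply: c_V => // x; rewrite gt_eqF.
have [Br Br0 HBr] := cont_bounded X ratc.
(* The tail gives slope at most [sqrt (2 * B) * phi]; the summands [2 * B] and [1] make
   [M ^+ 2 >= 2 * B]. *)
pose M := Bm + Br + 2 * B + 1.
have tail x : X <= `|x| -> phi x <= Bm /\ phi1 x ^+ 2 <= 2 * B * phi x ^+ 2.
  have [x0|x0] := ger0P x => Xx.
    have [h1 h2] := Hr x Xx; split => //; apply: le_trans h1 _.
    by apply: le_trans (ler_norm _) _; apply: HBm; rewrite ger0_norm// ltW.
  have [h1 h2] := Hl (- x) Xx; move: h1 h2; rewrite /psi /psi1 opprK sqrrN => h1 h2.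
  split => //; apply: le_trans h1 _.
  by apply: le_trans (ler_norm _) _; apply: HBm; rewrite normrN ger0_norm// ltW.
have phisq : continuous (fun x => phi x ^+ 2 + phi1 x ^+ 2) by conti.
exists mu, M, (Il + Ir + integ (fun x => phi x ^+ 2 + phi1 x ^+ 2) (- X) X), phi, phi1.
split; first by qlra.
split => //.
- move=> x; rewrite phip/=; have [Xx|Xx] := leP X `|x|.
    by have [h _] := tail x Xx; rewrite /M; qlra.
  have := le_trans (ler_norm _) (HBm x (ltW Xx)); rewrite /M; qlra.
- move=> x; have px := phip x; have [Xx|Xx] := leP X `|x|.
    have [_ h] := tail x Xx.
    have M0 : 0 <= M * phi x by rewrite mulr_ge0 ?ltW// /M; qlra.
    rewrite -(ger0_norm M0) -ler_sqr ?nnegrE// !real_normK ?num_real// exprMn.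
    apply: le_trans h _; rewrite ler_wpM2r ?sqr_ge0//.
    have M1 : 2 * B <= M by rewrite /M; qlra.
    have M2 : 1 <= M by rewrite /M; qlra.
    by apply: le_trans M1 _; rewrite expr2 ler_peMl; qlra.
  have := HBr x (ltW Xx); rewrite normrM normfV (gtr0_norm px) ler_pdivrMr// => h.
  by apply: le_trans h _; rewrite ler_pM2r// /M; qlra.
- move=> a b ab; pose L := X + `|a| + `|b|.
  have na := ler_norm a; have na' := ler_norm (- a); rewrite normrN in na'.
  have nb := ler_norm b; have nb' := ler_norm (- b); rewrite normrN in nb'.
  have a0 := normr_ge0 a; have b0 := normr_ge0 b.
  apply: le_trans (integ_sub phisq (_ : - L <= a) ab (_ : b <= L) _) _.
  + by rewrite /L; qlra.
  + by rewrite /L; qlra.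
  + by move=> x _; rewrite addr_ge0 ?sqr_ge0.
  have XL : X <= L by rewrite /L; qlra.
  have h1 := HIr L XL; have h2 := HIl L XL.
  have e : integ (fun x => psi x ^+ 2 + psi1 x ^+ 2) X L =
      integ (fun x => phi x ^+ 2 + phi1 x ^+ 2) (- L) (- X).
    rewrite (@integE _ _ (fun x => - prim (fun x => phi x ^+ 2 + phi1 x ^+ 2) (- x))).
    - by rewrite /integ; ring.
    - by have ? : continuous psi := d_continuous psid;
        have ? : continuous psi1 := d_continuous psi1d; conti.
    - move=> x _; have h y := d_prim y phisq; deriv_to; rewrite /psi /psi1; ring.
  move: h1 h2; rewrite e /integ; qlra.
Qed.

End ground_state.

(** * The Lie algebra su(2) and coordinate derivatives *)

Section su2_algebra.
Context {R : realType}.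
Implicit Types (a b c : R).

(** Real coordinates in the basis [tau1], [tau2], [tau3]: matrix identities become triples of real
    ones, and the bracket is the cross product ([su2_lie]). *)
Definition su2 a b c : 'M[R[i]]_2 :=
  a%:C%C *: tau1 R + b%:C%C *: tau2 R + c%:C%C *: tau3 R.

Lemma mx2P (T : Type) (A B : 'M[T]_2) :
  A 0 0 = B 0 0 -> A 0 1 = B 0 1 -> A 1 0 = B 1 0 -> A 1 1 = B 1 1 -> A = B.
Proof.
move=> e00 e01 e10 e11; apply/matrixP => i j.
have i01 (k : 'I_2) : k = 0 \/ k = 1.
  by case: k => [[|[|//]] kP]; [left|right]; exact: val_inj.
by have [->|->] := i01 i; have [->|->] := i01 j.
Qed.

Lemma entryD (A B : 'M[R[i]]_2) i j : (A + B) i j = A i j + B i j.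
Proof. by rewrite mxE. Qed.
Lemma entryN (A : 'M[R[i]]_2) i j : (- A) i j = - A i j.
Proof. by rewrite mxE. Qed.
Lemma entryZ (k : R[i]) (A : 'M[R[i]]_2) i j : (k *: A) i j = k * A i j.
Proof. by rewrite mxE. Qed.
Lemma entryM (A B : 'M[R[i]]_2) i j :
  (A *m B) i j = A i 0 * B 0 j + A i 1 * B 1 j.
Proof.
by rewrite mxE !big_ord_recl big_ord0 addr0; congr (_ + A i _ * B _ j); exact: val_inj.
Qed.
Lemma entry_lin (k l n : R[i]) (A B C : 'M[R[i]]_2) i j :
  (k *: A + l *: B + n *: C) i j = k * A i j + l * B i j + n * C i j.
Proof. by rewrite !mxE. Qed.
Lemma entry_mx2 (k a b c d : R[i]) : let M := k *: mx2 a b c d in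
  [/\ M 0 0 = k * a, M 0 1 = k * b, M 1 0 = k * c & M 1 1 = k * d].
Proof. by split; rewrite !mxE. Qed.

Lemma complexP (z w : R[i]) : complex.Re z = complex.Re w ->
  complex.Im z = complex.Im w -> z = w.
Proof. by move: z w => [z1 z2] [w1 w2] /= -> ->. Qed.

Lemma su2E a b c :
  [/\ su2 a b c 0 0 = (0 +i* (c / 2))%C,
      su2 a b c 0 1 = ((- b / 2) +i* (a / 2))%C,
      su2 a b c 1 0 = ((b / 2) +i* (a / 2))%C &
      su2 a b c 1 1 = (0 +i* (- c / 2))%C].
Proof.
have [a1 a2 a3 a4] := entry_mx2 (0 +i* 2^-1)%C 0 1 1 0.
have [b1 b2 b3 b4] := entry_mx2 (2^-1)%:C%C 0 (- 1) 1 0.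
have [c1 c2 c3 c4] := entry_mx2 (0 +i* 2^-1)%C 1 0 0 (- 1).
split; rewrite /su2 entry_lin /tau1 /tau2 /tau3.
- by rewrite a1 b1 c1; apply: complexP => /=; ring.
- by rewrite a2 b2 c2; apply: complexP => /=; ring.
- by rewrite a3 b3 c3; apply: complexP => /=; ring.
- by rewrite a4 b4 c4; apply: complexP => /=; ring.
Qed.

Lemma su2_ext (M : 'M[R[i]]_2) a b c :
  M 0 0 = (0 +i* (c / 2))%C -> M 0 1 = ((- b / 2) +i* (a / 2))%C ->
  M 1 0 = ((b / 2) +i* (a / 2))%C -> M 1 1 = (0 +i* (- c / 2))%C -> M = su2 a b c.
Proof. by have [e1 e2 e3 e4] := su2E a b c; rewrite -e1 -e2 -e3 -e4; exact: mx2P. Qed.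

Lemma su2_0 : su2 0 0 0 = 0.
Proof. by rewrite /su2 !scale0r !addr0. Qed.

Lemma su2_tau1 a : a%:C%C *: tau1 R = su2 a 0 0.
Proof. by rewrite /su2 !scale0r !addr0. Qed.

Lemma su2_tau2 b : b%:C%C *: tau2 R = su2 0 b 0.
Proof. by rewrite /su2 !scale0r add0r addr0. Qed.

Lemma su2_tau3 c : c%:C%C *: tau3 R = su2 0 0 c.
Proof. by rewrite /su2 !scale0r !add0r. Qed.

Lemma su2D a b c a' b' c' : su2 a b c + su2 a' b' c' = su2 (a + a') (b + b') (c + c').
Proof.
rewrite /su2; move: (tau1 R) (tau2 R) (tau3 R) => X Y Z; rewrite !rmorphD /=.
move: (a%:C)%C (b%:C)%C (c%:C)%C (a'%:C)%C (b'%:C)%C (c'%:C)%C => k l n k' l' n'.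
rewrite (scalerDl X) (scalerDl Y) (scalerDl Z).
rewrite (addrACA (k *: X + l *: Y)); congr (_ + _); exact: addrACA.
Qed.

Lemma su2Z (k : R) a b c : k%:C%C *: su2 a b c = su2 (k * a) (k * b) (k * c).
Proof.
have [e1 e2 e3 e4] := su2E a b c.
by apply: su2_ext; rewrite entryZ ?e1 ?e2 ?e3 ?e4; apply: complexP => /=; ring.
Qed.

Lemma su2N a b c : - su2 a b c = su2 (- a) (- b) (- c).
Proof.
have [e1 e2 e3 e4] := su2E a b c.
by apply: su2_ext; rewrite entryN ?e1 ?e2 ?e3 ?e4; apply: complexP => /=; ring.
Qed.

Lemma su2B a b c a' b' c' : su2 a b c - su2 a' b' c' = su2 (a - a') (b - b') (c - c').
Proof. by rewrite su2N su2D. Qed.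

Lemma su2_eq a b c a' b' c' : a = a' -> b = b' -> c = c' -> su2 a b c = su2 a' b' c'.
Proof. by move=> -> -> ->. Qed.

Lemma su2_lie a b c a' b' c' : lie (su2 a b c) (su2 a' b' c') =
  su2 (b * c' - c * b') (c * a' - a * c') (a * b' - b * a').
Proof.
have [e1 e2 e3 e4] := su2E a b c; have [f1 f2 f3 f4] := su2E a' b' c'.
move: (su2 a b c) (su2 a' b' c') e1 e2 e3 e4 f1 f2 f3 f4 => A B e1 e2 e3 e4 f1 f2 f3 f4.
by apply: su2_ext; rewrite /lie entryD entryN !entryM ?e1 ?e2 ?e3 ?e4 ?f1 ?f2 ?f3 ?f4;
  apply: complexP => /=; field.
Qed.

Lemma su2_inner a b c a' b' c' : su2_dot (su2 a b c) (su2 a' b' c') =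
  (4 * pi)^-1 * (a * a' + b * b' + c * c').
Proof.
have [e1 e2 e3 e4] := su2E a b c; have [f1 f2 f3 f4] := su2E a' b' c'.
move: (su2 a b c) (su2 a' b' c') e1 e2 e3 e4 f1 f2 f3 f4 => A B e1 e2 e3 e4 f1 f2 f3 f4.
rewrite /su2_dot /mxtrace !big_ord_recl big_ord0 addr0.
rewrite (_ : lift ord0 ord0 = 1); last exact: val_inj.
rewrite !entryM e1 e2 e3 e4 f1 f2 f3 f4 /=.
rewrite (_ : 4 * pi = 2 * (2 * pi)) ?(invfM 2); last by ring.
by move: (pi^-1) => k; field.
Qed.

Lemma su2_inj a b c : su2 a b c = 0 -> [/\ a = 0, b = 0 & c = 0].
Proof.
move=> e; have [e1 e2 e3 e4] := su2E a b c; move: e1 e3.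
by rewrite e !mxE => -[c0] [b0 a0]; split; qlra.
Qed.

End su2_algebra.

Section coordinates.
Context {R : realType}.
Implicit Types (t x th ph d s l : R) (f : 'rV[R]_4 -> R) (p : 'rV[R]_4).

Lemma event_t t x th ph : event t x th ph 0 ix_t = t.
Proof. by rewrite mxE. Qed.
Lemma event_x t x th ph : event t x th ph 0 ix_x = x.
Proof. by rewrite mxE. Qed.
Lemma event_theta t x th ph : event t x th ph 0 ix_theta = th.
Proof. by rewrite mxE. Qed.
Lemma event_phi t x th ph : event t x th ph 0 ix_phi = ph.
Proof. by rewrite mxE. Qed.
Definition eventE := (event_t, event_x, event_theta, event_phi).

Lemma ix4P (P : 'I_4 -> Prop) : P ix_t -> P ix_x -> P ix_theta -> P ix_phi ->
  forall i, P i.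
Proof.
move=> p0 p1 p2 p3 [[|[|[|[|//]]]] iP].
- by rewrite (_ : Ordinal iP = ix_t)//; exact: val_inj.
- by rewrite (_ : Ordinal iP = ix_x)//; exact: val_inj.
- by rewrite (_ : Ordinal iP = ix_theta)//; exact: val_inj.
- by rewrite (_ : Ordinal iP = ix_phi)//; exact: val_inj.
Qed.

Lemma sum4 (V : nmodType) (F : 'I_4 -> V) :
  \sum_(i < 4) F i = F ix_t + F ix_x + F ix_theta + F ix_phi.
Proof.
rewrite !big_ord_recl big_ord0 addr0 !addrA.
by congr (F _ + F _ + F _ + F _); exact: val_inj.
Qed.

Definition coordinate_line (a : 'I_4) (p : 'rV[R]_4) (s : R) : 'rV[R]_4 :=
  event (if a == ix_t then s else p 0 ix_t) (if a == ix_x then s else p 0 ix_x)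
        (if a == ix_theta then s else p 0 ix_theta)
        (if a == ix_phi then s else p 0 ix_phi).

(** Reduces the directional derivatives of the definitions to one-variable calculus along a
    coordinate line. *)
Lemma partial_line a f p : partial a f p = 'D_1 (fun s => f (coordinate_line a p s)) (p 0 a).
Proof.
have line0 : coordinate_line a p (p 0 a) = p.
  apply/rowP; apply: ix4P; rewrite /coordinate_line !eventE; by case: eqP => // ->.
have lineh h : coordinate_line a p (h *: 1 + p 0 a) = h *: delta_mx 0 a + p.
  apply/rowP; elim/ix4P: a {line0} => //; apply: ix4P; rewrite /coordinate_line !eventE !mxE /=;
  rewrite ?mulr0 ?add0r//.
rewrite /partial /derive line0.
suff -> : (fun h : R => h^-1 *: ((f \o shift p) (h *: delta_mx 0 a) - f p)) =
    (fun h : R => h^-1 *: (((fun s => f (coordinate_line a p s)) \o shift (p 0 a))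
                            (h *: (1 : R)) - f p)) by [].
by apply/funext => h /=; rewrite lineh.
Qed.

Lemma partialE a f p l : has_deriv (fun s => f (coordinate_line a p s)) (p 0 a) l ->
  partial a f p = l.
Proof. by move=> h; rewrite partial_line; exact: (@derive_val _ _ _ _ _ _ _ h). Qed.

Lemma partial_cst a p c f : (forall s, f (coordinate_line a p s) = c) ->
  partial a f p = 0.
Proof.
move=> fc; apply: partialE; rewrite (_ : (fun s => _) = (fun=> c)); last exact/funext.
exact: d_cst.
Qed.

(** Agreement is required only near the point, because the formulas for the raised curvature hold
    only for [0 < theta < pi]. *)
Lemma partialM_su2 a (F : 'rV[R]_4 -> 'M[R[i]]_2) p (f g h : R -> R) (f' g' h' : R) d :
  0 < d -> (forall s, `|p 0 a - s| < d -> F (coordinate_line a p s) = su2 (f s) (g s) (h s)) ->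
  has_deriv f (p 0 a) f' -> has_deriv g (p 0 a) g' -> has_deriv h (p 0 a) h' ->
  partialM a F p = su2 f' g' h'.
Proof.
move=> d0 FE fd gd hd.
have key (k : R -> R) k' (G : 'M[R[i]]_2 -> R) :
    (forall s, G (su2 (f s) (g s) (h s)) = k s) -> has_deriv k (p 0 a) k' ->
    partial a (fun q => G (F q)) p = k'.
  move=> kE kd; apply: partialE; apply: (d_near d0 _ kd) => s sd.
  by rewrite FE.
have E s := su2E (f s) (g s) (h s).
have z : has_deriv (fun _ : R => 0) (p 0 a) 0 by exact: d_cst.
have h2 : has_deriv (fun s => h s / 2) (p 0 a) (h' / 2) by deriv_to; ring.
have g2 : has_deriv (fun s => g s / 2) (p 0 a) (g' / 2) by deriv_to; ring.
have f2 : has_deriv (fun s => f s / 2) (p 0 a) (f' / 2) by deriv_to; ring.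
have mh2 : has_deriv (fun s => - h s / 2) (p 0 a) (- h' / 2) by deriv_to; ring.
have mg2 : has_deriv (fun s => - g s / 2) (p 0 a) (- g' / 2) by deriv_to; ring.
apply: su2_ext; rewrite /partialM mxE; congr (_ +i* _)%C.
- by apply: (key _ _ (fun M => complex.Re (M 0 0)) _ z) => s; have [-> _ _ _] := E s.
- by apply: (key _ _ (fun M => complex.Im (M 0 0)) _ h2) => s; have [-> _ _ _] := E s.
- by apply: (key _ _ (fun M => complex.Re (M 0 1)) _ mg2) => s; have [_ -> _ _] := E s.
- by apply: (key _ _ (fun M => complex.Im (M 0 1)) _ f2) => s; have [_ -> _ _] := E s.
- by apply: (key _ _ (fun M => complex.Re (M 1 0)) _ g2) => s; have [_ _ -> _] := E s.
- by apply: (key _ _ (fun M => complex.Im (M 1 0)) _ f2) => s; have [_ _ -> _] := E s.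
- by apply: (key _ _ (fun M => complex.Re (M 1 1)) _ z) => s; have [_ _ _ ->] := E s.
- by apply: (key _ _ (fun M => complex.Im (M 1 1)) _ mh2) => s; have [_ _ _ ->] := E s.
Qed.

Lemma partialM_cst a (F : 'rV[R]_4 -> 'M[R[i]]_2) p (x y z : R) d : 0 < d ->
  (forall s, `|p 0 a - s| < d -> F (coordinate_line a p s) = su2 x y z) ->
  partialM a F p = 0.
Proof.
move=> d0 FE; rewrite -su2_0.
by apply: (partialM_su2 (f := fun=> x) (g := fun=> y) (h := fun=> z) d0 FE);
  exact: d_cst.
Qed.

End coordinates.

(** * Magnetic curvatures *)

Local Opaque su2.

Section magnetic_tensor.
Context {R : realType}.
Implicit Types (A B C s l t x th ph : R) (a b c d i j : 'I_4) (p q : 'rV[R]_4).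

(** [A], [B], [C], [s] stand for [W'], the time derivative of [W], [W^2 - 1] and [sin theta].
    Keeping them independent makes the class closed under differences, so one energy formula serves
    for the data and for the solution. *)
Definition magF A B C s (a b : 'I_4) : 'M[R[i]]_2 :=
  match val a, val b with
  | 2, 1 => su2 A 0 0        | 1, 2 => su2 (- A) 0 0
  | 2, 0 => su2 B 0 0        | 0, 2 => su2 (- B) 0 0
  | 3, 1 => su2 0 (A * s) 0  | 1, 3 => su2 0 (- (A * s)) 0
  | 3, 0 => su2 0 (B * s) 0  | 0, 3 => su2 0 (- (B * s)) 0
  | 2, 3 => su2 0 0 (C * s)  | 3, 2 => su2 0 0 (- (C * s))
  | _, _ => su2 0 0 0
  end%N.

Lemma magnetic_curvatureE (W0 W1 : R -> R) t x th ph a b :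
  magnetic_curvature W0 W1 (event t x th ph) a b =
  magF (derive1 W0 x) (W1 x) (W0 x ^+ 2 - 1) (sin th) a b.
Proof.
rewrite /magnetic_curvature !eventE.
by elim/ix4P: a; elim/ix4P: b; rewrite /magF /= ?su2_tau1 ?su2_tau2 ?su2_tau3 ?su2_0 ?subr0
  ?sub0r ?su2N ?oppr0.
Qed.

Lemma magF_sub A B C A' B' C' s a b :
  magF A B C s a b - magF A' B' C' s a b = magF (A - A') (B - B') (C - C') s a b.
Proof.
by elim/ix4P: a; elim/ix4P: b; rewrite /magF /= su2B; apply: su2_eq; ring.
Qed.

Lemma d_sin x : has_deriv sin x (cos x).
Proof. exact: is_derive_sin. Qed.

Lemma d_cos x : has_deriv cos x (- sin x).
Proof. exact: is_derive_cos. Qed.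

Context {m : R} {xs r : R -> R}.
Hypothesis m_gt0 : 0 < m.
Hypothesis Hr : tortoise m xs r.

Local Notation N := (lapse m r).
Local Notation P := (potential m r).

Definition gdiag (q : 'rV[R]_4) (i : 'I_4) : R :=
  event (- N (q 0 ix_x)) (N (q 0 ix_x)) (r (q 0 ix_x) ^+ 2)
    (r (q 0 ix_x) ^+ 2 * sin (q 0 ix_theta) ^+ 2) 0 i.

Lemma metricE q i j : metric m r q i j = gdiag q i *+ (i == j).
Proof. by rewrite /metric mxE. Qed.

Lemma gdiag_neq0 q i : 0 < q 0 ix_theta < pi -> gdiag q i != 0.
Proof.
move=> /sin_gt0_pi s0; have N0 := lapse_neq0 m_gt0 Hr (q 0 ix_x).
have r0 := r_neq0 m_gt0 Hr (q 0 ix_x).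
elim/ix4P: i; rewrite /gdiag eventE ?oppr_eq0 ?expf_neq0//.
by rewrite mulf_neq0 ?expf_neq0// gt_eqF.
Qed.

Lemma inv_metricE q i j : 0 < q 0 ix_theta < pi ->
  inv_metric m r q i j = (gdiag q i)^-1 *+ (i == j).
Proof.
move=> q0; suff -> : inv_metric m r q = diag_mx (\row_i (gdiag q i)^-1).
  by rewrite mxE mxE.
have gE : metric m r q = diag_mx (\row_i gdiag q i).
  by apply/matrixP => k l; rewrite metricE mxE mxE.
have h : metric m r q *m diag_mx (\row_i (gdiag q i)^-1) = 1%:M.
  rewrite gE mulmx_diag; apply/matrixP => k l; rewrite !mxE.
  by rewrite divff ?gdiag_neq0.
have [u _] := mulmx1_unit h.
by rewrite /inv_metric -[RHS](mulKmx u) h mulmx1.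
Qed.

Lemma christoffelC c a b p : christoffel m r c a b p = christoffel m r c b a p.
Proof.
rewrite /christoffel; congr (_ * _); apply: eq_bigr => d _; congr (_ * (_ - _)).
  by rewrite addrC.
congr (partial d _ p); apply/funext => q; rewrite !metricE eq_sym.
by case: eqP => // ->.
Qed.

(** For a diagonal metric only one term of the inverse survives, and the derivatives of [g_ad] in
    direction [a] cancel. *)
Lemma christoffel_contract a d p : 0 < p 0 ix_theta < pi ->
  christoffel m r a a d p =
  2^-1 * (gdiag p a)^-1 * partial d (fun q => gdiag q a) p.
Proof.
move=> p0; rewrite /christoffel (bigD1 a)//= big1 => [|c ca]; last first.
  by rewrite inv_metricE// eq_sym (negPf ca) mul0r.
rewrite addr0 inv_metricE// eqxx mulr1n -mulrA; congr (_ * (_ * _)).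
rewrite (_ : (fun q => metric m r q a a) = fun q => gdiag q a); first by ring.
by apply/funext => q; rewrite metricE eqxx.
Qed.

Lemma coordinate_lineE a t x th ph s : coordinate_line a (event t x th ph) s =
  event (if a == ix_t then s else t) (if a == ix_x then s else x)
        (if a == ix_theta then s else th) (if a == ix_phi then s else ph).
Proof. by rewrite /coordinate_line !eventE. Qed.

(** The logarithmic derivative of the volume density [N r^2 sin theta]. *)
Definition kappa x th (d : 'I_4) : R :=
  match val d with
  | 1%N => 2 * m * P x / N x + 2 * N x / r x
  | 2%N => cos th / sin th
  | _ => 0
  end.

Lemma sum_christoffel t x th ph d : 0 < th < pi ->
  \sum_(a < 4) christoffel m r a a d (event t x th ph) = kappa x th d.
Proof.
move=> th0; have p0 : 0 < event t x th ph 0 ix_theta < pi by rewrite eventE.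
have s0 := lt0r_neq0 (sin_gt0_pi th0).
have N0 := lapse_neq0 m_gt0 Hr x; have r0 := r_neq0 m_gt0 Hr x.
have hN := d_lapse m_gt0 Hr; have hr := d_r m_gt0 Hr; have hs := d_sin.
rewrite sum4 !christoffel_contract//.
have pE a l : has_deriv (fun s => gdiag (coordinate_line d (event t x th ph) s) a)
    (event t x th ph 0 d) l -> partial d (fun q => gdiag q a) (event t x th ph) = l.
  by move=> h; exact: partialE.
elim/ix4P: d pE => pE.
- have pz a : partial ix_t (fun q => gdiag q a) (event t x th ph) = 0.
    apply: (@partial_cst _ _ _ (gdiag (event t x th ph) a)) => s.
    by rewrite coordinate_lineE /gdiag !eventE.
  by rewrite !pz /kappa /=; ring.
- rewrite (pE ix_t (- (2 * m * P x))) ?(pE ix_x (2 * m * P x))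
    ?(pE ix_theta (2 * r x * N x)) ?(pE ix_phi (2 * r x * N x * sin th ^+ 2)).
  + by rewrite /gdiag !eventE /kappa /=; field; rewrite s0 N0 r0.
  + rewrite eventE (_ : (fun s => _) = (fun s => r s ^+ 2 * sin th ^+ 2)).
      by deriv_to; ring.
    by apply/funext => s; rewrite coordinate_lineE /gdiag !eventE.
  + rewrite eventE (_ : (fun s => _) = (fun s => r s ^+ 2)).
      by deriv_to; ring.
    by apply/funext => s; rewrite coordinate_lineE /gdiag !eventE.
  + rewrite eventE (_ : (fun s => _) = N); first exact: hN.
    by apply/funext => s; rewrite coordinate_lineE /gdiag !eventE.
  + rewrite eventE (_ : (fun s => _) = (fun s => - N s)); first exact: (d_N (hN x)).
    by apply/funext => s; rewrite coordinate_lineE /gdiag !eventE.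
- rewrite (pE ix_phi (r x ^+ 2 * (2 * sin th * cos th))) ?(pE ix_t 0) ?(pE ix_x 0) ?(pE ix_theta
    0).
  + by rewrite /gdiag !eventE /kappa /=; field; rewrite s0 N0 r0.
  + rewrite (_ : (fun s => _) = (fun _ => r x ^+ 2)); first exact: d_cst.
    by apply/funext => s; rewrite coordinate_lineE /gdiag !eventE.
  + rewrite (_ : (fun s => _) = (fun _ => N x)); first exact: d_cst.
    by apply/funext => s; rewrite coordinate_lineE /gdiag !eventE.
  + rewrite (_ : (fun s => _) = (fun _ => - N x)); first exact: d_cst.
    by apply/funext => s; rewrite coordinate_lineE /gdiag !eventE.
  + rewrite eventE (_ : (fun s => _) = (fun s => r x ^+ 2 * sin s ^+ 2)).
      by deriv_to; ring.
    by apply/funext => s; rewrite coordinate_lineE /gdiag !eventE.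
- have pz a : partial ix_phi (fun q => gdiag q a) (event t x th ph) = 0.
    apply: (@partial_cst _ _ _ (gdiag (event t x th ph) a)) => s.
    by rewrite coordinate_lineE /gdiag !eventE.
  by rewrite !pz /kappa /=; ring.
Qed.

Lemma raise2_diag (F : two_tensor R) q a b : 0 < q 0 ix_theta < pi ->
  raise2 m r F q a b = ((gdiag q a)^-1 * (gdiag q b)^-1)%:C%C *: F q a b.
Proof.
move=> q0; rewrite /raise2 (bigD1 a)//= [X in _ + X]big1 ?addr0 => [|c ca]; last first.
  rewrite big1// => d _; rewrite (inv_metricE _ _ q0) eq_sym (negPf ca) mul0r.
  by rewrite scale0r.
rewrite (bigD1 b)//= big1 ?addr0 => [|d db]; last first.
  by rewrite (inv_metricE b _ q0) eq_sym (negPf db) mulr0 scale0r.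
by rewrite !inv_metricE// !eqxx.
Qed.

Lemma opp_eq0 (Z : 'M[R[i]]_2) : Z = - Z -> Z = 0.
Proof.
move=> h; have : (2 : R[i]) *: Z = 0 by rewrite scaler_nat mulr2n {1}h addNr.
by move/eqP; rewrite scaler_eq0 pnatr_eq0 /= => /eqP.
Qed.

(** For antisymmetric [G] the term with [christoffel m r b] cancels against its own transpose, and
    the other one involves only the contracted symbols [kappa]; no single Christoffel symbol is
    computed. *)
Lemma divergence (A : one_form R) (G : two_tensor R) t x th ph b : 0 < th < pi ->
  let p := event t x th ph in (forall c d, G p c d = - G p d c) ->
  \sum_(a < 4) (cov_up2 m r G p a a b + lie (A p a) (G p a b)) =
  \sum_(a < 4) partialM a (fun q => G q a b) p
  + \sum_(a < 4) (kappa x th a)%:C%C *: G p a b + \sum_(a < 4) lie (A p a) (G p a b).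
Proof.
move=> th0 p Ga; rewrite big_split /=; congr (_ + _).
rewrite /cov_up2 !big_split /= -[RHS]addr0; congr (_ + _ + _).
  rewrite exchange_big /=; apply: eq_bigr => d _.
  by rewrite -scaler_suml -rmorph_sum /= sum_christoffel.
apply: opp_eq0; rewrite {1}exchange_big /= -sumrN; apply: eq_bigr => c _.
rewrite -sumrN; apply: eq_bigr => d _.
by rewrite christoffelC Ga scalerN.
Qed.

End magnetic_tensor.

(** * Reduction of the Yang-Mills equations *)

Section su2_computation.
Context {R : realType}.
Implicit Types (M : 'M[R[i]]_2) (a b c k : R).

Lemma su2D_eq M (M' : 'M[R[i]]_2) a b c a' b' c' : M = su2 a b c -> M' = su2 a' b' c' ->
  M + M' = su2 (a + a') (b + b') (c + c').
Proof. by move=> -> ->; exact: su2D. Qed.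

Lemma su2Z_eq k M a b c : M = su2 a b c -> k%:C%C *: M = su2 (k * a) (k * b) (k * c).
Proof. by move=> ->; exact: su2Z. Qed.

Lemma su2_lie_eq M (M' : 'M[R[i]]_2) a b c a' b' c' : M = su2 a b c -> M' = su2 a' b' c' ->
  lie M M' = su2 (b * c' - c * b') (c * a' - a * c') (a * b' - b * a').
Proof. by move=> -> ->; exact: su2_lie. Qed.

End su2_computation.

(* Rewriting with the [su2] lemmas would search inside the real coefficients. *)
Ltac su2_compute :=
  lazymatch goal with
  | |- su2 _ _ _ = _ => reflexivity
  | |- lie _ _ = _ => eapply su2_lie_eq; su2_compute
  | |- _ *: _ = _ => eapply su2Z_eq; su2_compute
  | |- _ + _ = _ => eapply su2D_eq; su2_compute
  end.

Section magnetic_yang_mills.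
Context {R : realType} {m : R} {xs r : R -> R} {W Wt Wx : R -> R -> R}.
Hypothesis m_gt0 : 0 < m.
Hypothesis Hr : tortoise m xs r.
Hypothesis dWt : forall t x, has_deriv (W ^~ x) t (Wt t x).
Hypothesis dWx : forall t x, has_deriv (W t) x (Wx t x).
Implicit Types (t x th ph s w : R) (a b c d : 'I_4).

Local Notation N := (lapse m r).
Local Notation P := (potential m r).
Local Notation A := (magnetic_connection W).

Definition conn w th b : 'M[R[i]]_2 :=
  match val b with
  | 2%N => su2 (- w) 0 0
  | 3%N => su2 0 (- (w * sin th)) (cos th)
  | _ => su2 0 0 0
  end.

Lemma connE t x th ph b : A (event t x th ph) b = conn (W t x) th b.
Proof.
rewrite /magnetic_connection !eventE.
by elim/ix4P: b; rewrite /conn /= ?su2_tau1 ?su2_tau2 ?su2_tau3 ?su2_0 ?su2N ?oppr0 ?su2D ?addr0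
  ?add0r.
Qed.

Definition dconn t x th a b : 'M[R[i]]_2 :=
  match val a, val b with
  | 0%N, 2%N => su2 (- Wt t x) 0 0
  | 0%N, 3%N => su2 0 (- (Wt t x * sin th)) 0
  | 1%N, 2%N => su2 (- Wx t x) 0 0
  | 1%N, 3%N => su2 0 (- (Wx t x * sin th)) 0
  | 2%N, 3%N => su2 0 (- (W t x * cos th)) (- sin th)
  | _, _ => su2 0 0 0
  end.

Lemma partial_conn t x th ph a b :
  partialM a (fun q => A q b) (event t x th ph) = dconn t x th a b.
Proof.
have h1 := dWt; have h2 := dWx; have h3 := @d_sin R; have h4 := @d_cos R.
have l01 : (0 : R) < 1 by [].
have z y : has_deriv (fun _ : R => 0 : R) y 0 by exact: d_cst.
have cst y z' t' : (forall s, A (coordinate_line a (event t x th ph) s) b = su2 y z' t') ->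
    partialM a (fun q => A q b) (event t x th ph) = su2 0 0 0.
  by move=> H; rewrite su2_0; apply: (partialM_cst l01 (fun s _ => H s)).
elim/ix4P: b cst => cst.
- elim/ix4P: a cst => cst; apply: (cst 0 0 0) => s;
  by rewrite coordinate_lineE connE.
- elim/ix4P: a cst => cst; apply: (cst 0 0 0) => s;
  by rewrite coordinate_lineE connE.
- elim/ix4P: a cst => cst; rewrite /dconn /=.
  + apply: (partialM_su2 (f := fun s => - W s x) (g := fun=> 0) (h := fun=> 0) l01 _ _ (z _)
      (z _)).
      by move=> s _; rewrite coordinate_lineE connE.
    by rewrite eventE; apply: d_N.
  + apply: (partialM_su2 (f := fun s => - W t s) (g := fun=> 0) (h := fun=> 0) l01 _ _ (z _)
      (z _)).
      by move=> s _; rewrite coordinate_lineE connE.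
    by rewrite eventE; apply: d_N.
  + by apply: (cst (- W t x) 0 0) => s; rewrite coordinate_lineE connE.
  + by apply: (cst (- W t x) 0 0) => s; rewrite coordinate_lineE connE.
- elim/ix4P: a cst => cst; rewrite /dconn /=.
  + apply: (partialM_su2 (f := fun=> 0) (g := fun s => - (W s x * sin th))
      (h := fun=> cos th) l01 _ (z _) _ _).
    * by move=> s _; rewrite coordinate_lineE connE.
    * by rewrite eventE; deriv_to; ring.
    * exact: d_cst.
  + apply: (partialM_su2 (f := fun=> 0) (g := fun s => - (W t s * sin th))
      (h := fun=> cos th) l01 _ (z _) _ _).
    * by move=> s _; rewrite coordinate_lineE connE.
    * by rewrite eventE; deriv_to; ring.
    * exact: d_cst.
  + apply: (partialM_su2 (f := fun=> 0) (g := fun s => - (W t x * sin s)) (h := cos) l01 _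
      (z _) _ _).
    * by move=> s _; rewrite coordinate_lineE connE.
    * by rewrite eventE; deriv_to; ring.
    * by rewrite eventE.
  + by apply: (cst 0 (- (W t x * sin th)) (cos th)) => s; rewrite coordinate_lineE connE.
Qed.

(** Symmetry of the Christoffel symbols removes them from the antisymmetrized covariant derivative;
    partial derivatives and the bracket remain. *)
Lemma curvature_magnetic t x th ph a b :
  curvature m r A (event t x th ph) a b =
  magF (Wx t x) (Wt t x) (W t x ^+ 2 - 1) (sin th) a b.
Proof.
rewrite /curvature /cov1 !partial_conn.
rewrite (eq_bigr (fun c => (christoffel m r c b a (event t x th ph))%:C%C
    *: A (event t x th ph) c)) => [|c _]; last by rewrite christoffelC.
move: (\sum_(c < 4) _) => S; rewrite !connE.
have -> : dconn t x th a b - S - (dconn t x th b a - S) = dconn t x th a b - dconn t x th b a.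
  by rewrite opprB addrA subrK.
by elim/ix4P: a; elim/ix4P: b; rewrite /dconn /conn /magF /= su2B su2_lie su2D; apply: su2_eq;
  ring.
Qed.

(** Raising an angular index together with [x] multiplies by the same [1 / (N r^2)] as with [t],
    except that [t] reverses the sign; each index [phi] costs a further [1 / sin^2 theta]. *)
Definition upG t x th a b : 'M[R[i]]_2 :=
  let k := (N x * r x ^+ 2)^-1 in
  match val a, val b with
  | 2%N, 1%N => su2 (Wx t x * k) 0 0
  | 1%N, 2%N => su2 (- (Wx t x * k)) 0 0
  | 2%N, 0%N => su2 (- (Wt t x * k)) 0 0
  | 0%N, 2%N => su2 (Wt t x * k) 0 0
  | 3%N, 1%N => su2 0 (Wx t x * k / sin th) 0
  | 1%N, 3%N => su2 0 (- (Wx t x * k / sin th)) 0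
  | 3%N, 0%N => su2 0 (- (Wt t x * k / sin th)) 0
  | 0%N, 3%N => su2 0 (Wt t x * k / sin th) 0
  | 2%N, 3%N => su2 0 0 ((W t x ^+ 2 - 1) / r x ^+ 4 * (sin th)^-1)
  | 3%N, 2%N => su2 0 0 (- ((W t x ^+ 2 - 1) / r x ^+ 4 * (sin th)^-1))
  | _, _ => su2 0 0 0
  end.

Local Notation G := (raise2 m r (curvature m r A)).

Lemma upGE t x th ph a b : 0 < th < pi -> G (event t x th ph) a b = upG t x th a b.
Proof.
move=> th0; have s0 := lt0r_neq0 (sin_gt0_pi th0).
have N0 := lapse_neq0 m_gt0 Hr x; have r0 := r_neq0 m_gt0 Hr x.
rewrite (raise2_diag m_gt0 Hr) ?eventE// curvature_magnetic.
elim/ix4P: a; elim/ix4P: b; rewrite /magF /upG /gdiag !eventE /= su2Z; apply: su2_eq; by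
  first [ring | field; rewrite ?s0 ?N0 ?r0].
Qed.

Context {Wtt Wxx : R -> R -> R}.
Hypothesis dWtt : forall t x, has_deriv (Wt ^~ x) t (Wtt t x).
Hypothesis dWxx : forall t x, has_deriv (Wx t) x (Wxx t x).

(** The derivative of [upG] in the direction of its own first index. The second part of [l] comes
    from differentiating [1 / (N r^2)] and is cancelled by [kappa] in the divergence. *)
Definition dupG t x th a b : 'M[R[i]]_2 :=
  let k := (N x * r x ^+ 2)^-1 in
  let l := - (Wxx t x * k) + Wx t x * k * (2 * m * P x / N x + 2 * N x / r x) in
  match val a, val b with
  | 0%N, 2%N => su2 (Wtt t x * k) 0 0
  | 1%N, 2%N => su2 l 0 0
  | 0%N, 3%N => su2 0 (Wtt t x * k / sin th) 0
  | 1%N, 3%N => su2 0 (l / sin th) 0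
  | 2%N, 3%N => su2 0 0 (- ((W t x ^+ 2 - 1) / r x ^+ 4 * (cos th / sin th ^+ 2)))
  | _, _ => su2 0 0 0
  end.

Lemma partial_upG t x th ph a b : 0 < th < pi ->
  partialM a (fun q => G q a b) (event t x th ph) = dupG t x th a b.
Proof.
move=> th0; have s0 := lt0r_neq0 (sin_gt0_pi th0).
have N0 := lapse_neq0 m_gt0 Hr x; have r0 := r_neq0 m_gt0 Hr x.
have h1 := dWtt; have h2 := dWxx; have h3 := @d_sin R; have h4 := @d_cos R.
have hN := d_lapse m_gt0 Hr; have hr := d_r m_gt0 Hr.
(* The distance to the poles: within it [upGE] applies along the [theta] line. *)
pose e := Num.min th (pi - th).
have e0 : 0 < e by rewrite lt_min; qlra.
have near_th s : `|th - s| < e -> 0 < s < pi.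
  by rewrite lt_min !ltr_norml; qlra.
have z y : has_deriv (fun _ : R => 0 : R) y 0 by exact: d_cst.
have k0 : N x * r x ^+ 2 != 0 by rewrite mulf_neq0 ?expf_neq0.
have cst y z' t' : (forall s, `|event t x th ph 0 a - s| < e ->
      G (coordinate_line a (event t x th ph) s) a b = su2 y z' t') ->
    partialM a (fun q => G q a b) (event t x th ph) = su2 0 0 0.
  by move=> H; rewrite su2_0; apply: (partialM_cst e0 H).
have val_at (a' b' : 'I_4) s : `|event t x th ph 0 a - s| < e ->
    G (coordinate_line a (event t x th ph) s) a' b' =
    upG (if a == ix_t then s else t) (if a == ix_x then s else x)
        (if a == ix_theta then s else th) a' b'.
  move=> sd; rewrite coordinate_lineE upGE//; case: eqP => // E.
  by apply: near_th; move: sd; rewrite E eventE.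
have dk : has_deriv (fun s => (N s * r s ^+ 2)^-1) x
    (- ((N x * r x ^+ 2)^-1 * (2 * m * P x / N x + 2 * N x / r x))).
  notypeclasses refine (has_deriv_val _ _); first by deriv.
  by rewrite /=; field; rewrite r0 N0.
elim/ix4P: b cst => cst; elim/ix4P: a cst val_at => cst val_at; rewrite /dupG /=.
- by apply: (cst 0 0 0) => s sd; rewrite val_at.
- by apply: (cst 0 0 0) => s sd; rewrite val_at.
- by apply: (cst (- (Wt t x * (N x * r x ^+ 2)^-1)) 0 0) => s sd; rewrite val_at.
- by apply: (cst 0 (- (Wt t x * (N x * r x ^+ 2)^-1 / sin th)) 0) => s sd; rewrite val_at.
- by apply: (cst 0 0 0) => s sd; rewrite val_at.
- by apply: (cst 0 0 0) => s sd; rewrite val_at.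
- by apply: (cst (Wx t x * (N x * r x ^+ 2)^-1) 0 0) => s sd; rewrite val_at.
- by apply: (cst 0 (Wx t x * (N x * r x ^+ 2)^-1 / sin th) 0) => s sd; rewrite val_at.
- apply: (partialM_su2 (f := fun s => Wt s x * (N x * r x ^+ 2)^-1) (g := fun=> 0)
    (h := fun=> 0) e0 _ _ (z _) (z _)).
    by move=> s sd; rewrite val_at.
  by rewrite eventE; deriv_to; ring.
- apply: (partialM_su2 (f := fun s => - (Wx t s * (N s * r s ^+ 2)^-1)) (g := fun=> 0)
    (h := fun=> 0) e0 _ _ (z _) (z _)).
    by move=> s sd; rewrite val_at.
  rewrite eventE; apply: (has_deriv_val (d_N (d_M (h2 t x) dk))); ring.
- by apply: (cst 0 0 0) => s sd; rewrite val_at.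
- by apply: (cst 0 0 (- ((W t x ^+ 2 - 1) / r x ^+ 4 * (sin th)^-1))) => s sd; rewrite val_at.
- apply: (partialM_su2 (f := fun=> 0) (g := fun s => Wt s x * (N x * r x ^+ 2)^-1 / sin th)
    (h := fun=> 0) e0 _ (z _) _ (z _)).
    by move=> s sd; rewrite val_at.
  by rewrite eventE; deriv_to; ring.
- apply: (partialM_su2 (f := fun=> 0) (g := fun s => - (Wx t s * (N s * r s ^+ 2)^-1 / sin th))
    (h := fun=> 0) e0 _ (z _) _ (z _)).
    by move=> s sd; rewrite val_at.
  rewrite eventE; apply: (has_deriv_val (d_N (d_M (d_M (h2 t x) dk) (d_cst _ _)))); ring.
- apply: (partialM_su2 (f := fun=> 0) (g := fun=> 0) (h := fun s =>
    (W t x ^+ 2 - 1) / r x ^+ 4 * (sin s)^-1) e0 _ (z _) (z _) _).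
    by move=> s sd; rewrite val_at.
  rewrite eventE; apply: (has_deriv_val (d_M (d_cst _ _) (d_V s0 (h3 th)))).
  by field; rewrite s0 r0.
- by apply: (cst 0 0 0) => s sd; rewrite val_at.
Qed.

Definition wave_op t x := Wtt t x - Wxx t x + P x * W t x * (W t x ^+ 2 - 1).

(** In the components [t] and [x] the [cot theta] term of the divergence cancels the bracket of
    [cos theta tau3] with [tau2]; the two angular components both reduce to the scalar wave
    equation. *)
Lemma yang_mills_sum t x th ph b : 0 < th < pi ->
  \sum_(a < 4) (cov_up2 m r G (event t x th ph) a a b
    + lie (A (event t x th ph) a) (G (event t x th ph) a b)) =
  match val b with
  | 2%N => su2 (wave_op t x / (N x * r x ^+ 2)) 0 0
  | 3%N => su2 0 (wave_op t x / (N x * r x ^+ 2 * sin th)) 0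
  | _ => su2 0 0 0
  end.
Proof.
move=> th0; have s0 := lt0r_neq0 (sin_gt0_pi th0).
have N0 := lapse_neq0 m_gt0 Hr x; have r0 := r_neq0 m_gt0 Hr x.
have Ga c d : G (event t x th ph) c d = - G (event t x th ph) d c.
  rewrite !upGE//; elim/ix4P: c; elim/ix4P: d; rewrite /upG /= su2N; apply: su2_eq; ring.
rewrite (divergence m_gt0 Hr)// !sum4 !partial_upG// !upGE// !connE.
elim/ix4P: b; rewrite /dupG /upG /conn /kappa /=.
all: apply: etrans; [su2_compute|apply: su2_eq].
all: by first [ring | rewrite /wave_op /potential; field; rewrite ?s0 ?N0 ?r0].
Qed.

Lemma yang_mills_wave : yang_mills m r A <-> (forall t x, wave_op t x = 0).
Proof.
split=> [ym t x|w0 ? t x th ph th0 p b].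
  have th0 : 0 < (pi / 2 : R) < pi by have := @pi_gt0 R; qlra.
  have := ym t x (pi / 2) 0 th0 ix_theta; rewrite yang_mills_sum//= => /su2_inj[+ _ _].
  move/eqP; rewrite mulf_eq0 invr_eq0 mulf_eq0 expf_eq0 /=.
  by rewrite (negPf (lapse_neq0 m_gt0 Hr x)) (negPf (r_neq0 m_gt0 Hr x)) !orbF => /eqP.
apply: (etrans (yang_mills_sum t x ph b th0)).
by rewrite w0 !mul0r; elim/ix4P: b; rewrite /= su2_0.
Qed.

End magnetic_yang_mills.

(** * The energy *)

Section lebesgue.
Context {R : realType}.
Implicit Types (f : R -> R) (a b c : R).
Local Notation mu := (@lebesgue_measure R).

Lemma lebesgue_integ f a b : continuous f -> a < b ->
  (\int[mu]_(x in `[a, b]%classic%R) (f x)%:E)%E = (integ f a b)%:E.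
Proof.
move=> fc ab; have Fc := c_prim fc; have Fd x := d_prim x fc.
rewrite (@continuous_FTC2 _ _ (prim f) _ _ ab).
- by rewrite -EFinB.
- exact: continuous_subspaceT.
- split.
  + by move=> x _; have [] := Fd x.
  + by apply: cvg_at_right_filter; exact: Fc.
  + by apply: cvg_at_left_filter; exact: Fc.
- by move=> x _; exact: d_derive1.
Qed.

Lemma measurable_continuous f (D : set R) : measurable D -> continuous f ->
  measurable_fun D (EFin \o f).
Proof.
move=> mD fc; apply/measurable_EFinP; apply: (@measurable_funS _ _ _ _ setT) => //.
exact: continuous_measurable_fun.
Qed.

Lemma integ_le_lebesgue f a b : continuous f -> (forall x, 0 <= f x) -> a < b ->
  ((integ f a b)%:E <= \int[mu]_(x in [set: R]) (f x)%:E)%E.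
Proof.
move=> fc f0 ab; rewrite -lebesgue_integ//; apply: ge0_subset_integral => //.
- exact: measurable_continuous.
- by move=> x _; rewrite lee_fin.
Qed.

(** Monotone convergence along the intervals [[- (n + 1), n + 1]]. *)
Lemma lebesgue_le f c : continuous f -> (forall x, 0 <= f x) ->
  (forall a b, a <= b -> integ f a b <= c) ->
  (\int[mu]_(x in [set: R]) (f x)%:E <= c%:E)%E.
Proof.
move=> fc f0 H.
pose F (n : nat) : set R := `[- n.+1%:R, n.+1%:R]%classic.
have FT : \bigcup_n F n = [set: R].
  apply/seteqP; split => // x _; exists (Num.truncn `|x|) => //.
  by rewrite /F /= in_itv/= -ler_norml; apply/ltW/truncnS_gt.
have nF : nondecreasing_seq F.
  apply/nondecreasing_seqP => n; rewrite subsetEset; apply: subset_itv; rewrite bnd_simp.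
    by rewrite lerN2 ler_nat.
  by rewrite ler_nat.
have mF n : measurable (F n) by exact: measurable_itv.
have mf n : measurable_fun (F n) (EFin \o f) by exact: measurable_continuous.
have cv := @ge0_nondecreasing_set_cvg_integral _ (measurableTypeR R) R F (EFin \o f) mu nF mF mf
  (fun _ x _ => f0 x).
rewrite -FT -(cvg_lim _ cv)//; apply: lime_le; first exact: cvgP cv.
apply: nearW => n; rewrite lebesgue_integ ?lee_fin//; last by have := ltr0Sn R n; qlra.
by apply: H; have := ltr0Sn R n; qlra.
Qed.

Lemma integral_sin : (\int[mu]_(th in `]0%R, pi[%classic%R) (sin th)%:E)%E = 2%:E.
Proof.
rewrite -(integral_itv_bndoo true false); last first.
  by apply: (@measurable_continuous sin) => //; exact: continuous_sin.
have p0 := @pi_gt0 R.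
rewrite lebesgue_integ//; last exact: continuous_sin.
rewrite (@integE _ _ (fun x => - cos x)); last 2 first.
- exact: continuous_sin.
- move=> x _; apply: (has_deriv_val (d_N (d_cos x))); exact: opprK.
by rewrite cospi cos0; congr EFin; ring.
Qed.

End lebesgue.

Section energy_formula.
Context {R : realType} {m : R} {xs r : R -> R}.
Hypothesis m_gt0 : 0 < m.
Hypothesis Hr : tortoise m xs r.
Implicit Types (t x th ph s : R) (a b c d : 'I_4) (A B C : R).

Local Notation N := (lapse m r).
Local Notation P := (potential m r).
Local Notation mu := (@lebesgue_measure R).

Lemma slice_densityE t x th ph : 0 < th < pi ->
  slice_density m r (event t x th ph) = Num.sqrt (N x) * r x ^+ 2 * sin th.
Proof.
move=> th0; have s0 := sin_gt0_pi th0; have r0 := r_gt0 m_gt0 Hr x.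
have N0 := lapse_gt0 m_gt0 Hr x.
rewrite /slice_density (_ : row' _ _ = diag_mx (\row_(i < 4.-1)
    gdiag (m := m) (r := r) (event t x th ph) (lift ix_t i))); last first.
  apply/matrixP => i j; rewrite [LHS]mxE [LHS]mxE [RHS]mxE metricE.
  by rewrite (inj_eq lift_inj) mxE.
rewrite det_diag !big_ord_recl big_ord0 !mxE.
have -> : lift ix_t ord0 = ix_x by exact: val_inj.
have -> : lift ix_t (lift ord0 ord0) = ix_theta by exact: val_inj.
have -> : lift ix_t (lift ord0 (lift ord0 ord0)) = ix_phi by exact: val_inj.
rewrite /gdiag !eventE mulr1.
rewrite (_ : N x * _ = N x * (r x ^+ 2 * sin th) ^+ 2); last by ring.
by rewrite sqrtrM ?ltW// sqrtr_sqr ger0_norm ?mulrA// mulr_ge0 ?sqr_ge0// ltW.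
Qed.

Lemma su2_dotZr (X Y : 'M[R[i]]_2) s : su2_dot X (s%:C%C *: Y) = s * su2_dot X Y.
Proof.
rewrite /su2_dot -scalemxAr mxtraceZ mulrCA; congr (_ * _).
by case: (\tr _) => u v; rewrite /= mul0r subr0.
Qed.

(** The [sqrt N] of the slice density cancels the one of the unit normal, and its [r^2] cancels the
    [1 / r^2] of the stress-energy tensor, leaving [sin theta] to integrate over the sphere. *)
Lemma energy_density_magF (F : two_tensor R) A B C t x th ph : 0 < th < pi ->
  (forall a b, F (event t x th ph) a b = magF A B C (sin th) a b) ->
  energy_density m r F (event t x th ph) =
  (4 * pi)^-1 * sin th * (B ^+ 2 + A ^+ 2 + P x / 2 * C ^+ 2).
Proof.
move=> th0 FE; have s0 := lt0r_neq0 (sin_gt0_pi th0).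
have N0 := lapse_gt0 m_gt0 Hr x; have r0 := r_neq0 m_gt0 Hr x.
have p0 : 0 < event t x th ph 0 ix_theta < pi by rewrite eventE.
have diag (f : 'I_4 -> 'I_4 -> R) : \sum_(c < 4) \sum_(d < 4)
    inv_metric m r (event t x th ph) c d * f c d =
    \sum_(c < 4) (gdiag (m := m) (r := r) (event t x th ph) c)^-1 * f c c.
  apply: eq_bigr => c _; rewrite (bigD1 c)//= big1 ?addr0 => [|d dc].
    by rewrite (inv_metricE m_gt0 Hr)// eqxx.
  by rewrite (inv_metricE m_gt0 Hr)// eq_sym (negPf dc) mul0r.
pose nrm2 (a b : 'I_4) : R := match val a, val b with
  | 2, 1 | 1, 2 => (A ^+ 2)%R             | 2, 0 | 0, 2 => (B ^+ 2)%R
  | 3, 1 | 1, 3 => ((A * sin th) ^+ 2)%R     | 3, 0 | 0, 3 => ((B * sin th) ^+ 2)%R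
  | 2, 3 | 3, 2 => ((C * sin th) ^+ 2)%R    | _, _ => (0 : R)%R
  end%N.
have magF_norm2 a b : su2_dot (magF A B C (sin th) a b) (magF A B C (sin th) a b) =
    (4 * pi)^-1 * nrm2 a b.
  by elim/ix4P: a; elim/ix4P: b; rewrite /magF /nrm2 /= su2_inner; congr (_ * _); ring.
have T : stress_energy m r F (event t x th ph) ix_t ix_t =
    (4 * pi)^-1 / r x ^+ 2 * (B ^+ 2 + A ^+ 2 + P x / 2 * C ^+ 2).
  rewrite /stress_energy (diag (fun c d => su2_dot (F _ ix_t c) (F _ ix_t d))).
  have -> : \sum_(c < 4) \sum_(d < 4) su2_dot (F (event t x th ph) c d)
        (raise2 m r F (event t x th ph) c d) =
      \sum_(c < 4) \sum_(d < 4) (gdiag (m := m) (r := r) (event t x th ph) c)^-1 *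
        (gdiag (m := m) (r := r) (event t x th ph) d)^-1 * ((4 * pi)^-1 * nrm2 c d).
    apply: eq_bigr => c _; apply: eq_bigr => d _.
    by rewrite (raise2_diag m_gt0 Hr)// su2_dotZr FE magF_norm2.
  under eq_bigr do rewrite FE magF_norm2.
  rewrite metricE eqxx mulr1n; move: ((4 * pi)^-1 : R) => k.
  rewrite !sum4 /nrm2 /gdiag !eventE /= /potential; field.
  by rewrite r0 s0 gt_eqF.
rewrite /energy_density slice_densityE//.
rewrite (bigD1 ix_t)//= big1 ?addr0 => [|c ct]; last first.
  by rewrite /slice_normal /vec_dt (negPf ct) !mulr0.
rewrite /current (bigD1 ix_t)//= big1 ?addr0 => [|c ct]; last first.
  by rewrite /vec_dt (negPf ct) mul0r.
rewrite /slice_normal /vec_dt eqxx mul1r mulr1 eventE T.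
move: ((4 * pi)^-1 : R) => k.
have q0 : Num.sqrt (N x) != 0 by rewrite gt_eqF// sqrtr_gt0.
by field; rewrite r0 q0.
Qed.

(** The area [4 pi] of the sphere cancels the normalization of [su2_dot]. *)
Lemma energy_magF (F : two_tensor R) (A B C : R -> R) t :
  (forall x th ph a b, 0 < th < pi ->
     F (event t x th ph) a b = magF (A x) (B x) (C x) (sin th) a b) ->
  energy m r F t =
  (\int[mu]_(x in [set: R]) (B x ^+ 2 + A x ^+ 2 + P x / 2 * C x ^+ 2)%:E)%E.
Proof.
move=> FE; apply: eq_integral => x _; set e := _ + _ * _ ^+ 2.
have pi0 := @pi_gt0 R.
transitivity (\int[mu]_(th in `]0%R, pi[%classic%R) ((e / 2)%:E * (sin th)%:E))%E.
  apply: eq_integral => th; rewrite inE/= in_itv/= => th0.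
  transitivity (\int[mu]_(ph in `]0%R, (2 * pi)%R[%classic%R)
      cst (((4 * pi)^-1 * sin th * e)%:E) ph)%E.
    apply: eq_integral => ph _ /=.
    by rewrite (energy_density_magF (A := A x) (B := B x) (C := C x))// => a b; exact: FE.
  rewrite integral_cst//= lebesgue_measure_itv/= lte_fin mulr_gt0//.
  rewrite -EFinB -!EFinM; congr EFin; rewrite subr0.
  by move: (pi : R) pi0 => q q0; field; rewrite gt_eqF.
rewrite integralZl//; last first.
  apply: (@integrableS _ _ _ mu `[0%R, pi]%classic) => //.
    by apply: subset_itv; rewrite bnd_simp.
  apply: continuous_compact_integrable; first exact: segment_compact.
  by apply: continuous_subspaceT; exact: continuous_sin.
by rewrite integral_sin -EFinM divfK.
Qed.

End energy_formula.

(** * The semilinear wave equation *)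

Section duhamel.
Context {R : realType}.
Implicit Types (f ft fx G Gx S Sx : R -> R -> R) (h : R -> R) (sg a b t x s y : R).

Lemma C1_comb f ft fx g gt gx a b : C1_with f ft fx -> C1_with g gt gx ->
  C1_with (fun t x => a * f t x + b * g t x)
    (fun t x => a * ft t x + b * gt t x) (fun t x => a * fx t x + b * gx t x).
Proof.
move=> [f1 f2 f3 f4] [g1 g2 g3 g4]; split.
- by move=> t x; have h1 := f1 t x; have h2 := g1 t x; deriv_to; ring.
- by move=> t x; have h1 := f2 t x; have h2 := g2 t x; deriv_to; ring.
- by rewrite /cont2; conti.
- by rewrite /cont2; conti.
Qed.

Lemma C1_wave h (h1 : R -> R) sg : (forall x, has_deriv h x (h1 x)) -> continuous h1 ->
  C1_with (fun t x => h (x + sg * t)) (fun t x => sg * h1 (x + sg * t))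
    (fun t x => h1 (x + sg * t)).
Proof.
move=> hd h1c; split.
- by move=> t x; deriv_to; ring.
- by move=> t x; deriv_to; ring.
- by rewrite /cont2; conti.
- by rewrite /cont2; conti.
Qed.

Lemma C1_ext f ft fx f' ft' fx' : C1_with f ft fx ->
  (forall t x, f t x = f' t x) -> (forall t x, ft t x = ft' t x) ->
  (forall t x, fx t x = fx' t x) -> C1_with f' ft' fx'.
Proof.
move=> C fE ftE fxE.
have -> : f' = f by apply/funext => t; apply/funext => x; rewrite fE.
have -> : ft' = ft by apply/funext => t; apply/funext => x; rewrite ftE.
by have -> : fx' = fx by apply/funext => t; apply/funext => x; rewrite fxE.
Qed.

(* The solution of [u_t - sg * u_x = G] vanishing at [t = 0]. *)
Definition transport sg G t x := prim (fun s => G s (x + sg * (t - s))) t.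

Lemma c_transport sg G : cont2 G -> cont2 (transport sg G).
Proof.
move=> Gc; pose H y s := G s (y - sg * s).
have Hc : cont2 H by rewrite /cont2 /H; conti.
have -> : transport sg G = (fun t x => prim (H (x + sg * t)) t).
  apply/funext => t; apply/funext => x; rewrite /transport; congr prim.
  by apply/funext => s; rewrite /H; congr G; ring.
have pc := cont2_prim Hc.
by rewrite /cont2; apply: (c_comp2 pc); conti.
Qed.

(** In the characteristic variable [y = x + sg * t] the integrand depends on [(t, x)] through [y]
    only, so both derivatives need just the [x] derivative of the source. *)
Lemma transport_C1 sg G Gx : cont2 G -> cont2 Gx ->
  (forall t x, has_deriv (G t) x (Gx t x)) ->
  C1_with (transport sg G) (fun t x => G t x + sg * transport sg Gx t x)
    (transport sg Gx).
Proof.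
move=> Gc Gxc Gd; pose H y s := G s (y - sg * s); pose Hy y s := Gx s (y - sg * s).
have Hc : cont2 H by rewrite /cont2 /H; conti.
have Hyc : cont2 Hy by rewrite /cont2 /Hy; conti.
have Hd s x : has_deriv (H ^~ x) s (Hy s x).
  rewrite /H /Hy; apply: has_deriv_val; first apply: (d_comp (Gd _ _)).
    by deriv.
  by ring.
have E (F : R -> R -> R) t x : transport sg F t x =
    prim ((fun y s => F s (y - sg * s)) (x + sg * t)) t.
  rewrite /transport; congr prim.
  by apply/funext => s; congr F; ring.
have C := C1_prim Hc Hyc Hd; split.
- move=> t x; have -> : transport sg G ^~ x = fun t => prim (H (x + sg * t)) t.
    by apply/funext => s; rewrite E.
  have h1 : has_deriv (fun t => x + sg * t) t sg by deriv_to; ring.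
  have h2 : has_deriv (fun t : R => t) t 1 by exact: d_id.
  apply: (has_deriv_val (d_comp2 C h1 h2)) => /=.
  by rewrite E /H addrK /Hy; ring.
- move=> t x; have -> : transport sg G t = fun x => prim (H (x + sg * t)) t.
    by apply/funext => s; rewrite E.
  have h1 : has_deriv (fun x => x + sg * t) x 1 by deriv_to; ring.
  have h2 : has_deriv (fun=> t) x 0 by exact: d_cst.
  apply: (has_deriv_val (d_comp2 C h1 h2)) => /=.
  by rewrite E /Hy; ring.
- have := c_transport (sg := sg) Gxc; rewrite /cont2 => h; conti.
- exact: c_transport.
Qed.

(* The solution of [u_tt - u_xx = S] with vanishing data. *)
Definition duhamel S t x :=
  let Q := fun s => prim (S s) in
  2^-1 * transport 1 Q t x + - 2^-1 * transport (-1) Q t x.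

Lemma duhamelE S t x : cont2 S ->
  duhamel S t x = 2^-1 * integ (fun s => integ (S s) (x - (t - s)) (x + (t - s))) 0 t.
Proof.
move=> Sc; have pc := cont2_prim Sc.
have c1 : continuous (fun s => prim (S s) (x + 1 * (t - s))).
  by apply: (c_comp2 pc); conti.
have c2 : continuous (fun s => prim (S s) (x + -1 * (t - s))).
  by apply: (c_comp2 pc); conti.
rewrite /duhamel /transport !prim_integ// mulNr -mulrBr -integB//; congr (_ * integ _ _ _).
by apply/funext => s; rewrite /integ mul1r mulN1r.
Qed.

Lemma duhamel0 S x : cont2 S -> duhamel S 0 x = 0.
Proof. by move=> Sc; rewrite duhamelE// /integ subrr mulr0. Qed.

Lemma c_duhamel S : cont2 S -> cont2 (duhamel S).
Proof.
move=> Sc; have pc := cont2_prim Sc.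
have := c_transport (sg := 1) pc; have := c_transport (sg := -1) pc.
by rewrite /cont2 /duhamel => h1 h2; conti.
Qed.

(** The transported source is the [x] primitive of [S], so continuity of [S] already gives one
    derivative in each variable. *)
Lemma duhamel_C1 S : cont2 S -> C1_with (duhamel S)
  (fun t x => 2^-1 * transport 1 S t x + 2^-1 * transport (-1) S t x)
  (fun t x => 2^-1 * transport 1 S t x + - 2^-1 * transport (-1) S t x).
Proof.
move=> Sc; have pc := cont2_prim Sc.
have Qd t x : has_deriv (prim (S t)) x (S t x) by apply: d_prim; exact: cont2_l.
have := C1_comb (2^-1) (- 2^-1) (transport_C1 1 pc Sc Qd) (transport_C1 (-1) pc Sc Qd).
by move=> /C1_ext; apply => // t x; ring.
Qed.

Lemma duhamel_C2 S Sx : cont2 S -> cont2 Sx ->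
  (forall t x, has_deriv (S t) x (Sx t x)) ->
  exists Dt Dx Dtt Dtx Dxx, [/\ C1_with (duhamel S) Dt Dx, C1_with Dt Dtt Dtx,
    C1_with Dx Dtx Dxx, forall t x, Dtt t x = Dxx t x + S t x &
    forall x, Dt 0 x = 0].
Proof.
move=> Sc Sxc Sd.
have C1 := transport_C1 1 Sc Sxc Sd; have C2 := transport_C1 (-1) Sc Sxc Sd.
do 5 eexists; split; first exact: duhamel_C1.
- exact: (C1_comb (2^-1) (2^-1) C1 C2).
- apply: (C1_ext (C1_comb (2^-1) (- 2^-1) C1 C2)) => // t x; ring.
- by move=> t x /=; field.
- move=> x; rewrite /= /transport !prim0 ?mulr0 ?addr0//.
    by move=> s; apply: (c_comp2 Sc); conti.
  by move=> s; apply: (c_comp2 Sc); conti.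
Qed.

(** [|t| + |x|] is the maximum of [|x + t|] and [|x - t|]: diamonds are squares in null
    coordinates. *)
Lemma in_diamond t x K : (`|t| + `|x| <= K) = (`|x + t| <= K) && (`|x - t| <= K).
Proof.
rewrite !ler_norml; have [t0|t0] := leP 0 t; have [x0|x0] := leP 0 x;
  rewrite ?(ger0_norm t0) ?(ltr0_norm t0) ?(ger0_norm x0) ?(ltr0_norm x0);
  by apply/idP/andP => *; [split|]; qlra.
Qed.

(** The triangle of dependence of a point of the diamond stays in the diamond. The inner integral
    has length at most [2 * K], whose 2 cancels the factor one half of Duhamel's formula, and the
    outer one gains [1 / g]. *)
Lemma duhamel_diff S S' K c g t x : cont2 S -> cont2 S' -> 0 < g -> 0 <= c ->
  (forall s y, `|s| + `|y| <= K -> `|S s y - S' s y| <= c * eweight g s) ->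
  `|t| + `|x| <= K ->
  `|duhamel S t x - duhamel S' t x| <= K * c / g * eweight g t.
Proof.
move=> Sc Sc' g0 c0 H txK.
have pc := cont2_prim Sc; have pc' := cont2_prim Sc'.
have K0 : 0 <= K by apply: le_trans txK; rewrite addr_ge0.
pose J (T : R -> R -> R) s := integ (T s) (x - (t - s)) (x + (t - s)).
have Jc T : cont2 T -> continuous (J T).
  move=> Tc; have qc := cont2_prim Tc; rewrite /J /integ.
  by apply: c_D; [|apply: c_N]; apply: (c_comp2 qc); conti.
rewrite !duhamelE// -mulrBr -integB; [|exact: Jc|exact: Jc].
have Jd : `|integ (fun s => J S s - J S' s) 0 t| <= 2 * K * c / g * eweight g (t - 0).
  apply: eweight_integ => //; first by rewrite !mulr_ge0.
    by have := Jc _ Sc; have := Jc _ Sc'; move=> h1 h2; conti.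
  move=> s; rewrite subr0 => st.
  have sK : `|s| + `|t - s| = `|t|.
    move: st; rewrite /Num.min /Num.max; case: ifPn; rewrite -?leNgt => ? ?.
      by rewrite !ger0_norm; qlra.
    by rewrite !ler0_norm; qlra.
  have S1 : continuous (S s) := cont2_l Sc; have S2 : continuous (S' s) := cont2_l Sc'.
  rewrite /J -integB//; apply: le_trans (integ_norm_cst (M := c * eweight g s) _ _) _.
  - by conti.
  - move=> y /(@minmax_norm _ _ _ _ (`|x| + `|t - s|)) yx; apply: H.
    have := yx (ler_normB _ _) (ler_normD _ _); qlra.
  - rewrite (_ : _ - _ = 2 * (t - s)); last by ring.
    rewrite normrM (ger0_norm (ler0n _ 2)).
    have -> : 2 * K * c * eweight g s = c * eweight g s * (2 * K) by ring.
    rewrite ler_wpM2l//; last by have := normr_ge0 x; have := normr_ge0 s; qlra.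
    by rewrite mulr_ge0// (le_trans _ (eweight_ge1 g s)).
rewrite normrM ger0_norm ?invr_ge0// mulrC ler_pdivrMr//.
by apply: le_trans Jd _; rewrite subr0 -!mulrA; qlra.
Qed.

End duhamel.

Section mild_solutions.
Context {R : realType} {P P1 W0 W0p W0pp W1 W1p : R -> R}.
Hypothesis Pd : forall x, has_deriv P x (P1 x).
Hypothesis P1c : continuous P1.
Hypothesis W0d : forall x, has_deriv W0 x (W0p x).
Hypothesis W0pd : forall x, has_deriv W0p x (W0pp x).
Hypothesis W0ppc : continuous W0pp.
Hypothesis W1d : forall x, has_deriv W1 x (W1p x).
Hypothesis W1pc : continuous W1p.
Implicit Types (U V W : R -> R -> R) (f : R -> R) (t x s y u v L K M : R).

Definition wave_solution f W Wt Wx := exists Wtt Wtx Wxx : R -> R -> R,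
  [/\ C1_with W Wt Wx, C1_with Wt Wtt Wtx, C1_with Wx Wtx Wxx,
      forall t x, Wtt t x = Wxx t x - P x * f (W t x) &
      forall x, W 0 x = W0 x /\ Wt 0 x = W1 x].

Definition free_wave t x :=
  (2^-1 * W0 (x + 1 * t) + 2^-1 * W0 (x + -1 * t)) +
  (2^-1 * prim W1 (x + 1 * t) + - 2^-1 * prim W1 (x + -1 * t)).

Definition mild f W t x := free_wave t x - duhamel (fun s y => P y * f (W s y)) t x.

Lemma free_wave_C2 : exists Ft Fx Ftt Ftx Fxx, [/\ C1_with free_wave Ft Fx,
    C1_with Ft Ftt Ftx, C1_with Fx Ftx Fxx, forall t x, Ftt t x = Fxx t x &
    forall x, free_wave 0 x = W0 x /\ Ft 0 x = W1 x].
Proof.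
have W0pc := d_continuous W0pd; have W1c := d_continuous W1d.
have pd x : has_deriv (prim W1) x (W1 x) by exact: d_prim.
have A0 sg := C1_wave sg W0d W0pc; have A1 sg := C1_wave sg W0pd W0ppc.
have B0 sg := C1_wave sg pd W1c; have B1 sg := C1_wave sg W1d W1pc.
pose Ft t x := (2^-1 * W0p (x + 1 * t) + - 2^-1 * W0p (x + -1 * t)) +
  (2^-1 * W1 (x + 1 * t) + 2^-1 * W1 (x + -1 * t)).
pose Fx t x := (2^-1 * W0p (x + 1 * t) + 2^-1 * W0p (x + -1 * t)) +
  (2^-1 * W1 (x + 1 * t) + - 2^-1 * W1 (x + -1 * t)).
pose Ftt t x := (2^-1 * W0pp (x + 1 * t) + 2^-1 * W0pp (x + -1 * t)) +
  (2^-1 * W1p (x + 1 * t) + - 2^-1 * W1p (x + -1 * t)).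
pose Ftx t x := (2^-1 * W0pp (x + 1 * t) + - 2^-1 * W0pp (x + -1 * t)) +
  (2^-1 * W1p (x + 1 * t) + 2^-1 * W1p (x + -1 * t)).
exists Ft, Fx, Ftt, Ftx, Ftt; split; [| | |by []|].
- apply: (C1_ext (C1_comb 1 1 (C1_comb (2^-1) (2^-1) (A0 1) (A0 (-1)))
    (C1_comb (2^-1) (- 2^-1) (B0 1) (B0 (-1))))) => t x;
    rewrite /free_wave /Ft /Fx; ring.
- apply: (C1_ext (C1_comb 1 1 (C1_comb (2^-1) (- 2^-1) (A1 1) (A1 (-1)))
    (C1_comb (2^-1) (2^-1) (B1 1) (B1 (-1))))) => t x;
    rewrite /Ft /Ftt /Ftx; ring.
- apply: (C1_ext (C1_comb 1 1 (C1_comb (2^-1) (2^-1) (A1 1) (A1 (-1)))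
    (C1_comb (2^-1) (- 2^-1) (B1 1) (B1 (-1))))) => t x;
    rewrite /Fx /Ftt /Ftx; ring.
- move=> x; rewrite /free_wave /Ft !mulr0 addr0; split; by field.
Qed.

Let Pc : continuous P := d_continuous Pd.

Lemma c_source f W : continuous f -> cont2 W -> cont2 (fun s y => P y * f (W s y)).
Proof.
move=> fc Wc; have Pc' := Pc; by rewrite /cont2; conti.
Qed.

Lemma c_mild f W : continuous f -> cont2 W -> cont2 (mild f W).
Proof.
move=> fc Wc; have [Ft [Fx [_ [_ [_ [/C1_cont Fc _ _ _ _]]]]]] := free_wave_C2.
have := c_duhamel (c_source fc Wc); rewrite /cont2 /mild => h.
by conti.
Qed.

(** Bootstrap: a continuous [W] has a continuous source, hence is C1; then the source has a
    continuous [x] derivative, hence [W] is C2. *)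
Lemma mild_regular f f1 W : (forall u, has_deriv f u (f1 u)) -> continuous f1 ->
  cont2 W -> (forall t x, W t x = mild f W t x) ->
  exists Wt Wx, wave_solution f W Wt Wx.
Proof.
move=> fd f1c Wc WE; have fc := d_continuous fd; have Pc' := Pc.
have [Ft [Fx [Ftt [Ftx [Fxx [F1 F2 F3 FE F0]]]]]] := free_wave_C2.
have Sc := c_source fc Wc.
have [Wt [Wx C]] : exists Wt Wx, C1_with W Wt Wx.
  do 2 eexists; apply: (C1_ext (C1_comb 1 (-1) F1 (duhamel_C1 Sc))) => // t x.
  by rewrite WE /mild; ring.
have [_ Wxd _ Wxc] := C.
pose Sx t x := P1 x * f (W t x) + P x * (f1 (W t x) * Wx t x).
have Sxc : cont2 Sx.
  by rewrite /cont2 /Sx; conti.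
have Sd t x : has_deriv (fun y => P y * f (W t y)) x (Sx t x).
  apply: d_M; first exact: Pd.
  exact: (d_comp (fd _) (Wxd t x)).
have [Dt [Dx [Dtt [Dtx [Dxx [D1 D2 D3 DE D0]]]]]] := duhamel_C2 Sc Sxc Sd.
exists (fun t x => 1 * Ft t x + -1 * Dt t x), (fun t x => 1 * Fx t x + -1 * Dx t x).
exists (fun t x => 1 * Ftt t x + -1 * Dtt t x), (fun t x => 1 * Ftx t x + -1 * Dtx t x),
  (fun t x => 1 * Fxx t x + -1 * Dxx t x); split.
- apply: (C1_ext (C1_comb 1 (-1) F1 D1)) => // t x.
  by rewrite WE /mild; ring.
- exact: C1_comb.
- exact: C1_comb.
- by move=> t x; rewrite DE FE; ring.
- move=> x; have [h1 h2] := F0 x; rewrite WE /mild duhamel0// D0 h1 h2.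
  by split; ring.
Qed.

Lemma mildB f f' U V t x : mild f U t x - mild f' V t x =
  duhamel (fun s y => P y * f' (V s y)) t x - duhamel (fun s y => P y * f (U s y)) t x.
Proof. by rewrite /mild; ring. Qed.

(** [duhamel_diff] with [c = 0]. This is what allows exchanging the cubic and its truncation inside
    a diamond where the solution is bounded. *)
Lemma mild_domain f f' U V K t x : continuous f -> continuous f' ->
  cont2 U -> cont2 V ->
  (forall s y, `|s| + `|y| <= K -> f (U s y) = f' (V s y)) ->
  `|t| + `|x| <= K -> mild f U t x = mild f' V t x.
Proof.
move=> fc fc' Uc Vc H txK; apply/eqP; rewrite -subr_eq0 -normr_le0 mildB.
apply: le_trans (@duhamel_diff _ _ _ K 0 1 t x (c_source fc' Vc)
  (c_source fc Uc) _ _ _ txK) _ => //.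
- by move=> s y sy; rewrite H// subrr normr0 mul0r.
- by rewrite mulr0 !mul0r.
Qed.

Section lipschitz_source.
Variables (f : R -> R) (L Pm : R).
Hypothesis fc : continuous f.
Hypothesis L_ge0 : 0 <= L.
Hypothesis fL : forall u v, `|f u - f v| <= L * `|u - v|.
Hypothesis P_bnd : forall x, `|P x| <= Pm.

Let T (U : R -> R -> R) a b :=
  mild f (fun t x => U (x + t) (x - t)) ((a - b) / 2) ((a + b) / 2).

(* In the null coordinates [a = x + t], [b = x - t] the domain of dependence of
   the diamond [`|t| + `|x| <= K] is a square. *)
Let T_halves K : 0 < K -> halves T K.
Proof.
move=> K0; have Pm0 : 0 <= Pm by apply: le_trans (P_bnd 0).
have PL : 0 <= Pm * L by rewrite mulr_ge0.
(* Makes the contraction factor [K * (Pm * L) / g] at most one half. *)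
pose g := 2 * (K * (Pm * L)) + 1.
have KPL : 0 <= K * (Pm * L) by rewrite mulr_ge0// ltW.
have g0 : 0 < g by rewrite /g; qlra.
have dia a b : `|a| <= K -> `|b| <= K -> `|(a - b) / 2| + `|(a + b) / 2| <= K.
  move=> aK bK; rewrite in_diamond.
  rewrite (_ : (a + b) / 2 + (a - b) / 2 = a); last by field.
  by rewrite (_ : (a + b) / 2 - (a - b) / 2 = b) ?aK//; field.
exists (fun a b => eweight g ((a - b) / 2)), (2 * expR (g * K)).
  move=> a b aK bK; rewrite eweight_ge1 eweight_le//; first exact: ltW.
  by have := dia _ _ aK bK; have := normr_ge0 ((a + b) / 2); qlra.
move=> U V c Uc Vc c0 H a b aK bK.
have cc (W : R -> R -> R) : cont2 W -> cont2 (fun t x => W (x + t) (x - t)).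
  by move=> Wc; rewrite /cont2; conti.
rewrite /T mildB distrC.
apply: le_trans (@duhamel_diff _ _ _ K (Pm * L * c) g _ _
  (c_source fc (cc _ Uc)) (c_source fc (cc _ Vc)) g0 _ _ (dia _ _ aK bK)) _.
- by rewrite mulr_ge0.
- move=> s y; rewrite in_diamond => /andP[sy1 sy2].
  rewrite -mulrBr normrM -!mulrA ler_pM//.
  apply: le_trans (fL _ _) _; rewrite ler_wpM2l//.
  apply: le_trans (H _ _ sy1 sy2) _.
  by rewrite (_ : (y + s - (y - s)) / 2 = s)//; field.
- rewrite ler_wpM2r ?(le_trans _ (eweight_ge1 _ _))//.
  rewrite ler_pdivrMr// /g.
  rewrite (_ : K * (Pm * L * c) = K * (Pm * L) * c); last by ring.
  by move: (K * (Pm * L)) KPL => k k0; have := mulr_ge0 k0 c0; qlra.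
Qed.

Lemma mild_exists : exists2 U, cont2 U & forall t x, U t x = mild f U t x.
Proof.
have Tc (U : R -> R -> R) : cont2 U -> cont2 (T U).
  move=> Uc; have h : cont2 (fun t x => U (x + t) (x - t)).
    by rewrite /cont2; conti.
  by have := c_mild fc h; rewrite /cont2 /T => h'; apply: (c_comp2 h'); conti.
have [U Uc UT] := volterra_exists Tc T_halves.
exists (fun t x => U (x + t) (x - t)); first by rewrite /cont2; conti.
move=> t x; rewrite UT /T; congr mild; by field.
Qed.

Lemma mild_unique U V K : 0 < K -> cont2 U -> cont2 V ->
  (forall t x, `|t| + `|x| <= K -> U t x = mild f U t x) ->
  (forall t x, `|t| + `|x| <= K -> V t x = mild f V t x) ->
  forall t x, `|t| + `|x| <= K -> U t x = V t x.
Proof.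
move=> K0 Uc Vc UE VE t x; rewrite in_diamond => /andP[h1 h2].
have n1 (W : R -> R -> R) s y : W s y = W (((y + s) - (y - s)) / 2) (((y + s) + (y - s)) / 2).
  by congr W; field.
have nc (W : R -> R -> R) : cont2 W -> cont2 (fun a b => W ((a - b) / 2) ((a + b) / 2)).
  by move=> Wc; rewrite /cont2; conti.
have nT (W : R -> R -> R) : (forall t x, `|t| + `|x| <= K -> W t x = mild f W t x) ->
    forall a b, `|a| <= K -> `|b| <= K -> W ((a - b) / 2) ((a + b) / 2) =
      T (fun a b => W ((a - b) / 2) ((a + b) / 2)) a b.
  move=> WE a b aK bK; rewrite WE /T.
    by congr (mild _ _ _ _); apply/funext => s; apply/funext => y; exact: n1.
  rewrite in_diamond (_ : (a + b) / 2 + (a - b) / 2 = a); last by field.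
  by rewrite (_ : (a + b) / 2 - (a - b) / 2 = b) ?aK//; field.
rewrite n1 [RHS]n1.
exact: (volterra_unique (T_halves K0) (nc _ Uc) (nc _ Vc) (nT _ UE) (nT _ VE) h1 h2).
Qed.

End lipschitz_source.

End mild_solutions.

(** * Truncation of the cubic *)

Section truncated_cubic.
Context {R : realType}.
Implicit Types (M s u v : R).

(** For [M >= 0], the projection onto [[- M, M]]; absolute values make its continuity immediate. *)
Definition clamp M s := (`|s + M| - `|s - M|) / 2.

Lemma clamp_id M s : `|s| <= M -> clamp M s = s.
Proof.
rewrite ler_norml => sM; rewrite /clamp ger0_norm; last by qlra.
by rewrite ler0_norm; [field|qlra].
Qed.

Lemma clamp_le M s : 0 <= M -> `|clamp M s| <= M.
Proof.
move=> M0; rewrite ler_norml /clamp.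
have := ler_norm (s + M); have := ler_norm (s - M).
have := ler_norm (- (s + M)); have := ler_norm (- (s - M)); rewrite !normrN.
have [h|h] := leP 0 (s + M); [rewrite (ger0_norm h)|rewrite (ltr0_norm h)];
  (have [k|k] := leP 0 (s - M); [rewrite (ger0_norm k)|rewrite (ltr0_norm k)]); qlra.
Qed.

Lemma clamp_sqr M s : 0 <= M -> M <= `|s| -> clamp M s ^+ 2 = M ^+ 2.
Proof.
move=> M0; rewrite /clamp; have [s0|s0] := leP 0 s.
  rewrite (ger0_norm s0) => Ms; rewrite !ger0_norm; by [field|qlra].
rewrite (ltr0_norm s0) => Ms; rewrite !ler0_norm; by [field|qlra].
Qed.

(* The cubic [u ^+ 3 - u] on [`|u| <= M], extended affinely. *)
Definition trunc M := prim (fun s => 3 * clamp M s ^+ 2 - 1).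

Lemma c_trunc_slope M : continuous (fun s => 3 * clamp M s ^+ 2 - 1).
Proof.
rewrite /clamp; apply: c_D; last exact: c_cst.
apply: c_M; first exact: c_cst.
apply: c_X; apply: c_M; last exact: c_cst.
by apply: c_D; [|apply: c_N]; apply: c_norm; conti.
Qed.

Let slope_c := c_trunc_slope.

Lemma d_trunc M u : has_deriv (trunc M) u (3 * clamp M u ^+ 2 - 1).
Proof. exact: d_prim. Qed.

Lemma c_trunc M : continuous (trunc M).
Proof. exact: d_continuous (@d_trunc M). Qed.

Lemma truncE M u : `|u| <= M -> trunc M u = u ^+ 3 - u.
Proof.
move=> uM; rewrite /trunc prim_integ// (@integE _ _ (fun s => s ^+ 3 - s))//; first by ring.
have M0 : `|0 : R| <= M by rewrite normr0 (le_trans _ uM).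
by move=> s /(minmax_norm M0 uM) sM; deriv_to; rewrite clamp_id//; ring.
Qed.

Lemma trunc_lip M u v : 0 <= M ->
  `|trunc M u - trunc M v| <= (3 * M ^+ 2 + 1) * `|u - v|.
Proof.
move=> M0; rewrite -[leLHS]/(`|integ _ v u|); apply: integ_norm_cst => // s _.
have : clamp M s ^+ 2 <= M ^+ 2.
  by rewrite -real_normK ?num_real// lerXn2r ?nnegrE// clamp_le.
by have := sqr_ge0 (clamp M s); rewrite ler_norml; qlra.
Qed.

Lemma prim_truncE M u : `|u| <= M -> prim (trunc M) u + 4^-1 = 4^-1 * (u ^+ 2 - 1) ^+ 2.
Proof.
move=> uM; rewrite prim_integ; last exact: c_trunc.
rewrite (@integE _ _ (fun s => 4^-1 * (s ^+ 2 - 1) ^+ 2)).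
- by field.
- exact: c_trunc.
have M0 : `|0 : R| <= M by rewrite normr0 (le_trans _ uM).
by move=> s /(minmax_norm M0 uM) sM; deriv_to; rewrite truncE//; field.
Qed.

(** On [|u| <= M] the left side is [(u ^+ 2 - 1) ^+ 2 / 4]. Since [M >= 1], the truncated cubic is
    nonnegative beyond [M] and nonpositive below [- M], so outside this interval the potential only
    increases. *)
Lemma prim_trunc_ge M u : 1 <= M -> 0 <= prim (trunc M) u + 4^-1.
Proof.
move=> M1; have M0 : 0 <= M by qlra.
have slope s : M <= `|s| -> 0 <= 3 * clamp M s ^+ 2 - 1.
  by move=> /(clamp_sqr M0) ->; nra.
have base v : `|v| <= M -> 0 <= prim (trunc M) v + 4^-1.
  by move=> vM; rewrite prim_truncE// mulr_ge0 ?sqr_ge0.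
have [uM|Mu] := leP `|u| M; first exact: base.
have cM : continuous (trunc M) := @c_trunc M.
have [u0|u0] := leP 0 u.
  move: Mu; rewrite (ger0_norm u0) => Mu; have /base h : `|M| <= M by rewrite ger0_norm.
  suff : 0 <= integ (trunc M) M u by rewrite /integ; qlra.
  apply: integ_ge0 => // [|s sM]; first exact: ltW.
  have : 0 <= integ (fun s => 3 * clamp M s ^+ 2 - 1) M s.
    apply: integ_ge0 => // [|z zM]; first by qlra.
    by apply: slope; rewrite ger0_norm; qlra.
  rewrite /integ -/(trunc M) (@truncE M M) ?ger0_norm//.
  by have : 0 <= M * (M ^+ 2 - 1); [apply: mulr_ge0 => //; nra|qlra].
move: Mu; rewrite (ltr0_norm u0) => Mu; have /base h : `|- M| <= M by rewrite normrN ger0_norm.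
suff : 0 <= integ (fun s => - trunc M s) u (- M).
  by rewrite (_ : (fun s => - trunc M s) = fun s => -1 * trunc M s); [rewrite integZ// /integ;
    qlra|apply/funext => s; ring].
apply: integ_ge0 => // [|| s sM]; [by conti|by qlra|].
have : 0 <= integ (fun s => 3 * clamp M s ^+ 2 - 1) s (- M).
  apply: integ_ge0 => // [|z zM]; first by qlra.
  by apply: slope; rewrite ler0_norm; qlra.
rewrite /integ -/(trunc M) (@truncE M (- M)) ?normrN ?ger0_norm//.
by have : 0 <= M * (M ^+ 2 - 1); [apply: mulr_ge0 => //; nra|qlra].
Qed.

End truncated_cubic.

(** * Energy bound independent of the truncation *)

Section a_priori_bound.
Context {R : realType} {P P1 W0 W0p W1 W1p : R -> R}.
Hypothesis Pd : forall x, has_deriv P x (P1 x).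
Hypothesis P_gt0 : forall x, 0 < P x.
Hypothesis W0d : forall x, has_deriv W0 x (W0p x).
Hypothesis W0pc : continuous W0p.
Hypothesis W1c : continuous W1.
Implicit Types (t x K M : R).

Definition data_energy x :=
  W1 x ^+ 2 + W0p x ^+ 2 + W0 x ^+ 2 + P x / 2 * (W0 x ^+ 2 - 1) ^+ 2.

(* The energy method on the cone with base [`|x| <= K + 1]; the bound does not
   involve the truncation level [M]. *)
Lemma trunc_bound M W Wt Wx K t x : 1 <= M ->
  wave_solution (P := P) (W0 := W0) (W1 := W1) (trunc M) W Wt Wx ->
  (forall x, `|x| <= K + 1 -> `|W0 x| <= M) -> 0 <= t -> t + `|x| <= K ->
  W t x ^+ 2 <= 2 * expR (K + 1) * integ data_energy (- (K + 1)) (K + 1).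
Proof.
move=> M1 [Wtt [Wtx [Wxx [C1 C2 C3 Weq Wdata]]]] W0M t0 txK.
have Wc := C1_cont C1; have Wtc := C1_cont C2; have Wxc := C1_cont C3.
have [Wtd Wxd _ _] := C1; have [Wttd Wtxd Wttc Wtxc] := C2.
have [Wxtd Wxxd _ Wxxc] := C3.
have Pc : continuous P := d_continuous Pd; have W0c := d_continuous W0d.
have bc := @c_trunc R M; have Bd u := d_prim u bc; have Bc := d_continuous Bd.
(* The extra 1 leaves a slice of half-width at least 1 at time [t], as [sobolev] needs an interval
   of length at least 1. *)
pose K' := K + 1.
pose B s y := P y * (prim (trunc M) (W s y) + 4^-1).
(* The term [W ^+ 2] is added for the Sobolev inequality. It contributes [2 W W_t <= e] to the time
   derivative, whence the growth rate 1 and the exponential in the bound. *)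
pose e s y := Wt s y ^+ 2 + Wx s y ^+ 2 + W s y ^+ 2 + 2 * B s y.
pose et s y := 2 * Wt s y * Wtt s y + 2 * Wx s y * Wtx s y + 2 * W s y * Wt s y +
  2 * (P y * (trunc M (W s y) * Wt s y)).
pose p s y := 2 * Wt s y * Wx s y.
pose px s y := 2 * Wtx s y * Wx s y + 2 * Wt s y * Wxx s y.
have B0 s y : 0 <= B s y by apply: mulr_ge0; [exact: ltW|exact: prim_trunc_ge].
have ec : cont2 e by rewrite /cont2 /e /B; conti.
have etc : cont2 et by rewrite /cont2 /et; conti.
have pxc : cont2 px by rewrite /cont2 /px; conti.
have ed s y : has_deriv (e ^~ y) s (et s y).
  apply: has_deriv_val.
    apply: d_D; last apply: (d_M (d_cst 2 s) (d_M (d_cst (P y) s)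
      (d_D (d_comp (Bd _) (Wtd s y)) (d_cst (4^-1) s)))).
    by apply: d_D; [apply: d_D|]; apply: d_X; eauto.
  by rewrite /et /=; ring.
have pd s y : has_deriv (p s) y (px s y).
  apply: (has_deriv_val (d_M (d_M (d_cst 2 y) (Wtxd s y)) (Wxxd s y))).
  by rewrite /px /=; ring.
have pe s y : `|p s y| <= e s y.
  have := B0 s y; have := sqr_ge0 (Wt s y - Wx s y); have := sqr_ge0 (Wt s y + Wx s y).
  have := sqr_ge0 (W s y); rewrite ler_norml /p /e !expr2; qlra.
have es s y : et s y <= px s y + e s y.
  have := B0 s y; have := sqr_ge0 (Wx s y); have := sqr_ge0 (W s y - Wt s y).
  rewrite /et /px /e Weq !expr2; qlra.
pose E s := integ (e s) (s - K') (K' - s).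
have /choice[dE HdE] : forall s, exists dE, s <= K' -> has_deriv E s dE /\ dE <= E s.
  move=> s; have [sK|sK] := leP s K'; last by exists 0 => h; exfalso; qlra.
  have [dE h1 h2] := cone_energy sK ec etc pxc (cont2_l ec) ed (pd s) (pe s)
    (fun y _ => es s y).
  by exists dE.
have x0 := normr_ge0 x.
have tK : t <= K' by rewrite /K'; qlra.
have Emono : E t * expR (- t) <= E 0.
  have := @d_le2 _ (fun s => E s * expR (- s)) (fun=> 0)
    (fun s => (dE s - E s) * expR (- s)) (fun=> 0) 0 t t0.
  rewrite subrr subr_le0 oppr0 expR0 mulr1; apply.
  - move=> s /andP[s0 st]; have [|h1 h2] := HdE s; first by qlra.
    by deriv_to; ring.
  - by move=> s _; exact: d_cst.
  - move=> s /andP[s0 st]; have [|h1 h2] := HdE s; first by qlra.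
    by rewrite pmulr_lle0 ?expR_gt0//; qlra.
have E0 : E 0 = integ data_energy (- K') K'.
  rewrite /E sub0r subr0; apply: integ_eq; first exact: cont2_l.
    by rewrite /data_energy; conti.
  move=> y; rewrite minC maxC ge_min => h.
  have yK : `|y| <= K'.
    by rewrite ler_norml; move: h; rewrite /Num.min /Num.max; case: ifPn;
      rewrite -?leNgt /K' => *; qlra.
  have [h0 h1] := Wdata y; rewrite /e /B /data_energy h1 h0.
  rewrite prim_truncE ?W0M//.
  have -> : Wx 0 y = W0p y.
    have : has_deriv (W 0) y (W0p y) by rewrite (_ : W 0 = W0)//; apply/funext => z;
      have [] := Wdata z.
    by move=> h2; have [_ <-] := h2; have [_ <-] := Wxd 0 y.
  by field.
have /andP[xl xu] : - (K - t) <= x <= K - t by rewrite -ler_norml; qlra.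
have W2 : W t x ^+ 2 <= integ (fun y => 2 * W t y ^+ 2 + Wx t y ^+ 2) (t - K') (K' - t).
  apply: sobolev => //; rewrite /K'; try qlra.
  exact: cont2_l.
have W3 : integ (fun y => 2 * W t y ^+ 2 + Wx t y ^+ 2) (t - K') (K' - t) <= 2 * E t.
  rewrite /E -integZ; last exact: cont2_l.
  have h1 : continuous (W t) := cont2_l Wc; have h2 : continuous (Wx t) := cont2_l Wxc.
  have h3 : continuous (e t) := cont2_l ec.
  apply: integ_le; [by conti|by conti|by qlra|move=> y _].
  have := B0 t y; have := sqr_ge0 (Wt t y); have := sqr_ge0 (Wx t y); rewrite /e; qlra.
have Et : E t <= expR t * E 0.
  by move: Emono; rewrite expRN ler_pdivrMr ?expR_gt0// mulrC.
have E00 : 0 <= E 0.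
  apply: integ_ge0; [exact: cont2_l|by rewrite /K'; qlra|move=> y _].
  by apply: le_trans (pe _ _); exact: normr_ge0.
have eK : expR t <= expR K' by rewrite ler_expR.
have := ler_wpM2r E00 eK; rewrite -E0 /K'; qlra.
Qed.

End a_priori_bound.

(** * Global classical solutions of the cubic equation *)

Section global_existence.
Context {R : realType} {P P1 W0 W0p W0pp W1 W1p : R -> R} {Pm : R}.
Hypothesis Pd : forall x, has_deriv P x (P1 x).
Hypothesis P1c : continuous P1.
Hypothesis P_gt0 : forall x, 0 < P x.
Hypothesis P_le : forall x, P x <= Pm.
Hypothesis W0d : forall x, has_deriv W0 x (W0p x).
Hypothesis W0pd : forall x, has_deriv W0p x (W0pp x).
Hypothesis W0ppc : continuous W0pp.
Hypothesis W1d : forall x, has_deriv W1 x (W1p x).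
Hypothesis W1pc : continuous W1p.
Implicit Types (t x K M : R) (V : R -> R -> R).

Let cubic : R -> R := fun u => u ^+ 3 - u.

Let cubic_c : continuous cubic.
Proof. by rewrite /cubic; conti. Qed.

Let P_bnd x : `|P x| <= Pm.
Proof. by rewrite ger0_norm// ltW. Qed.

Local Notation mild := (mild (P := P) (W0 := W0) (W1 := W1)).

Lemma C1_reverse (f ft fx : R -> R -> R) : C1_with f ft fx ->
  C1_with (fun t x => f (- t) x) (fun t x => - ft (- t) x) (fun t x => fx (- t) x).
Proof.
move=> [fd fxd ftc fxc]; split.
- by move=> t x; apply: (has_deriv_val (d_comp (fd _ _) (d_N (d_id t)))); rewrite mulrN mulr1.
- by move=> t x; exact: fxd.
- by rewrite /cont2; conti.
- by rewrite /cont2; conti.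
Qed.

Lemma wave_reverse f W Wt Wx : wave_solution (P := P) (W0 := W0) (W1 := W1) f W Wt Wx ->
  wave_solution (P := P) (W0 := W0) (W1 := fun x => - W1 x) f
    (fun t x => W (- t) x) (fun t x => - Wt (- t) x) (fun t x => Wx (- t) x).
Proof.
move=> [Wtt [Wtx [Wxx [C1 C2 C3 Weq Wdata]]]].
exists (fun t x => Wtt (- t) x), (fun t x => - Wtx (- t) x), (fun t x => Wxx (- t) x); split.
- exact: C1_reverse.
- have := C1_comb (-1) 0 (C1_reverse C2) (C1_reverse C2).
  by move=> /C1_ext; apply => t x; ring.
- exact: C1_reverse.
- by move=> t x; exact: Weq.
- by move=> x; rewrite oppr0; have [-> ->] := Wdata x.
Qed.

Lemma local_exists K : 0 < K -> exists V M, [/\ 1 <= M, cont2 V,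
  forall t x, `|t| + `|x| <= K -> `|V t x| <= M &
  forall t x, `|t| + `|x| <= K -> V t x = mild cubic V t x].
Proof.
move=> K0; have W1c := d_continuous W1d; have W0c := d_continuous W0d.
have W0pc := d_continuous W0pd.
have [M0 M00 HM0] := cont_bounded (K + 1) W0c.
pose A := 2 * expR (K + 1) *
  integ (data_energy (P := P) (W0 := W0) (W0p := W0p) (W1 := W1)) (- (K + 1)) (K + 1).
have A0 : 0 <= A.
  rewrite mulr_ge0// ?mulr_ge0 ?expR_ge0//; apply: integ_ge0; last 2 first.
  - by qlra.
  - move=> y _; rewrite /data_energy !addr_ge0 ?sqr_ge0//.
    by apply: mulr_ge0; [rewrite divr_ge0 ?(ltW (P_gt0 _))|exact: sqr_ge0].
  - have Pc := d_continuous Pd; rewrite /data_energy; conti.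
(* [A] does not involve the truncation level, so [M] can be chosen after it. The truncated solution
   satisfies [V ^+ 2 <= A <= M ^+ 2] on the diamond, where it therefore solves the cubic equation;
   negative times follow by time reversal. *)
pose M := 1 + M0 + A; have M1 : 1 <= M by rewrite /M; qlra.
have M2 : 0 <= M by qlra.
have bL u v := trunc_lip u v M2.
have [|V Vc VE] := mild_exists Pd W0d W0pd W0ppc W1d W1pc (@c_trunc _ M) _ bL P_bnd.
  by rewrite addr_ge0 ?mulr_ge0 ?sqr_ge0.
have [Vt [Vx Vw]] := mild_regular Pd P1c W0d W0pd W0ppc W1d W1pc (@d_trunc _ M)
  (@c_trunc_slope _ M) Vc VE.
have W0M y : `|y| <= K + 1 -> `|W0 y| <= M.
  by move=> /HM0; rewrite /M; qlra.
have V2 t x : `|t| + `|x| <= K -> V t x ^+ 2 <= A.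
  have [t0|t0] := leP 0 t.
    rewrite (ger0_norm t0) => txK; exact: (trunc_bound Pd P_gt0 W0d W0pc W1c M1 Vw W0M t0 txK).
  rewrite (ltr0_norm t0) => txK; have t1 : 0 <= - t by qlra.
  have W1Nc : continuous (fun x => - W1 x) by conti.
  have := trunc_bound Pd P_gt0 W0d W0pc W1Nc M1 (wave_reverse Vw) W0M t1 txK.
  rewrite opprK /A /data_energy; congr (_ <= _ * integ _ _ _).
  by apply/funext => y; rewrite sqrrN.
have VM t x : `|t| + `|x| <= K -> `|V t x| <= M.
  move=> /V2 h; rewrite -ler_sqr ?nnegrE// real_normK ?num_real//.
  apply: le_trans h _; have : 0 <= (M - 1) * M by rewrite mulr_ge0// subr_ge0.
  by rewrite expr2 /M; qlra.
exists V, M; split => // t x txK; rewrite {1}VE.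
apply: (mild_domain Pd (@c_trunc _ M) cubic_c Vc Vc _ txK) => s y /VM.
exact: truncE.
Qed.

(** Below the common level [M + M'] both functions solve the same truncated equation, which is
    globally Lipschitz. *)
Lemma local_unique K V V' M M' : 0 < K -> 1 <= M -> 1 <= M' -> cont2 V -> cont2 V' ->
  (forall t x, `|t| + `|x| <= K -> `|V t x| <= M) ->
  (forall t x, `|t| + `|x| <= K -> V t x = mild cubic V t x) ->
  (forall t x, `|t| + `|x| <= K -> `|V' t x| <= M') ->
  (forall t x, `|t| + `|x| <= K -> V' t x = mild cubic V' t x) ->
  forall t x, `|t| + `|x| <= K -> V t x = V' t x.
Proof.
move=> K0 M1 M1' Vc Vc' VM VE VM' VE'; pose L := M + M'.
have L0 : 0 <= L by rewrite /L; qlra.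
have bL u v := trunc_lip u v L0.
have tr (U : R -> R -> R) N : cont2 U -> N <= L ->
  (forall t x, `|t| + `|x| <= K -> `|U t x| <= N) ->
    (forall t x, `|t| + `|x| <= K -> U t x = mild cubic U t x) ->
    forall t x, `|t| + `|x| <= K -> U t x = mild (trunc L) U t x.
  move=> Uc NL UN UE t x txK; rewrite {1}UE//.
  apply: (mild_domain Pd cubic_c (@c_trunc _ L) Uc Uc _ txK) => s y /UN h.
  by rewrite truncE// (le_trans h).
have LM : M <= L by rewrite /L; qlra.
have LM' : M' <= L by rewrite /L; qlra.
have L3 : 0 <= 3 * L ^+ 2 + 1 by rewrite addr_ge0 ?mulr_ge0 ?sqr_ge0.
have E := tr _ _ Vc LM VM VE; have E' := tr _ _ Vc' LM' VM' VE'.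
exact: (mild_unique Pd (@c_trunc _ L) L3 bL P_bnd K0 Vc Vc' E E').
Qed.

Lemma wave_exists : exists W Wt Wx,
  wave_solution (P := P) (W0 := W0) (W1 := W1) cubic W Wt Wx.
Proof.
have /choice[V HV] : forall K, exists V, 0 < K -> exists M, [/\ 1 <= M, cont2 V,
    forall t x, `|t| + `|x| <= K -> `|V t x| <= M &
    forall t x, `|t| + `|x| <= K -> V t x = mild cubic V t x].
  move=> K; have [/local_exists[V [M VM]]|K0] := ltP 0 K; first by exists V; exists M.
  by exists (fun _ _ => 0) => h; exfalso; qlra.
have agree K K' t x : 0 < K -> K <= K' -> `|t| + `|x| <= K -> V K t x = V K' t x.
  move=> K0 KK'; have K0' : 0 < K' by qlra.
  have [M [M1 Vc VM VE]] := HV _ K0; have [M' [M1' Vc' VM' VE']] := HV _ K0'.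
  apply: (local_unique K0 M1 M1' Vc Vc' VM VE) => s y sy; [apply: VM'|apply: VE']; qlra.
(* The solutions on nested diamonds agree, so each point may take its value from any diamond
   containing it. *)
pose k t x := `|t| + `|x| + 1; pose W t x := V (k t x) t x.
have k0 t x : 0 < k t x by have := normr_ge0 t; have := normr_ge0 x; rewrite /k; qlra.
have WE K t x : 0 < K -> `|t| + `|x| <= K -> W t x = V K t x.
  move=> K0 txK; have [h|/ltW h] := leP (k t x) K.
    by apply: agree => //; rewrite /k; qlra.
  by apply/esym/agree.
have Wc : cont2 W.
  apply/cont2P => a b e e0; have K0 := k0 a b.
  pose K := k a b + 1; have K1 : 0 < K by rewrite /K; qlra.
  have [M [_ Vc _ _]] := HV _ K1.
  have [d d0 Hd] := (cont2P _).1 Vc a b e e0.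
  exists (Num.min d 2^-1); first by rewrite lt_min d0 invr_gt0 ltr0n.
  move=> a' b'; rewrite !lt_min => /andP[ad a1] /andP[bd b1].
  rewrite !(WE K)//; first exact: Hd.
    have := ler_normB a (a - a'); have := ler_normB b (b - b').
    by rewrite !opprB !(addrC _ (_ - _)) !subrK /K /k; qlra.
  by rewrite /K /k; qlra.
have Wm t x : W t x = mild cubic W t x.
  have K0 := k0 t x; have [M [_ Vc _ VE]] := HV _ K0.
  have txk : `|t| + `|x| <= k t x by rewrite /k; qlra.
  rewrite {1}(WE (k t x))// VE//.
  apply: (mild_domain Pd cubic_c cubic_c Vc Wc _ txk) => s y sy.
  by rewrite (WE (k t x)).
exists W.
apply: (mild_regular Pd P1c W0d W0pd W0ppc W1d W1pc (f := cubic)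
  (f1 := fun u => 3 * u ^+ 2 - 1)) => //.
  by move=> u; rewrite /cubic; deriv_to; ring.
by conti.
Qed.

End global_existence.

(** * The growing mode *)

Section growing_mode.
Context {R : realType} {P P1 Ws Ws1 phi phi1 : R -> R} {mu M Phi Pm : R}.
Hypothesis Pd : forall x, has_deriv P x (P1 x).
Hypothesis P_gt0 : forall x, 0 < P x.
Hypothesis P_le : forall x, P x <= Pm.
Hypothesis Wsd : forall x, has_deriv Ws x (Ws1 x).
Hypothesis Ws1d : forall x, has_deriv Ws1 x (P x * Ws x * (Ws x ^+ 2 - 1)).
Hypothesis Ws_le : forall x, `|Ws x| <= 1.
Hypothesis mu_gt0 : 0 < mu.
Hypothesis phid : forall x, has_deriv phi x (phi1 x).
Hypothesis phi1d : forall x, has_deriv phi1 x (((3 * Ws x ^+ 2 - 1) * P x + mu) * phi x).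
Hypothesis phi_bnd : forall x, 0 < phi x <= M.
Hypothesis phi1_bnd : forall x, `|phi1 x| <= M * phi x.
Hypothesis phi_int : forall a b, a <= b ->
  integ (fun x => phi x ^+ 2 + phi1 x ^+ 2) a b <= Phi.
Implicit Types (t x s y T K eps ys : R).

Let lam := Num.sqrt mu.

Let lam_gt0 : 0 < lam. Proof. by rewrite sqrtr_gt0. Qed.
Let lam2 : lam ^+ 2 = mu. Proof. by rewrite sqr_sqrtr// ltW. Qed.

Let w x := phi1 x / phi x.

Let phi_neq0 x : phi x != 0. Proof. by rewrite gt_eqF//; case/andP: (phi_bnd x). Qed.

Let wd x : has_deriv w x ((3 * Ws x ^+ 2 - 1) * P x + mu - w x ^+ 2).
Proof.
apply: (has_deriv_val (d_M (phi1d x) (d_V (phi_neq0 x) (phid x)))).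
by rewrite /w; field; exact: phi_neq0.
Qed.

Let w_le x : `|w x| <= M.
Proof.
have /andP[p0 _] := phi_bnd x.
by rewrite /w normrM normfV (gtr0_norm p0) ler_pdivrMr.
Qed.

(** With [gx = h + w g] and [|w| <= M], [2 g^2 + gx^2 <= 2 h^2 + (2 + 2 M^2) g^2], while [h^2 <= e]
    and [g^2 <= e / mu]. *)
Definition sobolev_const := 2 + (2 + 2 * M ^+ 2) / mu.

Lemma sobolev_const_ge0 : 0 <= sobolev_const.
Proof.
have M2 := sqr_ge0 M; have m0 := mu_gt0.
have : 0 <= (2 + 2 * M ^+ 2) / mu by apply: divr_ge0; qlra.
by rewrite /sobolev_const; qlra.
Qed.

(** [128 = 16 * 8]: the factor [3 v + u] is at most 4 in size, and [u^4 <= 8 ((a y)^4 + z^4)]. The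
    bounds on [y] and [z] then lower the quartics to squares, which can be integrated against [Phi]
    and the energy. *)
Lemma source_pointwise p v u a y z C : 0 < p -> p <= Pm -> `|v| <= 1 ->
  u = a * y + z -> 0 < y <= M -> u ^+ 2 <= 1 -> z ^+ 2 <= C ->
  (p * (3 * v * u ^+ 2 + u ^+ 3)) ^+ 2 <=
  128 * Pm ^+ 2 * (a ^+ 4 * M ^+ 2 * y ^+ 2 + C * z ^+ 2).
Proof.
move=> p0 pPm v1 uE /andP[y0 yM] u1 zC.
have u1' : `|u| <= 1.
  by rewrite -(@expr_le1 _ 2)// real_normK ?num_real.
have h1 : (3 * v + u) ^+ 2 <= 16.
  move: v1 u1'; rewrite !ler_norml => v1 u1'.
  have := mulr_ge0 (_ : 0 <= 4 - (3 * v + u)) (_ : 0 <= 4 + (3 * v + u)).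
  by move=> /(_ ltac:(qlra) ltac:(qlra)); rewrite expr2; qlra.
have h2 : p ^+ 2 <= Pm ^+ 2 by rewrite lerXn2r ?nnegrE// ltW// (lt_le_trans p0).
have h3 : (u ^+ 2) ^+ 2 <= 8 * (a ^+ 4 * M ^+ 2 * y ^+ 2 + C * z ^+ 2).
  have k1 : u ^+ 2 <= 2 * (a * y) ^+ 2 + 2 * z ^+ 2.
    by have := sqr_ge0 (a * y - z); rewrite uE sqrrB sqrrD; qlra.
  have k2 : (u ^+ 2) ^+ 2 <= (2 * (a * y) ^+ 2 + 2 * z ^+ 2) ^+ 2.
    by rewrite lerXn2r ?nnegrE ?sqr_ge0// (le_trans _ k1) ?sqr_ge0.
  have k3 := sqr_ge0 ((a * y) ^+ 2 - z ^+ 2).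
  have k4 : ((a * y) ^+ 2) ^+ 2 <= a ^+ 4 * M ^+ 2 * y ^+ 2.
    have -> : ((a * y) ^+ 2) ^+ 2 = a ^+ 4 * y ^+ 2 * y ^+ 2 by ring.
    rewrite ler_wpM2r ?sqr_ge0// ler_wpM2l ?exprn_even_ge0//.
    by rewrite lerXn2r ?nnegrE// ltW// (lt_le_trans y0).
  have k5 := ler_wpM2r (sqr_ge0 z) zC.
  apply: le_trans k2 _; move: k3 k4 k5.
  by move: ((a * y) ^+ 2) (z ^+ 2) => b c; rewrite !expr2; qlra.
have -> : (p * (3 * v * u ^+ 2 + u ^+ 3)) ^+ 2 = p ^+ 2 * ((3 * v + u) ^+ 2 * (u ^+ 2) ^+ 2).
  by ring.
have -> : 128 * Pm ^+ 2 * (a ^+ 4 * M ^+ 2 * y ^+ 2 + C * z ^+ 2) =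
  Pm ^+ 2 * (16 * (8 * (a ^+ 4 * M ^+ 2 * y ^+ 2 + C * z ^+ 2))) by ring.
apply: ler_pM => //; [exact: sqr_ge0|by apply: mulr_ge0; exact: sqr_ge0|].
by apply: ler_pM => //; exact: sqr_ge0.
Qed.

Section solution.
Variables (W Wt Wx : R -> R -> R) (eps : R).
Hypothesis Wsol : wave_solution (P := P) (W0 := fun x => Ws x + eps * phi x)
  (W1 := fun x => eps * lam * phi x) (fun u => u ^+ 3 - u) W Wt Wx.

Let th t := eps * expR (lam * t).
Let g t x := W t x - (Ws x + th t * phi x).
Let gt t x := Wt t x - lam * th t * phi x.
Let gx t x := Wx t x - (Ws1 x + th t * phi1 x).
Let h t x := gx t x - w x * g t x.
Let f t x := th t * phi x + g t x.
(** What remains of the cubic after its value and its linear part at [Ws] are removed, with [f] the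
    whole perturbation. *)
Let Nl t x := P x * (3 * Ws x * f t x ^+ 2 + f t x ^+ 3).

(* With [w = phi1 / phi] the quadratic form of the linearized operator becomes
   the square of [h] plus [mu * g ^+ 2], since [w' = V + mu - w ^+ 2]. *)
Let e t x := gt t x ^+ 2 + h t x ^+ 2 + mu * g t x ^+ 2.

Let thd t : has_deriv th t (lam * th t).
Proof. by rewrite /th; deriv_to; ring. Qed.

Let C1 : exists Wtt Wtx Wxx, [/\ C1_with W Wt Wx, C1_with Wt Wtt Wtx & C1_with Wx Wtx Wxx].
Proof. by have [Wtt [Wtx [Wxx [C1 C2 C3 _ _]]]] := Wsol; exists Wtt, Wtx, Wxx. Qed.

Let gc : cont2 g.
Proof.
have [? [? [? [/C1_cont Wc _ _]]]] := C1.
have Wsc := d_continuous Wsd; have phic := d_continuous phid.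
by have thc := d_continuous thd; rewrite /cont2 /g; conti.
Qed.

Let gtc : cont2 gt.
Proof.
have [? [? [? [_ /C1_cont Wtc _]]]] := C1; have phic := d_continuous phid.
by have thc := d_continuous thd; rewrite /cont2 /gt; conti.
Qed.

Let gxc : cont2 gx.
Proof.
have [? [? [? [_ _ /C1_cont Wxc]]]] := C1.
have Ws1c := d_continuous Ws1d; have phi1c := d_continuous phi1d.
by have thc := d_continuous thd; rewrite /cont2 /gx; conti.
Qed.

Let hc : cont2 h.
Proof. by have wc := d_continuous wd; rewrite /cont2 /h; conti. Qed.

Let fc : cont2 f.
Proof.
have phic := d_continuous phid.
by have thc := d_continuous thd; rewrite /cont2 /f; conti.
Qed.

Let ec : cont2 e.
Proof. by rewrite /cont2 /e; conti. Qed.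

Let Nc : cont2 Nl.
Proof.
have Pc := d_continuous Pd; have Wsc := d_continuous Wsd.
by rewrite /cont2 /Nl; conti.
Qed.

Let gxd s x : has_deriv (g s) x (gx s x).
Proof.
have [? [? [? [[_ Wxd _ _] _ _]]]] := C1.
by rewrite /g /gx; deriv_to; ring.
Qed.

Lemma remainder_energy : (forall x, e 0 x = 0) /\
  forall K t, t <= K -> exists2 dE, has_deriv (fun r => integ (e r) (r - K) (K - r)) t dE &
    dE <= integ (fun x => 3 * lam * e t x + lam^-1 * Nl t x ^+ 2) (t - K) (K - t).
Proof.
have [Wtt [Wtx [Wxx [C1' C2 C3 Weq Wdata]]]] := Wsol.
have Wc := C1_cont C1'; have Wtc := C1_cont C2; have Wxc := C1_cont C3.
have [Wtd Wxd _ _] := C1'; have [Wttd Wtxd Wttc Wtxc] := C2.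
have [Wxtd Wxxd _ Wxxc] := C3.
have Pc := d_continuous Pd; have Wsc := d_continuous Wsd; have Ws1c := d_continuous Ws1d.
have phic := d_continuous phid; have phi1c := d_continuous phi1d.
have wc := d_continuous wd; have thc := d_continuous thd.
have gc' := gc; have gtc' := gtc; have gxc' := gxc; have hc' := hc.
pose gtt t x := Wtt t x - mu * th t * phi x.
pose gtx t x := Wtx t x - lam * th t * phi1 x.
pose gxx t x := Wxx t x - (P x * Ws x * (Ws x ^+ 2 - 1) +
  th t * (((3 * Ws x ^+ 2 - 1) * P x + mu) * phi x)).
have gttc : cont2 gtt by rewrite /cont2 /gtt; conti.
have gtxc : cont2 gtx by rewrite /cont2 /gtx; conti.
have gxxc : cont2 gxx by rewrite /cont2 /gxx; conti.
have gd s x : has_deriv (g ^~ x) s (gt s x).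
  by rewrite /g /gt; deriv_to; ring.
have gtd s x : has_deriv (gt ^~ x) s (gtt s x).
  by rewrite /gt /gtt -lam2; deriv_to; ring.
have gxtd s x : has_deriv (gx ^~ x) s (gtx s x).
  by rewrite /gx /gtx; deriv_to; ring.
have gxd' := gxd.
have gtxd s x : has_deriv (gt s) x (gtx s x).
  by rewrite /gt /gtx; deriv_to; ring.
have gxxd s x : has_deriv (gx s) x (gxx s x).
  by rewrite /gx /gxx; deriv_to; ring.
have geq s x : gtt s x = gxx s x - (3 * Ws x ^+ 2 - 1) * P x * g s x - Nl s x.
  by rewrite /gtt /gxx Weq /Nl /f /g; ring.
pose ht s x := gtx s x - w x * gt s x.
pose hx s x := gxx s x - (((3 * Ws x ^+ 2 - 1) * P x + mu - w x ^+ 2) * g s x + w x * gx s x).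
have hd s x : has_deriv (h ^~ x) s (ht s x).
  by rewrite /h /ht; deriv_to; ring.
have hxd s x : has_deriv (h s) x (hx s x).
  by rewrite /h /hx; deriv_to; ring.
pose et s x := 2 * gt s x * gtt s x + 2 * h s x * ht s x + 2 * mu * g s x * gt s x.
pose p s x := 2 * gt s x * h s x.
pose px s x := 2 * gtx s x * h s x + 2 * gt s x * hx s x.
have htc : cont2 ht by rewrite /cont2 /ht; conti.
have hxc : cont2 hx by rewrite /cont2 /hx; conti.
have etc : cont2 et by rewrite /cont2 /et; conti.
have pxc : cont2 px by rewrite /cont2 /px; conti.
have ed s x : has_deriv (e ^~ x) s (et s x).
  by rewrite /e /et; deriv_to; ring.
have pd s x : has_deriv (p s) x (px s x).
  by rewrite /p /px; deriv_to; ring.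
have pe s x : `|p s x| <= e s x.
  have := mulr_ge0 (ltW mu_gt0) (sqr_ge0 (g s x)).
  have := sqr_ge0 (gt s x - h s x); have := sqr_ge0 (gt s x + h s x).
  by rewrite ler_norml /p /e; move: (gt s x) (h s x) (g s x) => a b c; rewrite !expr2; qlra.
(* Besides the flux two terms remain: [4 mu g g_t <= 2 lam (mu g^2 + g_t^2)], and
   [- 2 g_t Nl <= lam g_t^2 + Nl^2 / lam]. Together they give the rate [3 lam]. *)
have es s x : et s x <= px s x + (3 * lam * e s x + lam^-1 * Nl s x ^+ 2).
  have -> : et s x = px s x + (4 * mu * g s x * gt s x - 2 * gt s x * Nl s x).
    by rewrite /et /px geq /ht /hx /h; ring.
  have := mulr_ge0 (ltW lam_gt0) (sqr_ge0 (h s x)).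
  have := mulr_ge0 (ltW lam_gt0) (mulr_ge0 (ltW mu_gt0) (sqr_ge0 (g s x))).
  have := mulr_ge0 (ltW lam_gt0) (sqr_ge0 (lam * g s x - gt s x)).
  have l1 : 0 <= lam^-1 by rewrite invr_ge0 ltW.
  have := mulr_ge0 l1 (sqr_ge0 (lam * gt s x + Nl s x)).
  have -> : lam^-1 * (lam * gt s x + Nl s x) ^+ 2 =
      lam * gt s x ^+ 2 + 2 * gt s x * Nl s x + lam^-1 * Nl s x ^+ 2.
    by field; exact: lt0r_neq0.
  have -> : lam * (lam * g s x - gt s x) ^+ 2 =
      lam * (mu * g s x ^+ 2) + lam * gt s x ^+ 2 - 2 * mu * g s x * gt s x.
    by rewrite -lam2; ring.
  by rewrite /e; qlra.
split => //.
  move=> x; have [h0 h1] := Wdata x.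
  have g0 y : g 0 y = 0.
    by have [h2 _] := Wdata y; rewrite /g h2 /th mulr0 expR0; ring.
  have gt0 : gt 0 x = 0 by rewrite /gt h1 /th mulr0 expR0; ring.
  have gx0 : gx 0 x = 0.
    have [_ <-] := gxd 0 x; rewrite (_ : g 0 = cst 0) ?derive_cst//.
    by apply/funext => y; exact: g0.
  by rewrite /e /h gt0 gx0 g0; ring.
move=> K t tK; apply: (cone_energy (s := fun t x => 3 * lam * e t x + lam^-1 * Nl t x ^+ 2)
  tK ec etc pxc _ ed (pd t) (pe t)).
  have := cont2_l (t := t) ec; have := cont2_l (t := t) Nc => h1 h2; conti.
by move=> x _; exact: es.
Qed.

Let g_le t x : g t x ^+ 2 <= mu^-1 * e t x.
Proof.
rewrite ler_pdivlMl// /e.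
by have := sqr_ge0 (gt t x); have := sqr_ge0 (h t x); qlra.
Qed.

Let sobolev_density t x :
  2 * g t x ^+ 2 + gx t x ^+ 2 <= sobolev_const * e t x.
Proof.
have [k1 k2 k3] := And3 (sqr_ge0 (gt t x)) (sqr_ge0 (h t x)) (sqr_ge0 (g t x)).
have w2 : w x ^+ 2 <= M ^+ 2.
  by rewrite -real_normK ?num_real// lerXn2r ?nnegrE ?w_le// (le_trans _ (w_le x)).
have -> : gx t x = h t x + w x * g t x by rewrite /h; ring.
have k4 := sqr_ge0 (h t x - w x * g t x).
have k5 := ler_wpM2r k3 w2.
have k6 : (2 + 2 * M ^+ 2) * g t x ^+ 2 <= (2 + 2 * M ^+ 2) / mu * e t x.
  by rewrite -mulrA; apply: ler_wpM2l (g_le t x); have := sqr_ge0 M; qlra.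
have k7 : h t x ^+ 2 <= e t x.
  by have := mulr_ge0 (ltW mu_gt0) k3; rewrite /e; qlra.
have k8 : 0 <= e t x by apply: le_trans k7.
rewrite /sobolev_const mulrDl; move: k4 k5 k6 k7 k8.
by move: (e t x) (h t x) (g t x) (w x) => E a b c; rewrite !expr2; qlra.
Qed.

(** The barrier is [ys * th^4], of growth rate [4 lam]. At a contact the energy grows at rate
    [3 lam] plus [Nl^2 / lam]; the second smallness condition keeps the latter strictly below the
    missing [lam * ys * th^4]. The first condition gives [|f| <= 1]. With [K = T + 1] the slice at
    time [T] is [[-1, 1]], and earlier ones are longer. *)
Lemma remainder_small T ys : 0 < eps -> 0 <= T -> 0 < ys ->
  2 * th T ^+ 2 * M ^+ 2 + 2 * sobolev_const * ys * th T ^+ 4 <= 1 ->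
  128 * Pm ^+ 2 * (M ^+ 2 * Phi + sobolev_const * ys ^+ 2 * th T ^+ 4 / mu) < mu * ys ->
  integ (e T) (- 1) 1 < ys * th T ^+ 4.
Proof.
move=> eps0 T0 ys0 c1 c2; pose K := T + 1.
have [e0 He] := remainder_energy.
have /choice[dE HdE] : forall t, exists dE, t <= K ->
    has_deriv (fun r => integ (e r) (r - K) (K - r)) t dE /\
    dE <= integ (fun x => 3 * lam * e t x + lam^-1 * Nl t x ^+ 2) (t - K) (K - t).
  move=> t; have [tK|tK] := leP t K; last by exists 0 => tK'; exfalso; qlra.
  by have [dE h1 h2] := He K t tK; exists dE.
have th0 t : 0 < th t by rewrite mulr_gt0 ?expR_gt0.
have thT t : t <= T -> th t <= th T.
  by move=> tT; rewrite ler_pM2l// ler_expR ler_pM2l.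
have C0 := sobolev_const_ge0.
suff H : integ (e T) (T - K) (K - T) - ys * th T ^+ 4 < 0.
  move: H; rewrite (_ : T - K = -1); last by rewrite /K; ring.
  by rewrite (_ : K - T = 1) ?subr_lt0// /K; ring.
apply: (@barrier _ (fun t => integ (e t) (t - K) (K - t) - ys * th t ^+ 4)
  (fun t => dE t - ys * (4 * th t ^+ 3 * (lam * th t))) T); last by rewrite T0 lexx.
- move=> t /andP[t0 tT]; have [|h1 _] := HdE t; first by rewrite /K; qlra.
  by have thd' := thd; deriv_to; ring.
- have c0 : continuous (e 0) := cont2_l ec.
  rewrite (@integE _ (e 0) (fun=> 0))//; last by move=> x _; rewrite e0; exact: d_cst.
  by rewrite subrr sub0r oppr_lt0 mulr_gt0 ?exprn_gt0.
move=> t /andP[t0 tT] /eqP; rewrite subr_eq0 => /eqP Et.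
have [|_ dEle] := HdE t; first by rewrite /K; qlra.
have slice : t - K <= K - t by rewrite /K; qlra.
set a := t - K in slice Et dEle; set b := K - t in slice Et dEle.
have ab : a + 1 <= b by rewrite /a /b /K; qlra.
have etc : continuous (e t) := cont2_l ec; have gtc' : continuous (g t) := cont2_l gc.
have gxtc : continuous (gx t) := cont2_l gxc; have Ntc : continuous (Nl t) := cont2_l Nc.
have phic := d_continuous phid; have phi1c := d_continuous phi1d.
pose Cg := sobolev_const * (ys * th t ^+ 4).
have g2 x : a <= x <= b -> g t x ^+ 2 <= Cg.
  move=> xab; apply: le_trans (sobolev (gxd t) gxtc ab xab) _.
  rewrite /Cg -Et -integZ//; apply: integ_le; [by conti|by conti|exact: slice|].
  by move=> y _; exact: sobolev_density.
have f2 x : a <= x <= b -> f t x ^+ 2 <= 1.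
  move=> /g2 g2x; apply: le_trans c1; rewrite /f.
  have /andP[p0 pM] := phi_bnd x.
  have h2 : (th t * phi x) ^+ 2 <= th T ^+ 2 * M ^+ 2.
    have t1 := thT t tT; have t2 := th0 t.
    by rewrite exprMn; apply: ler_pM; try exact: sqr_ge0; rewrite lerXn2r ?nnegrE; qlra.
  have h3 : Cg <= sobolev_const * (ys * th T ^+ 4).
    by rewrite /Cg !ler_wpM2l ?(ltW ys0)// lerXn2r ?nnegrE ?thT// ltW.
  have := sqr_ge0 (th t * phi x - g t x).
  move: h2 h3 g2x; move: {g2} Cg (th t * phi x) (g t x) => C u v.
  by rewrite !expr2; qlra.
pose c := 128 * Pm ^+ 2.
have c_ge0 : 0 <= c by rewrite mulr_ge0 ?sqr_ge0.
have t4 : 0 < th t ^+ 4 by rewrite exprn_gt0.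
have Cg0 : 0 <= Cg := mulr_ge0 C0 (mulr_ge0 (ltW ys0) (ltW t4)).
have tM0 : 0 <= th t ^+ 4 * M ^+ 2 := mulr_ge0 (ltW t4) (sqr_ge0 M).
have Nle : integ (fun x => Nl t x ^+ 2) a b <= c * (th t ^+ 4 * M ^+ 2 * Phi + Cg / mu *
  (ys * th t ^+ 4)).
  have Nle x : a <= x <= b -> Nl t x ^+ 2 <=
      c * (th t ^+ 4 * M ^+ 2) * (phi x ^+ 2 + phi1 x ^+ 2) + c * (Cg / mu) * e t x.
    move=> xab; apply: le_trans (source_pointwise (P_gt0 x) (P_le x) (Ws_le x)
      (erefl : f t x = _) (phi_bnd x) (f2 x xab) (g2 x xab)) _.
    rewrite -/c (_ : _ + c * (Cg / mu) * _ = c * (th t ^+ 4 * M ^+ 2 *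
      (phi x ^+ 2 + phi1 x ^+ 2) + Cg * (mu^-1 * e t x))); last by ring.
    apply: ler_wpM2l => //.
    have h1 := mulr_ge0 tM0 (sqr_ge0 (phi1 x)).
    have h2 := ler_wpM2l Cg0 (g_le t x).
    by rewrite mulrDr -addrA; apply: lerD => //; qlra.
  apply: (le_trans (integ_le _ _ slice Nle)); [by conti|by conti|].
  rewrite integD; [|by conti|by conti].
  rewrite integZ; last by conti.
  rewrite integZ// Et.
  by have := ler_wpM2l (mulr_ge0 c_ge0 tM0) (phi_int slice); qlra.
have c3 : c * (th t ^+ 4 * M ^+ 2 * Phi + Cg / mu * (ys * th t ^+ 4)) < mu * ys * th t ^+ 4.
  have h1 : c * (M ^+ 2 * Phi + sobolev_const * ys ^+ 2 * th t ^+ 4 / mu) < mu * ys.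
    apply: le_lt_trans c2; rewrite -/c ler_wpM2l// lerD2l.
    rewrite ler_pM2r ?invr_gt0//; apply: ler_wpM2l.
      by apply: mulr_ge0 => //; exact: sqr_ge0.
    by rewrite lerXn2r ?nnegrE ?thT// ltW.
  rewrite -(ltr_pM2r t4) in h1; apply: le_lt_trans h1.
  by rewrite /Cg le_eqVlt; apply/orP; left; apply/eqP; ring.
rewrite subr_lt0; apply: le_lt_trans dEle _.
rewrite integD; [|by conti|by conti].
rewrite integZ// integZ; last by conti.
rewrite Et.
have := le_lt_trans Nle c3; rewrite -(ltr_pM2l (_ : 0 < lam^-1)) ?invr_gt0// => h4.
have h5 : lam^-1 * (mu * ys * th t ^+ 4) = lam * ys * th t ^+ 4.
  by rewrite -lam2; field; exact: lt0r_neq0.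
rewrite h5 in h4; have : ys * (4 * th t ^+ 3 * (lam * th t)) = 4 * (lam * ys * th t ^+ 4).
  by ring.
by qlra.
Qed.

End solution.

End growing_mode.

Section instability.
Context {R : realType} {P P1 Ws Ws1 phi phi1 : R -> R} {mu M Phi Pm : R}.
Hypothesis Pd : forall x, has_deriv P x (P1 x).
Hypothesis P_gt0 : forall x, 0 < P x.
Hypothesis P_le : forall x, P x <= Pm.
Hypothesis Wsd : forall x, has_deriv Ws x (Ws1 x).
Hypothesis Ws1d : forall x, has_deriv Ws1 x (P x * Ws x * (Ws x ^+ 2 - 1)).
Hypothesis Ws_le : forall x, `|Ws x| <= 1.
Hypothesis mu_gt0 : 0 < mu.
Hypothesis phid : forall x, has_deriv phi x (phi1 x).
Hypothesis phi1d : forall x, has_deriv phi1 x (((3 * Ws x ^+ 2 - 1) * P x + mu) * phi x).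
Hypothesis phi_bnd : forall x, 0 < phi x <= M.
Hypothesis phi1_bnd : forall x, `|phi1 x| <= M * phi x.
Hypothesis phi_int : forall a b, a <= b ->
  integ (fun x => phi x ^+ 2 + phi1 x ^+ 2) a b <= Phi.

(* The data are chosen so that the growing mode [eps * expR (lam * t) * phi]
   has amplitude [th0] exactly at time [T]. *)
Lemma growing_mode_unstable : exists th0 c : R, [/\ 0 < th0, 0 < c &
  forall (T : R) (W Wt Wx : R -> R -> R), 0 <= T ->
  wave_solution (P := P) (W0 := fun x => Ws x + th0 * expR (- (Num.sqrt mu * T)) * phi x)
    (W1 := fun x => th0 * expR (- (Num.sqrt mu * T)) * Num.sqrt mu * phi x)
    (fun u => u ^+ 3 - u) W Wt Wx ->
  c <= integ (fun x => Wt T x ^+ 2) (- 1) 1].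
Proof.
have m0 := mu_gt0; pose lam := Num.sqrt mu.
have lam2 : lam ^+ 2 = mu by rewrite sqr_sqrtr// ltW.
have phic := d_continuous phid.
have phi2c : continuous (fun x => phi x ^+ 2) by conti.
pose Phi1 := integ (fun x => phi x ^+ 2) (-1) 1.
have Phi1_gt0 : 0 < Phi1.
  apply: (integ_gt0 (c := 0) phi2c); [by qlra|by qlra| |by move=> x _; exact: sqr_ge0].
  by rewrite exprn_gt0//; case/andP: (phi_bnd 0).
pose A := `|128 * Pm ^+ 2 * (M ^+ 2 * Phi)|.
have A0 : 0 <= A by exact: normr_ge0.
(* Then [mu * ys] exceeds the part of the source due to the mode by 1, room for the part due to the
   remainder. *)
pose ys := (A + 1) / mu.
have ys0 : 0 < ys by rewrite divr_gt0//; qlra.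
pose C := sobolev_const (mu := mu) (M := M).
have C0 : 0 <= C by exact: sobolev_const_ge0.
have a1 : 0 <= 2 * M ^+ 2 by have := sqr_ge0 M; qlra.
have a2 : 0 <= 2 * C * ys by have := mulr_ge0 C0 (ltW ys0); qlra.
pose A3 := 128 * Pm ^+ 2 * (C * ys ^+ 2 / mu).
have a3 : 0 <= A3.
  have := mulr_ge0 (sqr_ge0 Pm) (divr_ge0 (mulr_ge0 C0 (sqr_ge0 ys)) (ltW m0)).
  by rewrite /A3; qlra.
pose A4 := 4 * ys / (mu * Phi1).
have mP : 0 < mu * Phi1 by exact: mulr_gt0.
have a4 : 0 <= A4 by apply: divr_ge0; qlra.
(* With [th0 ^+ 2 = 1 / D] the products of [th0 ^+ 2] with the summands add up to 1, so all
   smallness conditions hold at once. The summand 2 gives [th0 < 1] and the strict inequality in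
   [c2]. *)
pose D := 2 * M ^+ 2 + 2 * C * ys + A3 + A4 + 2.
have D0 : 2 <= D by rewrite /D; qlra.
pose th0 := Num.sqrt D^-1.
have th2 : th0 ^+ 2 = D^-1 by rewrite sqr_sqrtr// invr_ge0; qlra.
have th0_gt0 : 0 < th0 by rewrite sqrtr_gt0 invr_gt0; qlra.
have thD : th0 ^+ 2 * D = 1 by rewrite th2 mulVf//; apply: lt0r_neq0; qlra.
have t2 : 0 < th0 ^+ 2 by rewrite exprn_gt0.
have t4 : th0 ^+ 4 <= th0 ^+ 2.
  have -> : th0 ^+ 4 = th0 ^+ 2 * th0 ^+ 2 by ring.
  by rewrite ler_piMr ?ltW// th2 invf_lt1; qlra.
have t4_ge0 : 0 <= th0 ^+ 4 by rewrite exprn_ge0// ltW.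
have k1 := mulr_ge0 (ltW t2) a1; have k2 := mulr_ge0 (ltW t2) a2.
have k3 := mulr_ge0 (ltW t2) a3; have k4 := mulr_ge0 (ltW t2) a4.
have thE : th0 ^+ 2 * (2 * M ^+ 2) + th0 ^+ 2 * (2 * C * ys) + th0 ^+ 2 * A3 +
  th0 ^+ 2 * A4 + th0 ^+ 2 * 2 = 1 by rewrite -[RHS]thD /D; ring.
have c1 : 2 * th0 ^+ 2 * M ^+ 2 + 2 * C * ys * th0 ^+ 4 <= 1.
  by have := ler_wpM2l a2 t4; qlra.
have c2 : 128 * Pm ^+ 2 * (M ^+ 2 * Phi + C * ys ^+ 2 * th0 ^+ 4 / mu) < mu * ys.
  have -> : mu * ys = A + 1 by rewrite /ys mulrC divfK// gt_eqF.
  have -> : 128 * Pm ^+ 2 * (M ^+ 2 * Phi + C * ys ^+ 2 * th0 ^+ 4 / mu) =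
    128 * Pm ^+ 2 * (M ^+ 2 * Phi) + A3 * th0 ^+ 4 by rewrite /A3; ring.
  have := ler_wpM2l a3 t4; have := ler_norm (128 * Pm ^+ 2 * (M ^+ 2 * Phi)).
  by rewrite -/A; qlra.
have c3 : ys * th0 ^+ 4 <= 4^-1 * (mu * th0 ^+ 2 * Phi1).
  have k5 : ys = 4^-1 * (mu * Phi1) * A4.
    by rewrite /A4; field; rewrite !gt_eqF.
  have -> : ys * th0 ^+ 4 = 4^-1 * (mu * th0 ^+ 2 * Phi1) * (th0 ^+ 2 * A4).
    by rewrite {1}k5; ring.
  rewrite ler_piMr//; last by qlra.
  by rewrite !mulr_ge0 ?invr_ge0// ltW.
exists th0, (4^-1 * (mu * th0 ^+ 2 * Phi1)); split => //.
  by rewrite !mulr_gt0 ?invr_gt0.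
move=> T W Wt Wx T0 Wsol; set eps := th0 * _ in Wsol.
have eps0 : 0 < eps by rewrite mulr_gt0 ?expR_gt0.
have thT : eps * expR (lam * T) = th0 by rewrite /eps -mulrA -expRD addNr expR0 mulr1.
have := remainder_small Pd P_gt0 P_le Wsd Ws1d Ws_le mu_gt0 phid phi1d phi_bnd phi1_bnd
  phi_int Wsol eps0 T0 ys0.
rewrite -/lam thT => /(_ c1 c2).
have [Wtt [Wtx [Wxx [C1 C2 C3 _ _]]]] := Wsol.
set e := (fun x => _ + _) => eT.
have ec : continuous e.
  have Wsc := d_continuous Wsd; have Ws1c := d_continuous Ws1d.
  have phi1c := d_continuous phi1d.
  have Wc := cont2_l (t := T) (C1_cont C1); have Wxc := cont2_l (t := T) (C1_cont C3).
  have Wtc := cont2_l (t := T) (C1_cont C2).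
  have iphic : continuous (fun x => (phi x)^-1).
    apply: c_V => // x; apply: lt0r_neq0; by case/andP: (phi_bnd x).
  by rewrite /e; conti.
have Wtc : continuous (Wt T) := cont2_l (C1_cont C2).
(* From [a^2 >= b^2 / 2 - (a - b)^2] with [b] the time derivative of the mode: half of its square
   minus the quarter lost to the remainder leaves the constant [c]. *)
have : integ (fun x => 2^-1 * (mu * th0 ^+ 2) * phi x ^+ 2 + -1 * e x) (-1) 1 <=
    integ (fun x => Wt T x ^+ 2) (-1) 1.
  apply: integ_le; [by conti|by conti|by qlra|move=> x _].
  have k6 : (Wt T x - lam * th0 * phi x) ^+ 2 <= e x.
    rewrite /e -addrA lerDl addr_ge0 ?sqr_ge0//; apply: mulr_ge0; [exact: ltW|exact: sqr_ge0].
  have -> : 2^-1 * (mu * th0 ^+ 2) * phi x ^+ 2 = 2^-1 * (lam * th0 * phi x) ^+ 2.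
    by rewrite -lam2; ring.
  have k7 := sqr_ge0 (2 * Wt T x - lam * th0 * phi x).
  move: k6 k7; move: (Wt T x) (lam * th0 * phi x) (e x) => a b c.
  by rewrite !expr2; qlra.
rewrite integD; [|by conti|by conti].
rewrite integZ// integZ// -/Phi1; qlra.
Qed.

End instability.

(** * The ground state at a stationary solution *)

Section stationary.
Context {R : realType} {m : R} {xs r : R -> R} {a : nat -> R} {Wst : nat -> R -> R}.
Hypothesis m_gt0 : 0 < m.
Hypothesis Hr : tortoise m xs r.
Hypothesis Hst : stationary_family m r a Wst.
Variable n : nat.
Hypothesis n_gt0 : (0 < n)%N.

Local Notation P := (potential m r).
Local Notation Ws := (Wst n).
Local Notation Ws1 := (derive1 (Wst n)).

Let smooth_derivable : forall k x, derivable (derive1n k Ws) x 1 := sf_smooth Hst n_gt0.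

Lemma d_stationary x : has_deriv Ws x (Ws1 x).
Proof. exact: derivable_d (@smooth_derivable 0%N x). Qed.

Lemma d_stationary1 x : has_deriv Ws1 x (P x * Ws x * (Ws x ^+ 2 - 1)).
Proof.
apply: (has_deriv_val (derivable_d (@smooth_derivable 1%N x))).
by have := sf_eq Hst n_gt0 x; rewrite /=; qlra.
Qed.

Lemma stationary_le1 x : `|Ws x| <= 1.
Proof. by rewrite ler_norml; exact: (sf_bound Hst n_gt0 x). Qed.

(** For [n >= 1] there is a zero, so a constant [Wst n] would vanish identically, against its
    positive limit [a n] at the horizon. *)
Lemma stationary_nonconstant : exists x, Ws1 x != 0.
Proof.
apply/not_existsP => H.
have W1 x : Ws1 x = 0 by apply/eqP; apply/negP => /negP; exact: H.
have [x0 Wx0] : exists x, Ws x = 0.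
  suff : [set x | Ws x = 0] !=set0 by [].
  apply/set0P/eqP => E; have := sf_zeros Hst n_gt0.
  rewrite E card_eq_sym card_eq0 => /eqP I0.
  by have : `I_n 0%N by []; rewrite I0.
have W0 x : Ws x = 0.
  by rewrite -Wx0; apply: d_cst_eq => y _; rewrite -(W1 y); exact: d_stationary.
have := sf_horizon Hst n_gt0; rewrite (_ : Wst n = cst 0); last exact/funext.
move=> /cvg_lim; rewrite lim_cst//.
by move=> /(_ (@norm_hausdorff _ _)) a0; have := sf_pos Hst n_gt0; rewrite -a0 ltxx.
Qed.

Lemma stationary_ground_state : exists (mu M Phi : R) (phi phi1 : R -> R), 0 < mu /\
  [/\ forall x, has_deriv phi x (phi1 x),
      forall x, has_deriv phi1 x (((3 * Ws x ^+ 2 - 1) * P x + mu) * phi x),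
      forall x, 0 < phi x <= M, forall x, `|phi1 x| <= M * phi x
    & forall a b, a <= b -> integ (fun x => phi x ^+ 2 + phi1 x ^+ 2) a b <= Phi].
Proof.
have [K [d [f [df [K0 d0 [fd dfc fK fNK fQ]]]]]] := unstable_direction m_gt0 Hr
  d_stationary d_stationary1 stationary_le1 stationary_nonconstant.
have Wc := d_continuous d_stationary; have Pc := c_potential m_gt0 Hr.
have V2 x : `|(3 * Ws x ^+ 2 - 1) * P x| <= 2 * P x.
  rewrite normrM (gtr0_norm (potential_gt0 m_gt0 Hr x)).
  apply: ler_wpM2r; first exact: ltW (potential_gt0 m_gt0 Hr x).
  have h : Ws x ^+ 2 <= 1 by rewrite -real_normK ?num_real// expr_le1 ?stationary_le1.
  by have := sqr_ge0 (Ws x); rewrite ler_norml; qlra.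
apply: (ground_state (V := fun x => (3 * Ws x ^+ 2 - 1) * P x)
  (B := 2 * (4 * m ^+ 2)^-1) _ _ _ K0 d0 fd dfc fK fNK fQ).
- by conti.
- by move=> x; apply: le_trans (V2 x) _; rewrite ler_wpM2l// (potential_le m_gt0 Hr).
- move=> e e0; have [|X X0 HX] := potential_vanishes m_gt0 Hr (e := e / 2).
    by rewrite divr_gt0.
  by exists X => // x /HX h; apply: le_trans (V2 x) _; qlra.
Qed.

End stationary.

(** [class_C2] does not identify the two mixed derivatives, whereas [wave_solution] uses a single
    one. Differentiating in time the formula that recovers [f] from its [x] derivative gives the
    equality. *)
Lemma schwarz (R : realType) (f ft fx fxt fxx : R -> R -> R) (t x l : R) :
  C1_with f ft fx -> C1_with fx fxt fxx -> has_deriv (ft t) x l -> fxt t x = l.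
Proof.
move=> [fd fxd ftc fxc] [fxtd _ fxtc _] ftxd.
have pd y : has_deriv (prim (fxt t)) y (fxt t y) by apply: d_prim; exact: cont2_l.
have E y : ft t y = ft t 0 + prim (fxt t) y.
  have h : has_deriv (fun s => f s 0 + prim (fx s) y) t (ft t 0 + prim (fxt t) y).
    by apply: d_D => //; exact: d_prim_param.
  have [_ <-] := fd t y; have [_ <-] := h; congr ('D_1 _ t).
  apply/funext => s; rewrite prim_integ; last exact: cont2_l.
  by rewrite (@integE _ (fx s) (f s))//; [ring|exact: cont2_l].
have h : has_deriv (ft t) x (fxt t x).
  have -> : ft t = fun y => ft t 0 + prim (fxt t) y by apply/funext => y; exact: E.
  by apply: (has_deriv_val (d_D (d_cst (ft t 0) x) (pd x))); rewrite add0r.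
by have [_ <-] := h; have [_ <-] := ftxd.
Qed.

Section magnetic_solutions.
Context {R : realType} {m : R} {xs r : R -> R}.
Hypothesis m_gt0 : 0 < m.
Hypothesis Hr : tortoise m xs r.
Implicit Types (W : R -> R -> R).

Lemma magnetic_solution_wave (W0 W1 : R -> R) W : magnetic_solution m r W0 W1 W ->
  wave_solution (P := potential m r) (W0 := W0) (W1 := W1) (fun u => u ^+ 3 - u)
    W (d_t W) (d_x W).
Proof.
move=> [[/class_C1_with C1 /class_C1_with C2 /class_C1_with C3] h0 h1 ym].
exists (d_t (d_t W)), (d_x (d_t W)), (d_x (d_x W)).
have [Wtd Wxd _ _] := C1; have [Wttd Wtxd Wttc Wtxc] := C2.
have [Wxtd Wxxd Wxtc Wxxc] := C3.
have E : d_t (d_x W) = d_x (d_t W).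
  by apply/funext => t; apply/funext => x; exact: (schwarz C1 C3 (Wtxd t x)).
split; [exact: C1|exact: C2|by rewrite -E; exact: C3| |by move=> x; split].
move=> t x; have := (yang_mills_wave m_gt0 Hr Wtd Wxd Wttd Wxxd).1 ym t x.
rewrite /wave_op; move: (d_t _ t x) (d_x _ t x) (W t x) => u v w; qlra.
Qed.

Lemma wave_magnetic_solution (W0 W1 : R -> R) W (Wt Wx : R -> R -> R) :
  wave_solution (P := potential m r) (W0 := W0) (W1 := W1) (fun u => u ^+ 3 - u) W Wt Wx ->
  magnetic_solution m r W0 W1 W.
Proof.
move=> [Wtt [Wtx [Wxx [C1 C2 C3 Weq Wdata]]]].
have [c1 e1 e2] := C1_with_class C1; have [c2 _ _] := C1_with_class C2.
have [c3 _ _] := C1_with_class C3.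
have [Wtd Wxd _ _] := C1; have [Wttd _ _ _] := C2; have [_ Wxxd _ _] := C3.
split; first by split; rewrite ?e1 ?e2.
- by move=> x; have [] := Wdata x.
- by move=> x; rewrite e1; have [] := Wdata x.
apply/(yang_mills_wave m_gt0 Hr Wtd Wxd Wttd Wxxd) => t x.
by rewrite /wave_op Weq; ring.
Qed.

End magnetic_solutions.

Lemma magF_eq (R : realType) (A B C A' B' C' s : R) (i k : 'I_4) :
  A = A' -> B = B' -> C = C' -> magF A B C s i k = magF A' B' C' s i k.
Proof. by move=> -> -> ->. Qed.

Lemma addrKl (V : zmodType) (u v : V) : u + v - u = v.
Proof. by rewrite addrAC subrr add0r. Qed.

Lemma subrBB (V : zmodType) (u v w : V) : (u - w) - (v - w) = u - v.
Proof. by rewrite opprB addrA subrK. Qed.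

Theorem corollary1p2 (R : realType) (m : R) (m_gt0 : 0 < m)
    (xs r : R -> R) (Hr : tortoise m xs r)
    (a : nat -> R) (Wst : nat -> R -> R) (Hst : stationary_family m r a Wst)
    (n : nat) (n_gt0 : (0 < n)%N) :
  let A_n := magnetic_connection (fun _ : R => Wst n) in
  let F_n := curvature m r A_n in
  yang_mills m r A_n /\
  exists2 eps0 : R, 0 < eps0 &
  exists W0 W1 : nat -> R -> R,
    (energy m r (tensor_sub (magnetic_curvature (W0 j) (W1 j)) F_n) 0
       @[j --> \oo] --> 0%E)
    /\
    forall j : nat,
      (exists W : R -> R -> R, magnetic_solution m r (W0 j) (W1 j) W) /\
      (forall W : R -> R -> R, magnetic_solution m r (W0 j) (W1 j) W ->
        (eps0%:E <=
         ereal_sup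
           [set energy m r
                  (tensor_sub (curvature m r (magnetic_connection W)) F_n) t
             | t in [set t : R | (0 <= t)%R]])%E).
Proof.
move=> A_n F_n.
pose Ws := Wst n; pose Ws1 := derive1 (Wst n); pose P := potential m r.
have Wd x : has_deriv Ws x (Ws1 x) := d_stationary Hst n_gt0 x.
have W1d x : has_deriv Ws1 x (P x * Ws x * (Ws x ^+ 2 - 1)) := d_stationary1 Hst n_gt0 x.
have W_le1 x : `|Ws x| <= 1 := stationary_le1 Hst n_gt0 x.
have Wc := d_continuous Wd; have W1c := d_continuous W1d.
have Pd x : has_deriv P x _ := d_potential m_gt0 Hr x.
have Pc : continuous P := d_continuous Pd.
have P1c := c_dpotential m_gt0 Hr.
have P0 x : 0 < P x := potential_gt0 m_gt0 Hr x.
have P_le x : P x <= (4 * m ^+ 2)^-1 := potential_le m_gt0 Hr x.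
have c0d (t x : R) : has_deriv (fun=> Ws x) t 0 by exact: d_cst.
have FnE t x th ph i j : F_n (event t x th ph) i j =
    magF (Ws1 x) 0 (Ws x ^+ 2 - 1) (sin th) i j.
  exact: (curvature_magnetic (Wt := fun _ _ => 0) c0d (fun _ x => Wd x)).
split.
  have c00 (t x : R) : has_deriv (fun=> 0 : R) t 0 by exact: d_cst.
  apply/(yang_mills_wave m_gt0 Hr (Wtt := fun _ _ => 0) c0d (fun _ x => Wd x)
    c00 (fun _ x => W1d x)) => t x.
  by rewrite /wave_op /P; ring.
have [mu [M [Phi [phi [phi1 [mu0 [phid phi1d phiM phi1M phiI]]]]]]] :=
  stationary_ground_state m_gt0 Hr Hst n_gt0.
have [th0 [c [th00 c0 Hc]]] := growing_mode_unstable Pd P0 P_le Wd W1d W_le1 mu0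
  phid phi1d phiM phi1M phiI.
have phic := d_continuous phid; have phi1c := d_continuous phi1d.
pose lam := Num.sqrt mu; have lam0 : 0 < lam by rewrite sqrtr_gt0.
have lam2 : lam ^+ 2 = mu by rewrite sqr_sqrtr// ltW.
(* The [j]-th mode reaches the fixed amplitude [th0] at time [j]. *)
pose eps (j : nat) := th0 * expR (- (lam * j%:R)).
have eps0 j : 0 < eps j by rewrite mulr_gt0 ?expR_gt0.
have eps_le j : eps j <= th0.
  have : expR (- (lam * j%:R)) <= expR 0.
    by rewrite ler_expR oppr_le0; apply: mulr_ge0 => //; exact: ltW.
  by rewrite expR0 => h; rewrite ler_piMr// ltW.
have W0d j x : has_deriv (fun x => Ws x + eps j * phi x) x (Ws1 x + eps j * phi1 x).
  by deriv_to; ring.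
exists c => //; exists (fun j x => Ws x + eps j * phi x), (fun j x => eps j * lam * phi x).
split.
  pose u j x := (eps j * lam * phi x) ^+ 2 + (eps j * phi1 x) ^+ 2 +
    P x / 2 * ((Ws x + eps j * phi x) ^+ 2 - Ws x ^+ 2) ^+ 2.
  have uE j : energy m r (tensor_sub (magnetic_curvature (fun x => Ws x + eps j * phi x)
      (fun x => eps j * lam * phi x)) F_n) 0 = (\int[lebesgue_measure]_x (u j x)%:E)%E.
    rewrite (energy_magF m_gt0 Hr (A := fun x => eps j * phi1 x)
      (B := fun x => eps j * lam * phi x)
      (C := fun x => (Ws x + eps j * phi x) ^+ 2 - Ws x ^+ 2))// => x th ph i k th_in.
    rewrite /tensor_sub magnetic_curvatureE FnE magF_sub (d_derive1 (W0d j x)).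
    by apply: magF_eq; [exact: addrKl|exact: subr0|exact: subrBB].
  have u0 j x : 0 <= u j x.
    by rewrite !addr_ge0 ?sqr_ge0// mulr_ge0 ?sqr_ge0// divr_ge0// ltW.
  have uc j : continuous (u j) by rewrite /u; conti.
  (* [B] bounds [2 * Ws + eps j * phi], the cofactor of [eps j * phi] in the difference of squares;
     [C] collects the coefficients of the three parts of the energy density, so the initial energy
     is at most [eps j ^+ 2 * C * Phi]. *)
  pose Pm := (4 * m ^+ 2)^-1; pose B := 2 + th0 * M.
  pose C := mu + 1 + Pm * B ^+ 2.
  have u_le j x : u j x <= eps j ^+ 2 * C * (phi x ^+ 2 + phi1 x ^+ 2).
    pose y := eps j * phi x; have y2 : y ^+ 2 = eps j ^+ 2 * phi x ^+ 2 by rewrite exprMn.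
    have /andP[p0 pM] := phiM x.
    have yB : `|y| <= th0 * M.
      by rewrite normrM !gtr0_norm// ler_pM// ltW.
    have h1 : (2 * Ws x + y) ^+ 2 <= B ^+ 2.
      rewrite -real_normK ?num_real// lerXn2r ?nnegrE//.
        by have := normr_ge0 y; rewrite /B; qlra.
      apply: le_trans (ler_normD _ _) _; rewrite normrM gtr0_norm// /B.
      by have := W_le1 x; qlra.
    have h2 : P x / 2 * ((Ws x + y) ^+ 2 - Ws x ^+ 2) ^+ 2 <= Pm * B ^+ 2 * y ^+ 2.
      have -> : P x / 2 * ((Ws x + y) ^+ 2 - Ws x ^+ 2) ^+ 2 =
        P x / 2 * (2 * Ws x + y) ^+ 2 * y ^+ 2 by ring.
      have P2 : 0 <= P x / 2 by have := P0 x; qlra.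
      rewrite ler_wpM2r ?sqr_ge0// ler_pM ?sqr_ge0//.
      by have := P_le x; have := P0 x; rewrite -/Pm; qlra.
    have h3 : 0 <= Pm * B ^+ 2 * (eps j * phi1 x) ^+ 2.
      by rewrite mulr_ge0 ?sqr_ge0// mulr_ge0 ?sqr_ge0// (le_trans (ltW (P0 x)) (P_le x)).
    have h4 := mulr_ge0 (ltW mu0) (sqr_ge0 (eps j * phi1 x)).
    have h5 := sqr_ge0 y.
    have -> : eps j ^+ 2 * C * (phi x ^+ 2 + phi1 x ^+ 2) =
        mu * y ^+ 2 + mu * (eps j * phi1 x) ^+ 2 + y ^+ 2 + (eps j * phi1 x) ^+ 2 +
        Pm * B ^+ 2 * y ^+ 2 + Pm * B ^+ 2 * (eps j * phi1 x) ^+ 2.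
      by rewrite /C /y; ring.
    have -> : u j x = mu * y ^+ 2 + (eps j * phi1 x) ^+ 2 +
        P x / 2 * ((Ws x + y) ^+ 2 - Ws x ^+ 2) ^+ 2.
      by rewrite /u /y -lam2; ring.
    by qlra.
  have uI j : (\int[lebesgue_measure]_x (u j x)%:E <= (eps j ^+ 2 * C * Phi)%:E)%E.
    apply: lebesgue_le => // b d bd.
    have iphi : continuous (fun x => phi x ^+ 2 + phi1 x ^+ 2) by conti.
    have C0 : 0 <= eps j ^+ 2 * C.
      rewrite mulr_ge0 ?sqr_ge0// /C !addr_ge0 ?(ltW mu0)//.
      by rewrite mulr_ge0 ?sqr_ge0// (le_trans (ltW (P0 0)) (P_le 0)).
    apply: le_trans (ler_wpM2l C0 (phiI b d bd)); rewrite -integZ//.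
    by apply: integ_le => //; conti.
  apply: (@squeeze_cvge _ _ _ _ (cst 0%E) _ (fun j => (eps j ^+ 2 * C * Phi)%:E)).
  - apply: nearW => j; rewrite uE uI andbT.
    by apply: integral_ge0 => x _; rewrite lee_fin.
  - exact: cvg_cst.
  have -> : (fun j => (eps j ^+ 2 * C * Phi)%:E) =
      (fun j => (geometric (th0 ^+ 2 * C * Phi) (expR (- lam) ^+ 2) j)%:E).
    apply/funext => j; congr EFin; rewrite /geometric/=.
    have -> : eps j = th0 * expR (- lam) ^+ j.
      by rewrite /eps -expRM_natl; congr (_ * expR _); ring.
    by rewrite exprMn -!exprM mulnC; ring.
  apply/fine_cvgP; split; first exact: nearW.
  apply: cvg_geometric.
  by rewrite ger0_norm ?exprn_ge0 ?expR_ge0// expr_lt1 ?expR_ge0// expR_lt1 oppr_lt0.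
move=> j; split.
  have W0pd x : has_deriv (fun x => Ws1 x + eps j * phi1 x) x
      (P x * Ws x * (Ws x ^+ 2 - 1) + eps j * (((3 * Ws x ^+ 2 - 1) * P x + mu) * phi x)).
    apply: (has_deriv_val (d_D (W1d x) (d_M (d_cst (eps j) x) (phi1d x)))).
    by rewrite mul0r add0r.
  have W1pd x : has_deriv (fun x => eps j * lam * phi x) x (eps j * lam * phi1 x).
    apply: (has_deriv_val (d_M (d_cst (eps j * lam) x) (phid x))).
    by rewrite mul0r add0r.
  have [||W [Wt [Wx Wsol]]] := wave_exists Pd P1c P0 P_le (W0d j) W0pd _ W1pd _.
  - by conti.
  - by conti.
  by exists W; exact: (wave_magnetic_solution m_gt0 Hr Wsol).
move=> W /(magnetic_solution_wave m_gt0 Hr) Wsol.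
have j0 : 0 <= j%:R :> R by [].
have cW := Hc _ _ _ _ j0 Wsol.
have [Wtt [Wtx [Wxx [C1 C2 C3 _ _]]]] := Wsol.
have [Wtd Wxd _ _] := C1.
(* The supremum is tested at [t = j]. There the time derivative on [[-1, 1]] alone already
   contributes [c], and the other terms of the density are nonnegative. *)
apply: le_trans (ereal_sup_ubound _); last by exists j%:R.
pose v x := (d_t W j%:R x) ^+ 2 + (d_x W j%:R x - Ws1 x) ^+ 2 +
  P x / 2 * (W j%:R x ^+ 2 - Ws x ^+ 2) ^+ 2.
rewrite (energy_magF m_gt0 Hr (A := fun x => d_x W j%:R x - Ws1 x)
  (B := d_t W j%:R) (C := fun x => W j%:R x ^+ 2 - Ws x ^+ 2)); last first.
  move=> x th ph i k th_in; rewrite /tensor_sub FnE (curvature_magnetic Wtd Wxd) magF_sub.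
  by apply: magF_eq; [|exact: subr0|exact: subrBB].
have k1 : continuous (W j%:R) := cont2_l (C1_cont C1).
have k2 : continuous (d_t W j%:R) := cont2_l (C1_cont C2).
have k3 : continuous (d_x W j%:R) := cont2_l (C1_cont C3).
have vc : continuous v by rewrite /v; conti.
have v1 x : 0 <= P x / 2 * (W j%:R x ^+ 2 - Ws x ^+ 2) ^+ 2.
  by rewrite mulr_ge0 ?sqr_ge0// divr_ge0// ltW.
have v0 x : 0 <= v x by rewrite !addr_ge0 ?sqr_ge0.
have ab : -1 < 1 :> R by qlra.
apply: le_trans (integ_le_lebesgue vc v0 ab); rewrite lee_fin; apply: (le_trans cW).
apply: integ_le; [by conti|exact: vc|by qlra|move=> x _].
by rewrite /v -addrA lerDl addr_ge0 ?sqr_ge0.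
Qed.
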